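(* Let $y_0\in L^2(\Omega)$ and let $G\in L^\infty(Q_T)$. With the spaces $Z,P,\Lambda$, the forms $k,\alpha,\beta$ and the linear forms $\ell_0,\ell$ defined in the context, consider the variational problem (A) find $p\in P$ such that $k(p,p')=\langle \ell_0,p'\rangle$ for all $p'\in P$, and the mixed problem (B) find $((z,p),\lambda)\in (Z\times P)\times\Lambda$ such that $$\alpha((z,p),(z',p'))+\beta((z',p'),\lambda)=\langle \ell,(z',p')\rangle,\qquad \beta((z,p),\lambda')=0$$ for all $(z',p',\lambda')\in Z\times P\times\Lambda$. Then there exists exactly one solution to (B). Furthermore, (A) and (B) are equivalent in the following sense: 1. If $((z,p),\lambda)$ solves (B), then $p$ solves (A). 2. Conversely, if $p$ solves (A), there exists $\lambda\in\Lambda$ such that $((z,p),\lambda)$, with $z:=L^*p$, solves (B).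
   Context: $\Omega\subset\mathbb{R}^2$ is a bounded domain with regular enough boundary $\Gamma=\partial\Omega$, $\omega\subset\Omega$ is a nonempty open subset, $T>0$, $Q_T=\Omega\times(0,T)$, $\Sigma_T=\Gamma\times(0,T)$, and $1_\omega$ is the characteristic function of $\omega$. Put $L^*p:=-p_t-\Delta p+G(\mathbf{x},t)\,p$. Weights: $$\rho(\mathbf{x},t)=e^{\chi(\mathbf{x})/(T-t)},\quad \chi(\mathbf{x})=K_1\left(e^{K_2}-e^{\chi_0(\mathbf{x})}\right),\quad \rho_i(\mathbf{x},t)=(T-t)^{3/2-i}\rho(\mathbf{x},t),\ i=0,1,2,$$ where $\chi_0$ is a regular bounded function, positive in $\Omega$, vanishing on $\Gamma$, with $|\nabla\chi_0|>0$ in $\overline\Omega\setminus\omega$, and $K_1,K_2>0$ are sufficiently large constants (depending on $T$). Let $P_0=\{p\in C^2(\overline Q_T): p=0 \text{ on }\Sigma_T\}$. The weights are such that the following (known) Carleman inequality holds for some constant $C_0>0$ and all $p\in P_0$: $$\iint_{Q_T}\left[\rho_2^{-2}(|p_t|^2+|\Delta p|^2)+\rho_1^{-2}|\nabla p|^2+\rho_0^{-2}|p|^2\right]d\mathbf{x}\,dt\le C_0\iint_{Q_T}\left(\rho^{-2}|L^*p|^2+\rho_0^{-2}|p|^2 1_\omega\right)d\mathbf{x}\,dt.$$ The bilinear form $$k(p,p')=\iint_{Q_T}\left(\rho^{-2}L^*p\,L^*p'+1_\omega\rho_0^{-2}p\,p'\right)d\mathbf{x}\,dt$$ is a scalar product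 on $P_0$; $P$ is the Hilbert space obtained as the completion of $P_0$ for this scalar product. By the Carleman inequality the elements of $P$ are functions on $Q_T$, $L^*p$ is well defined for $p\in P$ with $\rho^{-1}L^*p\in L^2(Q_T)$, and $p(\cdot,0)$ makes sense with $\|p(\cdot,0)\|_{H^1_0(\Omega)}\le C\,k(p,p)^{1/2}$. $Z=L^2(\rho^{-1};Q_T)$ is the space of measurable $z$ with $\iint_{Q_T}\rho^{-2}|z|^2\,d\mathbf{x}\,dt<+\infty$, and $\Lambda=L^2(\rho;Q_T)$ is the space of measurable $\lambda$ with $\iint_{Q_T}\rho^{2}|\lambda|^2\,d\mathbf{x}\,dt<+\infty$, each with the corresponding Hilbert norm. Forms, for $(z,p),(z',p')\in Z\times P$, $\lambda\in\Lambda$: $$\alpha((z,p),(z',p'))=\iint_{Q_T}\left(\rho^{-2}z\,z'+\rho_0^{-2}p\,p'1_\omega\right)d\mathbf{x}\,dt,\qquad \beta((z,p),\lambda)=\iint_{Q_T}[L^*p-z]\,\lambda\,d\mathbf{x}\,dt,$$ $$\langle \ell_0,p\rangle=\langle\ell,(z,p)\rangle=\int_\Omega y_0(\mathbf{x})\,p(\mathbf{x},0)\,d\mathbf{x}.$$ *)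

(* Defs.v *)
From HB Require Import structures.
From mathcomp Require Import all_boot all_order all_algebra.
From mathcomp Require Import all_classical all_reals all_analysis.
Set Implicit Arguments.
Unset Strict Implicit.
Unset Printing Implicit Defensive.
Import Order.TTheory GRing.Theory Num.Theory.
Import numFieldNormedType.Exports.
Local Open Scope classical_set_scope.
Local Open Scope ring_scope.

Section C2_up_to_the_boundary.
Context (R : realType) (V : normedModType R).

Definition continuous_extension (U : set V) (f g : V -> R) : Prop :=
  {within closure U, continuous g} /\ {in U, f =1 g}.

(* C^2(closure U) for an open U: f is continuous on closure U, and its partial
   derivatives of order 1 and 2 along the directions listed in B (the canonical
   basis) exist in U and extend continuously to closure U. *)
Definition C2_closure (B : seq V) (U : set V) (f : V -> R) : Prop :=
  [/\ {within closure U, continuous f},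
      (forall v, v \in B -> {in U, forall x, derivable f x v} /\
        exists g, continuous_extension U ('D_v f) g) &
      (forall v w, v \in B -> w \in B ->
        {in U, forall x, derivable ('D_v f) x w} /\
        exists g, continuous_extension U ('D_w ('D_v f)) g)].

End C2_up_to_the_boundary.

Section Weighted_L2.
Context d (X : measurableType d) (R : realType).
Variable mu : {measure set X -> \bar R}.

Definition sq_integral (D : set X) (w f : X -> R) : \bar R :=
  (\int[mu]_(x in D) ((w x) ^+ 2 * (f x) ^+ 2)%:E)%E.

Definition wL2 (D : set X) (w : X -> R) : set (X -> R) :=
  [set f : X -> R | measurable_fun D f /\ (sq_integral D w f < +oo)%E].

(* Convergence in the weighted L^2 norm, stated with extended-real integrals so
   that a non-integrable difference is never at distance 0. *)
Definition wL2_cvg (D : set X) (w : X -> R) (u : nat -> X -> R) (f : X -> R) :=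
  (fun n => sq_integral D w (fun x => u n x - f x)) @ \oo --> 0%E.

Definition Linfty (D : set X) : set (X -> R) :=
  [set f : X -> R | measurable_fun D f /\
    exists M : R, {ae mu, forall x, D x -> `|f x| <= M}].

End Weighted_L2.

Section Lebesgue_measures.
Context (R : realType).

Definition leb2 :
    {measure set (measurableTypeR R * measurableTypeR R)%type -> \bar R} :=
  (@lebesgue_measure R \x @lebesgue_measure R)%E.

Definition leb3 :
    {measure set ((measurableTypeR R * measurableTypeR R) * measurableTypeR R)%type
       -> \bar R} :=
  (leb2 \x @lebesgue_measure R)%E.

End Lebesgue_measures.
Arguments leb2 {R}.
Arguments leb3 {R}.

(* A point of R^2 is x : R * R; a point of R^2 x R is X : R * R * R, with space
   part X.1 and time part X.2. *)
Section Domains.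
Context (R : realType).
Implicit Types (Omega omega : set (R * R)) (T : R).

Definition basis2 : seq (R * R) := [:: (1, 0); (0, 1)].
Definition dx1 : R * R * R := (1, 0, 0).
Definition dx2 : R * R * R := (0, 1, 0).
Definition dt : R * R * R := (0, 0, 1).
Definition basis3 : seq (R * R * R) := [:: dx1; dx2; dt].

Definition bounded_domain Omega : Prop :=
  [/\ open Omega, connected Omega, Omega !=set0 & bounded_set Omega].

Definition bd Omega : set (R * R) := closure Omega `\` Omega°.

(* Regularity of the boundary: near each boundary point, Omega is a strict
   sublevel set of a C^2 function with nonzero gradient at that point. *)
Definition C2_boundary Omega : Prop :=
  forall x0, bd Omega x0 -> exists (U : set (R * R)) (phi : R * R -> R),
    [/\ open U, U x0, C2_closure basis2 setT phi,
        exists2 v, v \in basis2 & 'D_v phi x0 != 0 &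
        Omega `&` U = [set x | phi x < 0] `&` U].

(* The gradient on closure Omega is the continuous extension of the gradient. *)
Definition admissible_chi0 Omega omega (chi0 : R * R -> R) : Prop :=
  [/\ C2_closure basis2 Omega chi0,
      forall x, Omega x -> 0 < chi0 x,
      forall x, bd Omega x -> chi0 x = 0 &
      exists g1 g2 : R * R -> R,
        [/\ continuous_extension Omega ('D_((1, 0) : R * R) chi0) g1,
            continuous_extension Omega ('D_((0, 1) : R * R) chi0) g2 &
            forall x, (closure Omega `\` omega) x ->
              0 < Num.sqrt (g1 x ^+ 2 + g2 x ^+ 2)]].

Definition cylinder Omega T : set (R * R * R) := Omega `*` `]0, T[%classic.
Definition lateral Omega T : set (R * R * R) := bd Omega `*` `]0, T[%classic.

End Domains.

Section Weights.
Context (R : realType).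
Variables (T : R) (chi0 : R * R -> R) (K1 K2 : R).

Definition chi (x : R * R) : R := K1 * (expR K2 - expR (chi0 x)).

Definition rho (X : R * R * R) : R := expR (chi X.1 / (T - X.2)).

Definition rho_ (i : nat) (X : R * R * R) : R :=
  (T - X.2) `^ (3 / 2 - i%:R) * rho X.

End Weights.

Section Spaces_and_forms.
Context (R : realType).
Variables (Omega omega : set (R * R)) (T : R).
Variables (chi0 : R * R -> R) (K1 K2 : R) (G : R * R * R -> R).

Local Notation QT := (cylinder Omega T).
Local Notation rho := (rho T chi0 K1 K2).
Local Notation rho_ := (rho_ T chi0 K1 K2).
Implicit Types (p q z lam : R * R * R -> R) (r : R * R -> R).

Definition laplacian p (X : R * R * R) : R :=
  'D_(dx1 R) ('D_(dx1 R) p) X + 'D_(dx2 R) ('D_(dx2 R) p) X.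

Definition Lstar0 p (X : R * R * R) : R :=
  - 'D_(dt R) p X - laplacian p X + G X * p X.

Definition P0 : set (R * R * R -> R) :=
  [set p | C2_closure (basis3 R) QT p /\ forall X, lateral Omega T X -> p X = 0].

Definition carleman (C0 : R) : Prop :=
  forall p, P0 p ->
    (\int[leb3]_(X in QT)
       (rho_ 2 X ^- 2 * ('D_(dt R) p X ^+ 2 + laplacian p X ^+ 2)
        + rho_ 1 X ^- 2 * ('D_(dx1 R) p X ^+ 2 + 'D_(dx2 R) p X ^+ 2)
        + rho_ 0 X ^- 2 * p X ^+ 2)%:E
     <= C0%:E * \int[leb3]_(X in QT)
       (rho X ^- 2 * Lstar0 p X ^+ 2
        + rho_ 0 X ^- 2 * p X ^+ 2 * \1_omega X.1)%:E)%E.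

(* The form k, for a given realization L of the operator L^*. *)
Definition kform_of (L : (R * R * R -> R) -> R * R * R -> R) p p' : R :=
  \int[leb3]_(X in QT)
    (rho X ^- 2 * L p X * L p' X + \1_omega X.1 * rho_ 0 X ^- 2 * p X * p' X).

(* An element of the completion of P0, realized as a function p on QT, is the
   limit, in the norm of rho_0^-1 p in L^2(QT) provided by the Carleman
   inequality, of a sequence of P0 which is Cauchy for k. *)
Definition k_approx (u : nat -> R * R * R -> R) p : Prop :=
  [/\ forall n, P0 (u n),
      forall e : R, 0 < e -> exists N : nat, forall m n,
        (N <= m)%N -> (N <= n)%N ->
        kform_of Lstar0 (u m \- u n) (u m \- u n) < e &
      wL2_cvg leb3 QT (fun X => (rho_ 0 X)^-1) u p].

Definition P_space : set (R * R * R -> R) :=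
  [set p | wL2 leb3 QT (fun X => (rho_ 0 X)^-1) p /\ exists u, k_approx u p].

Definition Z_space : set (R * R * R -> R) := wL2 leb3 QT (fun X => (rho X)^-1).
Definition Lambda_space : set (R * R * R -> R) := wL2 leb3 QT rho.

(* Extensions by continuity, from P0 to P, of L^* (with values in Z) and of the
   initial trace p |-> p(., 0) (with values in L^2(Omega)). They are determined
   up to equality almost everywhere; xget selects a representative. *)
Definition Lstar p : R * R * R -> R :=
  xget (cst 0) [set q | Z_space q /\ exists u, k_approx u p /\
    wL2_cvg leb3 QT (fun X => (rho X)^-1) (fun n => Lstar0 (u n)) q].

Definition trace0 p : R * R -> R :=
  xget (cst 0) [set r | wL2 leb2 Omega (cst 1) r /\ exists u, k_approx u p /\
    wL2_cvg leb2 Omega (cst 1) (fun n x => u n (x, 0)) r].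

Definition kform := kform_of Lstar.

Definition alpha (zp zp' : (R * R * R -> R) * (R * R * R -> R)) : R :=
  \int[leb3]_(X in QT)
    (rho X ^- 2 * zp.1 X * zp'.1 X
     + rho_ 0 X ^- 2 * zp.2 X * zp'.2 X * \1_omega X.1).

Definition beta (zp : (R * R * R -> R) * (R * R * R -> R)) lam : R :=
  \int[leb3]_(X in QT) ((Lstar zp.2 X - zp.1 X) * lam X).

Definition ell0 (y0 : R * R -> R) p : R := \int[leb2]_(x in Omega) (y0 x * trace0 p x).

Definition ell (y0 : R * R -> R) (zp : (R * R * R -> R) * (R * R * R -> R)) : R := ell0 y0 zp.2.

Definition solves_A (y0 : R * R -> R) p : Prop :=
  P_space p /\ forall p', P_space p' -> kform p p' = ell0 y0 p'.

Definition solves_B (y0 : R * R -> R) (zp : (R * R * R -> R) * (R * R * R -> R)) lam : Prop :=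
  [/\ Z_space zp.1, P_space zp.2, Lambda_space lam &
    forall z' p' lam', Z_space z' -> P_space p' -> Lambda_space lam' ->
      alpha zp (z', p') + beta (z', p') lam = ell y0 (z', p') /\
      beta zp lam' = 0].

End Spaces_and_forms.

(* Main.v *)
Require Import Defs.
From HB Require Import structures.
From mathcomp Require Import all_boot all_order all_algebra.
From mathcomp Require Import all_classical all_reals all_analysis.
From mathcomp Require Import measurable_realfun.
From mathcomp Require Import ring lra.
Set Implicit Arguments.
Unset Strict Implicit.
Unset Printing Implicit Defensive.
Import Order.TTheory GRing.Theory Num.Theory.
Import numFieldNormedType.Exports.
Local Open Scope classical_set_scope.
Local Open Scope ring_scope.

(** Both problems live on the completion P of P0 for k, and the substance of the
    proof is that P is faithfully a space of functions: an element p of P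
    determines L^* p and p(., 0) almost everywhere, and p, L^* p, p(., 0) all
    depend continuously on p for the norm of k.

    Continuity holds on P0.  The form k bounds rho^-1 L^* p by definition, and
    bounds rho_0^-1 p by the Carleman inequality (carleman_L2).  For the trace,
    the weights are bounded above on the first half of the time interval
    (weights_early_lb), so the Carleman inequality bounds p and p_t in L^2 there,
    and the fundamental theorem of calculus in time bounds p(., 0) in L^2
    (initial_value_bound, trace_bound).  Hence a k-Cauchy sequence of P0 converges
    in all three components (k_cauchy_graph_cvg).

    The limits of L^* u_n and u_n(., 0) depend only on the limit p of u_n because
    the two operators are closable.  For L^* (Lstar0_closable), suppose that
    w_n -> 0 and L^* w_n -> h locally in L^2.  Integrating by parts on a box
    against a product of polynomials that vanish with their first derivative at
    the end points (green_box) shows that h is orthogonal to this product.  Letting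
    the polynomials increase to the indicators of the open edges shows that h has
    integral zero over every open box (limit_integral_obox_eq0).  A Dynkin class
    argument in each coordinate (integral_eq0_measurable) passes to all measurable
    sets, so h = 0.  Once w_n -> 0 and L^* w_n -> 0, also k(w_n, w_n) -> 0, and the
    trace bound sends the traces to 0 (graph_cvg_eq0).  This gives
    graph_cvg_unique, and identifies the chosen representatives Lstar p and
    trace0 p with the limits along any approximating sequence
    (graph_cvg_operators).

    Existence for (A) is the Riesz representation theorem, obtained directly: a
    minimising sequence of k(p, p) - 2 <l_0, p> in P0 is k-Cauchy by the
    parallelogram identity, and its limit in P satisfies the variational equation
    (riesz_minimizing_sequence, exists_solves_A).  Uniqueness is the Carleman
    inequality extended to P (graph_carleman, solves_A_unique).

    For the equivalence, the second equation of (B) says z = L^* p: take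
    lambda' = rho^-2 (L^* p - z) (solves_B_z).  Taking z' = L^* p' in the first
    equation cancels the multiplier and leaves (A) (solves_B_A).  Taking p' = 0
    gives lambda = rho^-2 z (solves_B_lam), and with this multiplier (A) implies
    (B) (solves_A_B).  Uniqueness for (B) follows from uniqueness for (A). *)

(** * Square-integrable functions *)

Section L2.
Context d (X : measurableType d) (R : realType).
Variables (mu : {measure set X -> \bar R}) (D : set X).
Hypothesis mD : measurable D.
Implicit Types f g h : X -> R.

Definition sqint f : Prop :=
  measurable_fun D f /\ (\int[mu]_(x in D) (f x ^+ 2)%:E < +oo)%E.

(** The real-valued integral is zero when the integrand is not integrable, so this
    is the inner product of L^2 only between functions satisfying sqint, where
    ip_fin recovers the extended-real integral. *)
Definition ip f g : R := \int[mu]_(x in D) (f x * g x).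

Lemma sqint_integrable f : sqint f -> mu.-integrable D (fun x => (f x ^+ 2)%:E).
Proof.
move=> [mf foo]; apply/integrableP; split.
  by apply/measurable_EFinP; exact: measurable_funX.
by under eq_integral do rewrite gee0_abs ?lee_fin ?sqr_ge0//.
Qed.

Lemma integrable_mul f g : sqint f -> sqint g ->
  mu.-integrable D (EFin \o (fun x => f x * g x)).
Proof.
move=> sf sg.
apply: (@le_integrable _ _ _ _ _ mD _ (fun x => (f x ^+ 2 + g x ^+ 2)%:E)).
- by apply/measurable_EFinP; apply: measurable_funM; [case: sf|case: sg].
- move=> x Dx /=; rewrite lee_fin [leRHS]ger0_norm; last first.
    by rewrite addr_ge0 ?sqr_ge0.
  have := sqr_ge0 (f x - g x); have := sqr_ge0 (f x + g x).
  by rewrite ler_norml => ? ?; apply/andP; split; nra.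
- have := integrableD mD (sqint_integrable sf) (sqint_integrable sg).
  by apply: eq_integrable.
Qed.

Lemma ip_fin f g : sqint f -> sqint g ->
  (\int[mu]_(x in D) (f x * g x)%:E)%E = (ip f g)%:E.
Proof.
move=> sf sg; rewrite /ip /Rintegral fineK//.
exact: (integrable_fin_num mD (integrable_mul sf sg)).
Qed.

Lemma ipC f g : ip f g = ip g f.
Proof. by apply: eq_Rintegral => x _; rewrite mulrC. Qed.

Lemma sqintD f g : sqint f -> sqint g -> sqint (f \+ g).
Proof.
move=> sf sg; split; first by apply: measurable_funD; [case: sf|case: sg].
have i2 := integrableD mD (integrableD mD (sqint_integrable sf)
  (sqint_integrable sg)) (integrableZl mD 2 (integrable_mul sf sg)).
have := integrable_lty mD i2; rewrite (_ : (fun x => _) = (fun x => ((f \+ g) x ^+ 2)%:E))//.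
by apply/funext => x /=; congr EFin; ring.
Qed.

Lemma sqintZ a f : sqint f -> sqint (a \*: f).
Proof.
move=> sf; split; first by apply: measurable_funM; [exact: measurable_cst|case: sf].
have := integrable_lty mD (integrableZl mD (a ^+ 2) (sqint_integrable sf)).
by rewrite (_ : (fun x => _) = (fun x => ((a \*: f) x ^+ 2)%:E))//;
  apply/funext => x /=; congr EFin; rewrite /GRing.scale/=; ring.
Qed.

Lemma sqintN f : sqint f -> sqint (\- f).
Proof.
move=> sf; rewrite (_ : \- f = (-1) \*: f); first exact: sqintZ.
by apply/funext => x /=; rewrite /GRing.scale/= mulN1r.
Qed.

Lemma sqintB f g : sqint f -> sqint g -> sqint (f \- g).
Proof. by move=> sf sg; apply: sqintD => //; exact: sqintN. Qed.

Lemma sqint_le f g : measurable_fun D f ->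
  (forall x, D x -> `|f x| <= `|g x|) -> sqint g -> sqint f.
Proof.
move=> mf fg [mg goo]; split => //; apply: le_lt_trans goo.
apply: ge0_le_integral => //.
- by move=> x _; rewrite lee_fin sqr_ge0.
- by apply/measurable_EFinP; exact: measurable_funX.
- by apply/measurable_EFinP; exact: measurable_funX.
- move=> x Dx; rewrite lee_fin -(real_normK (num_real (f x))).
  rewrite -(real_normK (num_real (g x))).
  by rewrite lerXn2r ?nnegrE// fg.
Qed.

Lemma eq_sqint f g : (forall x, D x -> f x = g x) -> sqint f -> sqint g.
Proof.
move=> fg [mf foo]; split.
  by apply: eq_measurable_fun mf => x /set_mem/fg.
rewrite (eq_integral (fun x => (f x ^+ 2)%:E))// => x /set_mem xD.
by rewrite fg.
Qed.

Lemma ipDl f g h : sqint f -> sqint g -> sqint h ->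
  ip (f \+ g) h = ip f h + ip g h.
Proof.
move=> sf sg sh; rewrite /ip -RintegralD//; [|exact: integrable_mul..].
by apply: eq_Rintegral => x _ /=; rewrite mulrDl.
Qed.

Lemma ipZl a f h : sqint f -> sqint h -> ip (a \*: f) h = a * ip f h.
Proof.
move=> sf sh; rewrite /ip -RintegralZl//; last exact: integrable_mul.
by apply: eq_Rintegral => x _ /=; rewrite /GRing.scale/= mulrA.
Qed.

Lemma ipBl f g h : sqint f -> sqint g -> sqint h ->
  ip (f \- g) h = ip f h - ip g h.
Proof.
move=> sf sg sh; rewrite /ip -RintegralB//; [|exact: integrable_mul..].
by apply: eq_Rintegral => x _ /=; rewrite mulrBl.
Qed.

Lemma ip_ge0 f : 0 <= ip f f.
Proof. by apply: Rintegral_ge0 => x _; rewrite -expr2 sqr_ge0. Qed.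

Lemma ip_polar f g (t : R) : sqint f -> sqint g ->
  ip (f \+ (t \*: g)) (f \+ (t \*: g)) = ip f f + 2 * t * ip f g + t ^+ 2 * ip g g.
Proof.
move=> sf sg; have stg := sqintZ t sg; have sD := sqintD sf stg.
rewrite ipDl// ipZl// (ipC f) (ipC g) !ipDl// !ipZl// (ipC g f); ring.
Qed.

(** The quadratic t |-> ip (f + t g) (f + t g) is nonnegative, so its discriminant
    is at most 0. *)
Lemma cauchy_schwarz f g : sqint f -> sqint g ->
  ip f g ^+ 2 <= ip f f * ip g g.
Proof.
move=> sf sg.
have P t : 0 <= ip f f + 2 * t * ip f g + t ^+ 2 * ip g g.
  by rewrite -ip_polar// ip_ge0.
(* for ip g g = 0 the quadratic is affine, and nonnegative only if constant *)
have [g0|gn0] := eqVneq (ip g g) 0.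
  have [->|fg0] := eqVneq (ip f g) 0; first by rewrite g0 mulr0 expr0n.
  have := P (- (ip f f + 1) / (2 * ip f g)).
  rewrite g0 mulr0 addr0.
  have -> : 2 * (- (ip f f + 1) / (2 * ip f g)) * ip f g = - (ip f f + 1) by field.
  lra.
have gp : 0 < ip g g by rewrite lt_neqAle eq_sym gn0 ip_ge0.
have := P (- ip f g / ip g g).
have -> : ip f f + 2 * (- ip f g / ip g g) * ip f g +
  (- ip f g / ip g g) ^+ 2 * ip g g = (ip f f * ip g g - ip f g ^+ 2) / ip g g by field.
by rewrite pmulr_lge0 ?invr_gt0// subr_ge0.
Qed.

Lemma ip_triangleB f g : sqint f -> sqint g ->
  ip (f \- g) (f \- g) <= 2 * ip f f + 2 * ip g g.
Proof.
move=> sf sg; rewrite (_ : f \- g = f \+ ((-1) \*: g)); last first.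
  by apply/funext => x /=; rewrite scaleN1r.
rewrite ip_polar// sqrrN expr1n.
have := ip_ge0 (f \+ (1 \*: g)); rewrite ip_polar// expr1n.
by move: (ip f f) (ip g g) (ip f g) => a b c; lra.
Qed.

Lemma ip_eq0 f : sqint f -> ip f f = 0 -> ae_eq mu D f (cst 0).
Proof.
move=> sf f0.
have mf2 : measurable_fun D (fun x => (f x * f x)%:E).
  by apply/measurable_EFinP; apply: measurable_funM; case: sf.
have : ae_eq mu D (fun x => (f x * f x)%:E) (cst 0%E).
  apply/(ae_eq_integral_abs _ mD) => //.
  rewrite -[RHS](_ : (ip f f)%:E = 0%E); last by rewrite f0.
  rewrite -ip_fin//; apply: eq_integral => x _.
  by rewrite gee0_abs// lee_fin -expr2 sqr_ge0.
apply: filterS => x h Dx; have := h Dx => /= /eqP.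
by rewrite eqe mulf_eq0 orbb => /eqP.
Qed.

Lemma ae_ip f f' g : measurable_fun D f -> measurable_fun D f' ->
  measurable_fun D g -> ae_eq mu D f f' -> ip f g = ip f' g.
Proof.
move=> mf mf' mg ff'; rewrite /ip /Rintegral; congr fine.
apply: ae_eq_integral => //.
- by apply/measurable_EFinP; exact: measurable_funM.
- by apply/measurable_EFinP; exact: measurable_funM.
- by move: ff'; apply: filterS => x h Dx /=; rewrite h.
Qed.

Lemma ip_cvgl (u : nat -> X -> R) f g : (forall n, sqint (u n)) -> sqint f ->
  sqint g -> ip (u n \- f) (u n \- f) @[n --> \oo] --> 0 ->
  ip (u n) g @[n --> \oo] --> ip f g.
Proof.
move=> su sf sg u0.
apply/cvgrPdist_lt => e e0.
have G := ip_ge0 g.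
have d0 : 0 < e ^+ 2 / (ip g g + 1) by rewrite divr_gt0// ?exprn_gt0//; lra.
have /cvgrPdist_lt/(_ _ d0) := u0.
apply: filterS => n; rewrite sub0r normrN ger0_norm ?ip_ge0// => h.
rewrite distrC -ipBl// -(@ltr_pXn2r _ 2) ?nnegrE// ?ltW//.
rewrite real_normK ?num_real//.
apply: le_lt_trans (cauchy_schwarz (sqintB (su n) sf) sg) _.
move: h; rewrite ltr_pdivlMr; last lra.
have := ip_ge0 (u n \- f); nra.
Qed.

(** Expanding ip (u n - f) (v n - g), which tends to 0 by Cauchy-Schwarz, leaves terms
    in which only one factor varies. *)
Lemma ip_cvg2 (u v : nat -> X -> R) f g :
  (forall n, sqint (u n)) -> (forall n, sqint (v n)) -> sqint f -> sqint g ->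
  ip (u n \- f) (u n \- f) @[n --> \oo] --> 0 ->
  ip (v n \- g) (v n \- g) @[n --> \oo] --> 0 ->
  ip (u n) (v n) @[n --> \oo] --> ip f g.
Proof.
move=> su sv sf sg u0 v0.
have -> : (fun n => ip (u n) (v n)) =
  (fun n => ip (u n \- f) (v n \- g) + ip (u n) g + ip (v n) f - ip f g).
  apply/funext => n; rewrite ipBl//; last exact: sqintB.
  rewrite (ipC (u n) (_ \- _)) (ipC f (_ \- _)) !ipBl//.
  rewrite (ipC g (u n)) (ipC g f) (ipC (v n) (u n)); ring.
rewrite -[X in _ --> X](_ : 0 + ip f g + ip g f - ip f g = _); last first.
  by rewrite (ipC g f); ring.
apply: cvgB; last exact: cvg_cst.
apply: cvgD; last exact: ip_cvgl.
apply: cvgD; last exact: ip_cvgl.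
apply/cvgrPdist_lt => e e0.
near=> n.
have U : ip (u n \- f) (u n \- f) < e.
  near: n; have /cvgrPdist_lt/(_ _ e0) := u0.
  by apply: filterS => n; rewrite sub0r normrN ger0_norm// ip_ge0.
have V : ip (v n \- g) (v n \- g) < e.
  near: n; have /cvgrPdist_lt/(_ _ e0) := v0.
  by apply: filterS => n; rewrite sub0r normrN ger0_norm// ip_ge0.
rewrite sub0r normrN -(@ltr_pXn2r _ 2) ?nnegrE// ?ltW// real_normK ?num_real//.
apply: le_lt_trans (cauchy_schwarz (sqintB (su n) sf) (sqintB (sv n) sg)) _.
have := ip_ge0 (u n \- f); have := ip_ge0 (v n \- g); nra.
Unshelve. all: by end_near. Qed.

End L2.

(** * Completeness of L^2 *)

Section L2_complete.
Context d (X : measurableType d) (R : realType).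
Variables (mu : {measure set X -> \bar R}) (D : set X).
Hypothesis mD : measurable D.

Local Notation ip := (ip mu D).
Local Notation sqint := (sqint mu D).

(** The series of the 4 ^ k |v (k + 1) - v k| ^ 2 has a finite integral, hence is
    finite almost everywhere; there the increments are O(2 ^ -k), so summable. *)
Lemma rapid_cauchy_ae_cvg (v : nat -> X -> R) : (forall k, sqint (v k)) ->
  (forall k, ip (v k.+1 \- v k) (v k.+1 \- v k) <= (8^-1) ^+ k) ->
  {ae mu, forall x, D x -> cvgn (v ^~ x)}.
Proof.
move=> sv v8.
pose dv k x := (4 ^+ k * (v k.+1 x - v k x) ^+ 2)%:E : \bar R.
have dv0 k x : (0 <= dv k x)%E.
  by rewrite lee_fin; apply: mulr_ge0; [exact: exprn_ge0|exact: sqr_ge0].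
have mdv k : measurable_fun D (dv k).
  apply/measurable_EFinP; apply: measurable_funM; first exact: measurable_cst.
  by apply/measurable_funX/measurable_funB; [case: (sv k.+1)|case: (sv k)].
have idv : (\int[mu]_(x in D) (\sum_(k <oo) dv k x) <= 2%:E)%E.
  rewrite integral_nneseries//.
  have -> : 2%:E = (\sum_(k <oo) (2 / (2 ^ (k + 1))%:R)%:E : \bar R)%E.
    apply/esym/cvg_lim => //; have := @cvg_geometric_eseries_half R 2 0.
    by rewrite expr0 divr1.
  apply: lee_nneseries; first by move=> k _ _; exact: integral_ge0.
  move=> k _; rewrite /dv.
  have sdv : sqint (v k.+1 \- v k) by exact: sqintB.
  under eq_integral do rewrite EFinM.
  rewrite integralZl//; last exact: (sqint_integrable sdv).
  have -> : (\int[mu]_(x in D) ((v k.+1 x - v k x) ^+ 2)%:E)%E =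
    (ip (v k.+1 \- v k) (v k.+1 \- v k))%:E.
    by rewrite -ip_fin//; apply: eq_integral => x _; rewrite expr2.
  rewrite -EFinM lee_fin.
  apply: le_trans (_ : 4 ^+ k * 8^-1 ^+ k <= _).
    by rewrite ler_wpM2l ?exprn_ge0.
  rewrite -exprMn addn1 natrX exprS.
  have -> : (4 * 8^-1 : R) = 2^-1 by field.
  by rewrite invfM mulrA divff// mul1r exprVn.
have mS : measurable_fun D (fun x => \sum_(k <oo) dv k x)%E.
  by apply: ge0_emeasurable_sum => // k x Dx _.
have soo : {ae mu, forall x, D x -> (\sum_(k <oo) dv k x \is a fin_num)%E}.
  apply: integrable_ae => //; apply/integrableP; split => //.
  under eq_integral do rewrite gee0_abs ?nneseries_ge0//.
  by apply: le_lt_trans idv _; rewrite ltry.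
apply: filterS soo => x + Dx => /(_ Dx) Sfin.
pose s := fine (\sum_(k <oo) dv k x)%E.
have s0 : 0 <= s by rewrite fine_ge0// nneseries_ge0.
have dvs k : 4 ^+ k * (v k.+1 x - v k x) ^+ 2 <= s.
  rewrite -lee_fin fineK//.
  apply: le_trans (@nneseries_lim_ge R (dv ^~ x) xpredT 0%N k.+1 (fun n _ _ => dv0 n x)).
  by rewrite big_nat_recr//= leeDr// sume_ge0.
rewrite (_ : v^~ x = cst (v 0%N x) \+ series (telescope (v^~ x))); last first.
  by apply/funext => n /=; rewrite -(eq_sum_telescope (v ^~ x)).
apply: is_cvgD; first exact: is_cvg_cst.
apply: normed_cvg.
(* s + 1 majorises the square root of s *)
apply: (@series_le_cvg _ _ (geometric (s + 1) 2^-1)) => [n|n|n|].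
- exact: normr_ge0.
- by rewrite /geometric/= mulr_ge0 ?exprn_ge0// ?addr_ge0.
- rewrite /= -(@ler_pXn2r _ 2) ?nnegrE ?mulr_ge0 ?exprn_ge0 ?addr_ge0//.
  rewrite real_normK ?num_real// exprMn -exprM mulnC exprM.
  have -> : (2^-1 ^+ 2 : R) = 4^-1 by field.
  rewrite exprVn ler_pdivlMr ?exprn_gt0// mulrC.
  by apply: le_trans (dvs n) _; nra.
- by apply: is_cvg_geometric_series; rewrite ger0_norm// invf_lt1// ltr1n.
Qed.

Lemma limn_einf_le (a : (\bar R)^nat) (e : \bar R) N :
  (forall n, (N <= n)%N -> (a n <= e)%E) -> (limn_einf a <= e)%E.
Proof.
move=> ae; rewrite limn_einf_lim; apply: lime_le; first exact: is_cvg_einfs.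
apply: nearW => n; apply: le_trans (ae (maxn N n) (leq_maxl _ _)).
by apply: ereal_inf_lbound; exists (maxn N n) => //=; exact: leq_maxr.
Qed.

(** Riesz-Fischer: a rapidly Cauchy subsequence converges almost everywhere, and
    Fatou's lemma turns this pointwise limit into a limit in the norm. *)
Lemma sqint_complete (u : nat -> X -> R) : (forall n, sqint (u n)) ->
  (forall e : R, 0 < e -> exists N : nat, forall m n,
     (N <= m)%N -> (N <= n)%N -> ip (u m \- u n) (u m \- u n) < e) ->
  exists f, sqint f /\ ip (u n \- f) (u n \- f) @[n --> \oo] --> 0.
Proof.
move=> su cu.
have e8 k : 0 < (8^-1 : R) ^+ k by rewrite exprn_gt0.
pose N k := projT1 (cid (cu _ (e8 k))).
have NP k m n : (N k <= m)%N -> (N k <= n)%N ->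
    ip (u m \- u n) (u m \- u n) < 8^-1 ^+ k.
  by move=> Nm Nn; exact: (projT2 (cid (cu _ (e8 k)))).
(* the ranks N k need not increase, so the subsequence uses their partial sums *)
pose M k := (\sum_(i < k.+1) (N i).+1)%N.
have MS k : (M k < M k.+1)%N.
  by rewrite /M [X in (_ < X)%N]big_ord_recr/= addnS ltnS leq_addr.
have kM k : (k <= M k)%N.
  by elim: k => // k /leq_ltn_trans; apply.
have NM k : (N k <= M k)%N.
  by rewrite /M big_ord_recr/=; apply: leq_trans (leq_addl _ _); exact: ltnW.
pose v k := u (M k).
have /rapid_cauchy_ae_cvg : forall k, sqint (v k) by move=> k; exact: su.
move=> /(_ (fun k => ltW (NP k _ _ (leq_trans (NM k) (ltnW (MS k))) (NM k)))) cvv.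
(* an upper limit is measurable even where v fails to converge *)
pose f x := fine (limn_esup (fun k => (v k x)%:E)).
have mf : measurable_fun D f.
  apply: (@measurableT_comp _ _ _ _ _ _ fine) => //.
  apply: measurable_fun_limn_esup => k.
  by apply/measurable_EFinP; case: (su (M k)).
have vf : {ae mu, forall x, D x -> v ^~ x @ \oo --> f x}.
  apply: filterS cvv => x cx Dx; have /cvg_ex[l vl] := cx Dx.
  suff -> : f x = l by [].
  rewrite /f.
  have /cvg_limn_einf_sup [_ ->] // : (v k x)%:E @[k --> \oo] --> l%:E.
  by apply: cvg_EFin => //; exact: nearW.
have key e n : (exists K : nat, forall m, (K <= m)%N ->
    ip (u n \- u m) (u n \- u m) <= e) ->
    (\int[mu]_(x in D) ((u n x - f x) ^+ 2)%:E <= e%:E)%E.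
  move=> [K Ke].
  pose g k x := ((u n x - v k x) ^+ 2)%:E : \bar R.
  have mg k : measurable_fun D (g k).
    apply/measurable_EFinP/measurable_funX/measurable_funB.
    by case: (su n). by case: (su (M k)).
  have g0 k x : D x -> (0 <= g k x)%E by move=> _; rewrite lee_fin sqr_ge0.
  rewrite (_ : (\int[mu]_(x in D) _ = \int[mu]_(x in D) limn_einf (g^~ x))%E).
    apply: le_trans (fatou mu mD mg g0) _.
    apply: (@limn_einf_le _ _ K) => k Kk.
    rewrite (_ : (\int[mu]_(x in D) g k x)%E =
        (ip (u n \- v k) (u n \- v k))%:E); last first.
      rewrite -ip_fin//.
      - by apply: sqintB => //; exact: su.
      - by apply: sqintB => //; exact: su.
    by rewrite lee_fin Ke// (leq_trans Kk).
  apply: ge0_ae_eq_integral => //.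
  - apply/measurable_EFinP/measurable_funX/measurable_funB => //.
    by case: (su n).
  - apply: measurableT_comp => //; apply: measurable_fun_limn_esup => k.
    exact: measurableT_comp.
  - by move=> x _; rewrite lee_fin sqr_ge0.
  - move=> x Dx; rewrite limn_einf_lim; apply: lime_ge; first exact: is_cvg_einfs.
    by apply: nearW => k; apply: le_ereal_inf_tmp => _ [j _ <-]; exact: g0.
  apply: filterS vf => x vx Dx.
  have /cvg_limn_einf_sup [-> _] // : g k x @[k --> \oo] --> ((u n x - f x) ^+ 2)%:E.
  apply: cvg_EFin; first exact: nearW.
  rewrite /comp/= /g.
  by under eq_fun do rewrite /=; rewrite expr2; under eq_fun do rewrite expr2;
    apply: cvgM; apply: cvgB; [exact: cvg_cst|exact: vx|exact: cvg_cst|exact: vx].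
have cu' e : 0 < e -> exists K : nat, forall n, (K <= n)%N ->
    (\int[mu]_(x in D) ((u n x - f x) ^+ 2)%:E <= e%:E)%E.
  move=> e0; have [K Ke] := cu _ e0; exists K => n Kn; apply: key.
  by exists K => m Km; exact/ltW/Ke.
have sf : sqint f.
  have [K Ke] := cu' 1 ltr01.
  have suf : sqint (u K \- f).
    split; first by apply: measurable_funB => //; case: (su K).
    by apply: le_lt_trans (Ke K (leqnn _)) _; rewrite ltry.
  apply: (@eq_sqint _ _ _ _ _ (u K \- (u K \- f))); last exact: sqintB.
  by move=> x _ /=; rewrite opprB addrC subrK.
exists f; split => //.
apply/cvgrPdist_le => e e0.
have [K Ke] := cu' _ e0.
near=> n; rewrite sub0r normrN ger0_norm ?ip_ge0// -lee_fin -ip_fin//.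
- under eq_integral do rewrite -expr2.
  by apply: Ke; near: n; exists K.
- exact: sqintB.
- exact: sqintB.
Unshelve. all: by end_near. Qed.

End L2_complete.

(** * Minimising sequences for bounded linear forms *)

(** S is a pre-Hilbert space for k, so the representative of l exists in general
    only as a k-Cauchy sequence of S. *)
Section Riesz.
Context (X : Type) (R : realType).
Variables (S : set (X -> R)) (k : (X -> R) -> (X -> R) -> R) (l : (X -> R) -> R).
Variable C : R.
Hypothesis S0 : S (cst 0).
Hypothesis SDZ : forall (t : R) f g, S f -> S g -> S (f \+ (t \*: g)).
Hypothesis kC : forall f g, k f g = k g f.
Hypothesis k_ge0 : forall f, 0 <= k f f.
Hypothesis kDZ : forall (t : R) f g h, S f -> S g -> S h ->
  k (f \+ (t \*: g)) h = k f h + t * k g h.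
Hypothesis lDZ : forall (t : R) f g, S f -> S g -> l (f \+ (t \*: g)) = l f + t * l g.
Hypothesis l_bounded : forall f, S f -> l f ^+ 2 <= C * k f f.

Let J f := k f f - 2 * l f.

Let kpolar t f g : S f -> S g ->
  k (f \+ (t \*: g)) (f \+ (t \*: g)) = k f f + 2 * t * k f g + t ^+ 2 * k g g.
Proof.
move=> Sf Sg; have S' := SDZ t Sf Sg.
by rewrite kDZ// (kC f (_ \+ _)) (kC g (_ \+ _)) !kDZ// (kC g f); ring.
Qed.

Let JD t f g : S f -> S g ->
  J (f \+ (t \*: g)) = J f + 2 * t * (k f g - l g) + t ^+ 2 * k g g.
Proof. by move=> Sf Sg; rewrite /J kpolar// lDZ//; ring. Qed.

Let J_lb f : S f -> - `|C| <= J f.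
Proof.
move=> Sf; rewrite /J.
have h := l_bounded Sf; have k0 := k_ge0 f.
have h2 : l f ^+ 2 <= `|C| * k f f.
  by apply: le_trans h _; rewrite ler_wpM2r// ler_norm.
have C0 := normr_ge0 C.
suff : 2 * l f <= `|C| + k f f by lra.
have [l0|l0] := leP (l f) 0; first lra.
rewrite -(@ler_pXn2r _ 2) ?nnegrE//; [|lra|lra].
have := sqr_ge0 (`|C| - k f f); nra.
Qed.

(** Since l is bounded for k, the functional J f = k f f - 2 l f is bounded below on
    S.  By the parallelogram identity, near-minimisers of J are close for k, and
    comparing J at u n and at u n + t v bounds k (u n) v - l v by the distance of
    J (u n) to the infimum. *)
Lemma riesz_minimizing_sequence : exists u : nat -> X -> R,
  [/\ forall n, S (u n),
      forall e : R, 0 < e -> exists N : nat, forall m n,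
        (N <= m)%N -> (N <= n)%N -> k (u m \- u n) (u m \- u n) < e &
      forall v, S v -> k (u n) v @[n --> \oo] --> l v].
Proof.
have inf_J : has_inf (J @` S).
  split; first by exists (J (cst 0)), (cst 0).
  by exists (- `|C|) => _ [f Sf <-]; exact: J_lb.
have [m mJ ex] : exists2 m, (forall f, S f -> m <= J f) &
    forall n, exists f, S f /\ J f < m + n.+1%:R^-1.
  exists (inf (J @` S)) => [f Sf|n].
    by apply: ge_inf; [case: inf_J|exists f].
  have n0 : 0 < n.+1%:R^-1 :> R by rewrite invr_gt0.
  by have [_ [f Sf <-] Jf] := inf_adherent n0 inf_J; exists f.
pose u n := projT1 (cid (ex n)).
have Su n : S (u n) by case: (projT2 (cid (ex n))).
have Ju n : J (u n) < m + n.+1%:R^-1 by case: (projT2 (cid (ex n))).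
exists u; split => //.
- move=> e e0.
  have e4 : 0 < e / 4 by rewrite divr_gt0.
  have [N _ HN] := near_infty_natSinv_lt (PosNum e4).
  exists N => i j Ni Nj; set w := u i \- u j.
  have hi : i.+1%:R^-1 < e / 4 :> R := HN i Ni.
  have hj : j.+1%:R^-1 < e / 4 :> R := HN j Nj.
  have wE : w = u i \+ ((-1) \*: u j).
    by apply/funext => x /=; rewrite scaleN1r.
  have Sw : S w by rewrite wE; exact: SDZ.
  have uiE : u i = u j \+ (1 \*: w).
    by apply/funext => x /=; rewrite scale1r addrC subrK.
  have Ji := Ju i; rewrite uiE JD// in Ji.
  (* u j + w / 2 is the midpoint of u i and u j *)
  have := mJ _ (SDZ 2^-1 (Su j) Sw); rewrite JD//.
  have -> : 2^-1 ^+ 2 = 4^-1 :> R by field.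
  rewrite expr1n in Ji; have := Ju j; move: hi hj Ji.
  by move: (i.+1%:R^-1 : R) (j.+1%:R^-1 : R) => di dj; lra.
- move=> v Sv; apply/cvgrPdist_lt => /= e e0.
  have kv := k_ge0 v.
  have d0 : 0 < e ^+ 2 / (k v v + 1) by rewrite divr_gt0 ?exprn_gt0//; lra.
  have [N _ HN] := near_infty_natSinv_lt (PosNum d0).
  exists N => // n Nn /=.
  have hn : n.+1%:R^-1 < e ^+ 2 / (k v v + 1) :> R := HN n Nn.
  have Jn := Ju n; move: (n.+1%:R^-1 : R) hn Jn => dn hn Jn.
  rewrite distrC; set a := k (u n) v - l v.
  (* t = - a / k v v would be optimal; adding 1 keeps it defined when k v v = 0 *)
  have := mJ _ (SDZ (- a / (k v v + 1)) (Su n) Sv); rewrite JD// -/a => h.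
  have {h} : a ^+ 2 / (k v v + 1) < dn.
    apply: le_lt_trans (_ : a ^+ 2 / (k v v + 1) + (a / (k v v + 1)) ^+ 2 < _).
      by rewrite lerDl sqr_ge0.
    rewrite (_ : _ + _ = - (2 * (- a / (k v v + 1)) * a +
      (- a / (k v v + 1)) ^+ 2 * k v v)); first by lra.
    by field; rewrite gt_eqF//; lra.
  move=> h; have {h} := lt_trans h hn.
  rewrite ltr_pM2r ?invr_gt0; last lra.
  rewrite -(real_normK (num_real a)) ltr_pXn2r ?nnegrE//; lra.
Qed.

End Riesz.

(** * Boxes and Borel sets *)

Section Borel.
Context (R : realType).
Local Notation R2m := (measurableTypeR R * measurableTypeR R)%type.
Local Notation R3m := (measurableTypeR R * measurableTypeR R * measurableTypeR R)%type.

Definition box (a b : R * R * R) : set (R * R * R) :=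
  (`[a.1.1, b.1.1] `*` `[a.1.2, b.1.2]) `*` `[a.2, b.2].

Definition obox (a b : R * R * R) : set (R * R * R) :=
  (`]a.1.1, b.1.1[ `*` `]a.1.2, b.1.2[) `*` `]a.2, b.2[.

Lemma measurable_box a b : measurable (box a b : set R3m).
Proof. by apply: measurableX => //; exact: measurableX. Qed.

Lemma measurable_obox a b : measurable (obox a b : set R3m).
Proof. by apply: measurableX => //; exact: measurableX. Qed.

(** For e = -1 and e = 1, opposite corners of the cube with rational centre and
    half-edge 1 / (n + 1), where (centre, n) = q. *)
Definition rat_corner (e : R) (q : rat * rat * rat * nat) : R * R * R :=
  (ratr q.1.1.1 + e / q.2.+1%:R, ratr q.1.1.2 + e / q.2.+1%:R, ratr q.1.2 + e / q.2.+1%:R).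

Definition rat_box q := box (rat_corner (-1) q) (rat_corner 1 q).
Definition rat_obox q := obox (rat_corner (-1) q) (rat_corner 1 q).

(** The open cubes cover U; the closed ones are compact subsets of U, on which
    continuous functions on U are bounded. *)
Lemma open_rat_box_cover (U : set (R * R * R)) X : open U -> U X ->
  exists2 q, rat_box q `<=` U & rat_obox q X.
Proof.
move=> oU UX.
have /nbhs_ballP[e /= e0 eU] : nbhs X U by exact: open_nbhs_nbhs.
have e2 : 0 < e / 2 by rewrite divr_gt0.
have [n _ Hn] := near_infty_natSinv_lt (PosNum e2).
have {}Hn : n.+1%:R^-1 < e / 2 :> R := Hn n (leqnn n).
have n0 : 0 < n.+1%:R^-1 :> R by rewrite invr_gt0.
have ex (x : R) : exists q : rat, x \in `](ratr q - n.+1%:R^-1), (ratr q + n.+1%:R^-1)[.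
  have : x - n.+1%:R^-1 < x + n.+1%:R^-1 by rewrite ltrD2l gtrN.
  move=> /rat_in_itvoo[q]; rewrite !in_itv/= => /andP[xq qx]; exists q.
  by rewrite in_itv/= ltrBlDr qx -ltrBlDr xq.
have [q1 h1] := ex X.1.1; have [q2 h2] := ex X.1.2; have [q3 h3] := ex X.2.
exists (q1, q2, q3, n); last first.
  by split; [split|]; rewrite /rat_corner/= mulN1r mul1r.
move=> Y; rewrite /rat_box /rat_corner /box/= !mulN1r !mul1r => -[[/= k1 k2] k3]; apply: eU.
have tri (q x y : R) : x \in `](q - n.+1%:R^-1), (q + n.+1%:R^-1)[ ->
    y \in `[(q - n.+1%:R^-1), (q + n.+1%:R^-1)] -> ball x e y.
  rewrite !in_itv/= => /andP[xq1 xq2] /andP[yq1 yq2].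
  rewrite /ball/= ltr_norml; move: (n.+1%:R^-1 : R) Hn n0 xq1 xq2 yq1 yq2 => d *.
  by apply/andP; split; lra.
by split; [split|]; apply: tri; eassumption.
Qed.

(** Measurable sets of the product are those of the product sigma-algebra, which
    contains the open sets because each is a countable union of boxes. *)
Lemma open_measurable3 (U : set (R * R * R)) : open U -> measurable (U : set R3m).
Proof.
move=> oU.
have -> : U = \bigcup_q (if `[< rat_box q `<=` U >] then rat_obox q else set0).
  apply/seteqP; split => [X UX|X [q _]].
    have [q qU qX] := open_rat_box_cover oU UX.
    by exists q => //; case: asboolP.
  case: asboolP => // qU [[/= h1 h2] h3]; apply: qU.
  by split; [split|]; exact: subset_itv_oo_cc.
apply: countable_bigcupT_measurable; first exact: countableP.
by move=> q; case: asboolP => // _; exact: measurable_obox.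
Qed.

(** U is a section of the open cylinder over it. *)
Lemma open_measurable2 (U : set (R * R)) : open U -> measurable (U : set R2m).
Proof.
move=> oU.
have /open_measurable3 : open (fst @^-1` U : set (R * R * R)).
  by apply: open_comp => // X _; exact: cvg_fst.
move=> /(measurable_ysection (0 : measurableTypeR R)).
by congr measurable; apply/seteqP; split=> x; rewrite /ysection/= ?inE//= => /set_mem.
Qed.

Lemma continuous_measurable3 (U : set (R * R * R)) (f : R * R * R -> R) :
  open U -> {in U, continuous f} -> measurable_fun (U : set R3m) f.
Proof.
move=> oU cf; apply: (measurability _ (RGenOpens.measurableE R)).
move=> _ [_ [a [b ->] <-]]; apply: open_measurable3.
rewrite openE => X [UX abX]; apply: filterI; first exact: open_nbhs_nbhs.
apply: (cf X (mem_set UX)); apply: open_nbhs_nbhs; split => //.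
Qed.

Lemma continuous_measurable2 (U : set (R * R)) (f : R * R -> R) :
  open U -> {in U, continuous f} -> measurable_fun (U : set R2m) f.
Proof.
move=> oU cf; apply: (measurability _ (RGenOpens.measurableE R)).
move=> _ [_ [a [b ->] <-]]; apply: open_measurable2.
rewrite openE => X [UX abX]; apply: filterI; first exact: open_nbhs_nbhs.
apply: (cf X (mem_set UX)); apply: open_nbhs_nbhs; split => //.
Qed.

End Borel.

(** * Fubini, directional derivatives and the fundamental theorem of calculus *)

Section Fubini_zero.
Context d1 d2 (T1 : measurableType d1) (T2 : measurableType d2) (R : realType).
Variables (m1 : {measure set T1 -> \bar R})
  (m2 : {sigma_finite_measure set T2 -> \bar R}).
Hypothesis sm1 : sigma_finite setT m1.
Variables (A : set T1) (B : set T2) (f : T1 * T2 -> R).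
Hypotheses (mA : measurable A) (mB : measurable B).
Hypothesis f_int : (m1 \x m2)%E.-integrable (A `*` B) (EFin \o f).

Let f_int' : (m1 \x m2)%E.-integrable setT ((EFin \o f) \_ (A `*` B)).
Proof. by apply: (integrable_mkcond _ (measurableX mA mB)).1. Qed.

(** The Fubini theorems ask for a sigma-finite structure on the first factor, but a
    product measure such as leb2 comes with a plain measure structure only; this
    copy of m1 carries both. *)
Definition sfin_copy of sigma_finite setT m1 : set T1 -> \bar R := m1.
Local Notation n1 := (sfin_copy sm1).
HB.instance Definition _ := Measure.copy n1 m1.
HB.instance Definition _ := Measure_isSigmaFinite.Build _ _ _ n1 sm1.

Lemma integral_setX_eq0r :
  (forall x, A x -> (\int[m2]_(y in B) (f (x, y))%:E = 0)%E) ->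
  (\int[(m1 \x m2)%E]_(z in A `*` B) (f z)%:E = 0)%E.
Proof.
move=> f0; rewrite integral_mkcond.
rewrite -[LHS](@integral12_prod_meas1 _ _ _ _ _ n1 m2 _ f_int').
apply: integral0_eq => x _.
have [Ax|nAx] := pselect (A x).
  rewrite -(f0 _ Ax) [RHS]integral_mkcond; apply: eq_integral => y _.
  rewrite !patchE; congr (if _ then _ else _).
  by apply/idP/idP => /set_mem; [case=> _ h|move=> h]; apply/mem_set.
apply: integral0_eq => y _; rewrite patchE; case: ifP => // /set_mem[].
by move/nAx.
Qed.

Lemma integral_setX_eq0l :
  (forall y, B y -> (\int[m1]_(x in A) (f (x, y))%:E = 0)%E) ->
  (\int[(m1 \x m2)%E]_(z in A `*` B) (f z)%:E = 0)%E.
Proof.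
move=> f0; rewrite integral_mkcond.
rewrite -[LHS](@integral21_prod_meas1 _ _ _ _ _ n1 m2 _ f_int').
apply: integral0_eq => y _.
have [By|nBy] := pselect (B y).
  rewrite -(f0 _ By) [RHS]integral_mkcond; apply: eq_integral => x _.
  rewrite !patchE; congr (if _ then _ else _).
  by apply/idP/idP => /set_mem; [case=> h _|move=> h]; apply/mem_set.
apply: integral0_eq => x _; rewrite patchE; case: ifP => // /set_mem[].
by move=> _ /nBy.
Qed.

End Fubini_zero.

Section Derivatives.
Context (R : realType) (V : normedModType R).
Implicit Types (U : set V) (f g : V -> R).

(** A directional derivative only looks at f near X. *)
Lemma derive_eq_on_open U f g X v : open U -> U X -> {in U, f =1 g} ->
  derivable g X v -> derivable f X v /\ 'D_v f X = 'D_v g X.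
Proof.
move=> oU UX fg dg.
have near_fg : {near 0^', (fun h : R => h^-1 *: ((g \o shift X) (h *: v) - g X)) =1
    (fun h => h^-1 *: ((f \o shift X) (h *: v) - f X))}.
  have cX : (fun h : R => h *: v + X) @ (0 : R) --> X.
    rewrite -[X in _ --> X]add0r -[X in _ --> X + _](scale0r v).
    apply: cvgD; last exact: cvg_cst.
    by apply: cvgZr_tmp; exact: cvg_id.
  have UnX : \forall h \near (0 : R), U (h *: v + X).
    by apply: cX; exact: open_nbhs_nbhs.
  apply: nbhs_dnbhs; apply: filterS UnX => h Uh.
  by rewrite /= !fg// ?inE.
have cvD : h^-1 *: ((f \o shift X) (h *: v) - f X) @[h --> 0^'] --> 'D_v g X.
  by apply: cvg_trans (near_eq_cvg near_fg) _; exact: dg.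
split; first by apply/cvg_ex; exists ('D_v g X).
by apply/cvg_lim.
Qed.

(** Reduces partial derivatives to one-variable calculus along an affine line. *)
Lemma is_derive_line f (gam : R -> V) v (s : R) :
  (forall h, gam (h + s) = h *: v + gam s) -> derivable f (gam s) v ->
  is_derive s 1 (f \o gam) ('D_v f (gam s)).
Proof.
move=> gamE df.
have E : (fun h : R => h^-1 *: (((f \o gam) \o shift s) (h *: (1 : R)) - (f \o gam) s)) =
  (fun h => h^-1 *: ((f \o shift (gam s)) (h *: v) - f (gam s))).
  by apply/funext => h /=; rewrite -gamE [h *: 1]mulr1.
by apply: DeriveDef; [rewrite /derivable E|rewrite /derive E].
Qed.

Lemma eq_on_open_continuous U f g : open U -> {in U, f =1 g} ->
  {in U, continuous g} -> {in U, continuous f}.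
Proof.
move=> oU fg cg X XU.
have UX := set_mem XU.
rewrite /continuous_at fg//.
apply: cvg_trans (cg X XU); apply: near_eq_cvg.
have : nbhs X U by exact: open_nbhs_nbhs.
by apply: filterS => Y UY; rewrite fg ?inE.
Qed.

Lemma within_closure_continuous U g : open U -> {within closure U, continuous g} ->
  {in U, continuous g}.
Proof.
move=> oU cg; rewrite -(continuous_open_subspace _ oU).
by apply: continuous_subspaceW cg; exact: subset_closure.
Qed.

Lemma continuous_extension_interior U f g : open U ->
  continuous_extension U f g -> {in U, continuous f}.
Proof.
move=> oU [cg fg]; apply: (eq_on_open_continuous oU fg).
exact: within_closure_continuous.
Qed.

End Derivatives.

Section FTC.
Context (R : realType).

Lemma integral_derivative (F f : R -> R) a b : a < b ->
  {within `[a, b], continuous f} ->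
  (forall x, x \in `[a, b] -> is_derive x 1 F (f x)) ->
  (\int[lebesgue_measure]_(x in `[a, b]) (f x)%:E = (F b - F a)%:E)%E.
Proof.
move=> ab cf dF; rewrite EFinB; apply: (continuous_FTC2 ab cf).
- have cF x : x \in `[a, b] -> {for x, continuous F}.
    by move=> /dF h; apply/differentiable_continuous/derivable1_diffP/ex_derive.
  split.
  + by move=> x /subset_itv_oo_cc /dF h; exact: ex_derive.
  + by apply: cvg_at_right_filter; apply: cF; rewrite in_itv/= lexx ltW.
  + by apply: cvg_at_left_filter; apply: cF; rewrite in_itv/= lexx ltW.
- by move=> x /subset_itv_oo_cc /dF h; rewrite derive1E derive_val.
Qed.

End FTC.

(** * Integrals over boxes *)

Section Boxes.
Context (R : realType).
Local Notation mu := (@lebesgue_measure R).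
Local Notation R2m := (measurableTypeR R * measurableTypeR R)%type.
Local Notation R3m := (measurableTypeR R * measurableTypeR R * measurableTypeR R)%type.
Implicit Types (a b : R * R * R) (U : set (R * R * R)) (F : R * R * R -> R).

Lemma box_compact a b : compact (box a b).
Proof.
by apply: compact_setX; [apply: compact_setX|]; exact: segment_compact.
Qed.

Lemma itv_finite (x y : R) : (mu `[x, y] < +oo)%E.
Proof.
by rewrite lebesgue_measure_itv/=; case: ifP => _; rewrite ?ltry// -EFinB ltry.
Qed.

Lemma rect_finite (x y x' y' : R) :
  (leb2 (`[x, y] `*` `[x', y'] : set R2m) < +oo)%E.
Proof.
rewrite (_ : leb2 _ = mu `[x, y] * mu `[x', y'])%E; last exact: product_measure1E.
by rewrite lte_mul_pinfty// ?itv_finite// ge0_fin_numE// itv_finite.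
Qed.

Lemma box_finite a b : (leb3 (box a b : set R3m) < +oo)%E.
Proof.
rewrite (_ : leb3 _ = leb2 (`[a.1.1, b.1.1] `*` `[a.1.2, b.1.2] : set R2m) * mu `[a.2, b.2])%E;
  last by apply: product_measure1E => //; exact: measurableX.
by rewrite lte_mul_pinfty// ?itv_finite// ge0_fin_numE// rect_finite.
Qed.

Lemma leb2_sigma_finite : sigma_finite setT (@leb2 R).
Proof.
have /sigma_finiteP[F [TF ndF Foo]] := @sigma_finiteT _ _ _ mu.
exists (fun n => F n `*` F n).
  rewrite -setXTT {1 2}TF predeqE => -[x y]; split.
    move=> [/= [n _ Fnx] [k _ Fky]]; exists (maxn n k) => //; split.
    - by move: x Fnx; exact/subsetPset/ndF/leq_maxl.
    - by move: y Fky; exact/subsetPset/ndF/leq_maxr.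
  by move=> [n _ []/= ? ?]; split; exists n.
move=> k; have [mF Fk] := Foo k; split; first exact: measurableX.
rewrite (_ : leb2 _ = mu (F k) * mu (F k))%E; last exact: product_measure1E.
by rewrite lte_mul_pinfty// ge0_fin_numE.
Qed.

Lemma continuous_compact_bounded (T : topologicalType) (K U : set T) (f : T -> R) :
  compact K -> K `<=` U -> {in U, continuous f} -> [bounded f x | x in K].
Proof.
move=> cK KU cf; have /compact_bounded : compact (f @` K).
  apply: continuous_compact => //; apply: continuous_in_subspaceT => x /set_mem Kx.
  by apply: cf; rewrite inE; exact: KU.
by move=> [M [Mr h]]; exists M; split => // x Mx y Ky; apply: h Mx _ _; exists y.
Qed.

Lemma continuous_box_integrable a b U F : open U -> box a b `<=` U ->
  {in U, continuous F} -> leb3.-integrable (box a b : set R3m) (EFin \o F).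
Proof.
move=> oU BU cF; apply: measurable_bounded_integrable.
- exact: measurable_box.
- exact: box_finite.
- apply: measurable_funS (continuous_measurable3 oU cF) => //.
  exact: open_measurable3.
- exact: continuous_compact_bounded (@box_compact a b) BU cF.
Qed.

(** Integrability is part of the definition so that null integrals can be added. *)
Definition box_null a b F : Prop :=
  leb3.-integrable (box a b : set R3m) (EFin \o F) /\
  (\int[leb3]_(X in (box a b : set R3m)) (F X)%:E = 0)%E.

Lemma box_nullD a b F F' : box_null a b F -> box_null a b F' -> box_null a b (F \+ F').
Proof.
move=> [iF F0] [iF' F0']; split.
  exact: (integrableD (@measurable_box R a b) iF iF').
by rewrite (integralD_EFin (@measurable_box R a b))// F0 F0' adde0.
Qed.

Lemma box_nullB a b F F' : box_null a b F -> box_null a b F' -> box_null a b (F \- F').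
Proof.
move=> [iF F0] [iF' F0']; split.
  exact: (integrableB (@measurable_box R a b) iF iF').
by rewrite (integralB_EFin (@measurable_box R a b))// F0 F0' sube0.
Qed.

(** If the inner integral along one axis vanishes on every line, Fubini's theorem
    kills the whole integral; the time axis is the last factor of the product, so one
    application suffices. *)
Lemma box_null_t a b U F : open U -> box a b `<=` U -> {in U, continuous F} ->
  (forall x y, x \in `[a.1.1, b.1.1] -> y \in `[a.1.2, b.1.2] ->
     \int[mu]_(t in `[a.2, b.2]) (F (x, y, t))%:E = 0)%E ->
  box_null a b F.
Proof.
move=> oU BU cF F0; split; first exact: continuous_box_integrable oU BU cF.
apply: (@integral_setX_eq0r _ _ R2m (measurableTypeR R) R leb2 mu leb2_sigma_finite _ _ F) => //.
- exact: measurableX.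
- exact: continuous_box_integrable oU BU cF.
- by move=> [x y] [/= Ix Iy]; exact: F0.
Qed.

(** Integrability of each time slice allows a second application of Fubini's
    theorem, inside the space variables. *)
Lemma box_slice_integrable a b U F t : open U -> box a b `<=` U -> {in U, continuous F} ->
  t \in `[a.2, b.2] ->
  leb2.-integrable (`[a.1.1, b.1.1] `*` `[a.1.2, b.1.2] : set R2m)
    (EFin \o (fun z => F (z, t))).
Proof.
move=> oU BU cF It.
pose Ut := [set z : R * R | U (z, t)].
have cpair : continuous (fun z : R * R => (z, t)).
  by move=> z; apply: (cvg_pair (@cvg_id _ (nbhs z)) (cvg_cst t)); exact: filter_filter.
have oUt : open Ut.
  by apply: (open_comp _ oU) => z _; exact: cpair.
have KUt : `[a.1.1, b.1.1] `*` `[a.1.2, b.1.2] `<=` Ut.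
  by move=> z Kz; apply: BU.
have cFt : {in Ut, continuous (fun z => F (z, t))}.
  move=> z /set_mem Utz; apply: (@continuous_comp _ _ _ (fun z : R * R => (z, t)) F).
    exact: cpair.
  by apply: cF; rewrite inE.
apply: measurable_bounded_integrable.
- exact: measurableX.
- exact: rect_finite.
- apply: measurable_funS (continuous_measurable2 oUt cFt) => //.
  exact: open_measurable2.
- exact: (continuous_compact_bounded (compact_setX (segment_compact (a := _) (b := _))
    (segment_compact (a := _) (b := _))) KUt cFt).
Qed.

Lemma box_null_x1 a b U F : open U -> box a b `<=` U -> {in U, continuous F} ->
  (forall y t, y \in `[a.1.2, b.1.2] -> t \in `[a.2, b.2] ->
     \int[mu]_(x in `[a.1.1, b.1.1]) (F (x, y, t))%:E = 0)%E ->
  box_null a b F.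
Proof.
move=> oU BU cF F0; split; first exact: continuous_box_integrable oU BU cF.
apply: (@integral_setX_eq0l _ _ R2m (measurableTypeR R) R leb2 mu leb2_sigma_finite _ _ F) => //.
- exact: measurableX.
- exact: continuous_box_integrable oU BU cF.
move=> t It; apply: (@integral_setX_eq0l _ _ _ (measurableTypeR R) R mu mu
  (@sigma_finiteT _ _ _ mu) _ _ (fun z => F (z, t))) => //.
- exact: box_slice_integrable oU BU cF It.
- by move=> y Iy; exact: F0.
Qed.

Lemma box_null_x2 a b U F : open U -> box a b `<=` U -> {in U, continuous F} ->
  (forall x t, x \in `[a.1.1, b.1.1] -> t \in `[a.2, b.2] ->
     \int[mu]_(y in `[a.1.2, b.1.2]) (F (x, y, t))%:E = 0)%E ->
  box_null a b F.
Proof.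
move=> oU BU cF F0; split; first exact: continuous_box_integrable oU BU cF.
apply: (@integral_setX_eq0l _ _ R2m (measurableTypeR R) R leb2 mu leb2_sigma_finite _ _ F) => //.
- exact: measurableX.
- exact: continuous_box_integrable oU BU cF.
move=> t It; apply: (@integral_setX_eq0r _ _ _ (measurableTypeR R) R mu mu
  (@sigma_finiteT _ _ _ mu) _ _ (fun z => F (z, t))) => //.
- exact: box_slice_integrable oU BU cF It.
- by move=> x Ix; exact: F0.
Qed.

End Boxes.

(** * Green's identity on a box *)

Section Green.
Context (R : realType).
Local Notation mu := (@lebesgue_measure R).
Local Notation R3m := (measurableTypeR R * measurableTypeR R * measurableTypeR R)%type.
Implicit Types (a b : R * R * R) (U : set (R * R * R)) (w G h : R * R * R -> R).

(** The interior form of C2_closure: continuity is stated at the points of U, which is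
    how it serves on boxes contained in U. *)
Record C2_in U w : Prop := {
  C2_cont : {in U, continuous w} ;
  C2_der : forall v, v \in basis3 R -> {in U, forall X, derivable w X v} ;
  C2_cder : forall v, v \in basis3 R -> {in U, continuous ('D_v w)} ;
  C2_der2 : forall v v', v \in basis3 R -> v' \in basis3 R ->
    {in U, forall X, derivable ('D_v w) X v'} ;
  C2_cder2 : forall v v', v \in basis3 R -> v' \in basis3 R ->
    {in U, continuous ('D_v' ('D_v w))} }.

Lemma C2_closure_in U w : open U -> C2_closure (basis3 R) U w -> C2_in U w.
Proof.
move=> oU [cw dw ddw]; split.
- exact: within_closure_continuous.
- by move=> v /dw[].
- by move=> v /dw[_ [g]]; exact: continuous_extension_interior.
- by move=> v v' vB v'B; have [] := ddw _ _ vB v'B.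
- move=> v v' vB v'B; have [_ [g]] := ddw _ _ vB v'B.
  exact: continuous_extension_interior.
Qed.

Lemma dx1_basis : dx1 R \in basis3 R. Proof. by rewrite inE eqxx. Qed.
Lemma dx2_basis : dx2 R \in basis3 R. Proof. by rewrite !inE eqxx orbT. Qed.
Lemma dt_basis : dt R \in basis3 R. Proof. by rewrite !inE eqxx !orbT. Qed.
Hint Resolve dx1_basis dx2_basis dt_basis : core.

Lemma shift_x1 (x y t h : R) : ((h + x, y), t) = h *: dx1 R + ((x, y), t).
Proof. by congr (_, _, _); rewrite /= ?[_ *: 1]mulr1 ?[_ *: 0]mulr0 ?add0r. Qed.
Lemma shift_x2 (x y t h : R) : ((x, h + y), t) = h *: dx2 R + ((x, y), t).
Proof. by congr (_, _, _); rewrite /= ?[_ *: 1]mulr1 ?[_ *: 0]mulr0 ?add0r. Qed.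
Lemma shift_t (x y t h : R) : ((x, y), h + t) = h *: dt R + ((x, y), t).
Proof. by congr (_, _, _); rewrite /= ?[_ *: 1]mulr1 ?[_ *: 0]mulr0 ?add0r. Qed.

(** The integrand is c times the derivative of g * al, which vanishes at both
    ends. *)
Lemma integral_by_parts_poly (g : R -> R) (dg : R -> R) (al : {poly R}) (c x y : R) :
  x < y -> (forall s, s \in `[x, y] -> is_derive s 1 g (dg s)) ->
  {within `[x, y], continuous dg} -> al.[x] = 0 -> al.[y] = 0 ->
  (\int[mu]_(s in `[x, y]) ((dg s * al.[s] + g s * al^`().[s]) * c)%:E = 0)%E.
Proof.
move=> xy dgP cdg ax ay.
have cg : {within `[x, y], continuous g}.
  apply: continuous_in_subspaceT => s /set_mem sxy.
  by apply/differentiable_continuous/derivable1_diffP; apply: (@ex_derive _ _ _ _ _ _ _ (dgP s sxy)).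
have cp (p : {poly R}) : {within `[x, y], continuous (horner p)}.
  by apply: continuous_subspaceT; exact: continuous_horner.
pose F s := g s * al.[s] * c.
have -> : 0%E = (F y - F x)%:E by rewrite /F ax ay !mulr0 mul0r subrr.
apply: integral_derivative => // [s|s sxy].
  apply: cvgM; last exact: cvg_cst.
  by apply: cvgD; apply: cvgM; [exact: cdg|exact: cp|exact: cg|exact: cp].
have D1 := dgP s sxy; have D2 := is_derive_poly al s.
have D3 := is_deriveM D1 D2.
have D4 := is_deriveZ c D3.
rewrite (_ : F = c \*: ((g : R -> R) * horner al)); last first.
  by apply/funext => z /=; rewrite /F mulrC.
by apply: trigger_derive D4 _; rewrite /GRing.scale/=; ring.
Qed.

Lemma continuous_poly_x1 (p : {poly R}) : continuous (fun X : R * R * R => p.[X.1.1]).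
Proof.
move=> X; apply: (@continuous_comp _ _ _ (fun X : R * R * R => X.1.1) (horner p)).
  by apply: (@continuous_comp _ _ _ fst fst); exact: cvg_fst.
exact: continuous_horner.
Qed.

Lemma continuous_poly_x2 (p : {poly R}) : continuous (fun X : R * R * R => p.[X.1.2]).
Proof.
move=> X; apply: (@continuous_comp _ _ _ (fun X : R * R * R => X.1.2) (horner p)).
  by apply: (@continuous_comp _ _ _ fst snd); [exact: cvg_fst|exact: cvg_snd].
exact: continuous_horner.
Qed.

Lemma continuous_poly_t (p : {poly R}) : continuous (fun X : R * R * R => p.[X.2]).
Proof.
move=> X; apply: (@continuous_comp _ _ _ snd (horner p)); first exact: cvg_snd.
exact: continuous_horner.
Qed.

Section Green_axes.
Variables (a b : R * R * R) (U : set (R * R * R)) (g : R * R * R -> R).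
Hypotheses (oU : open U) (BU : box a b `<=` U).
Hypotheses (a1 : a.1.1 < b.1.1) (a2 : a.1.2 < b.1.2) (a3 : a.2 < b.2).
Hypothesis cg : {in U, continuous g}.
Variables al be ga : {poly R}.

Let inB x y t : x \in `[a.1.1, b.1.1] -> y \in `[a.1.2, b.1.2] ->
  t \in `[a.2, b.2] -> (x, y, t) \in U.
Proof. by move=> xI yI tI; rewrite inE; exact: BU. Qed.

Lemma green_t : {in U, forall X, derivable g X (dt R)} -> {in U, continuous ('D_(dt R) g)} ->
  ga.[a.2] = 0 -> ga.[b.2] = 0 ->
  box_null a b (fun X =>
    ('D_(dt R) g X * ga.[X.2] + g X * ga^`().[X.2]) * (al.[X.1.1] * be.[X.1.2])).
Proof.
move=> dg cdg ga0 gb0; apply: (box_null_t oU BU).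
  move=> X XU; apply: cvgM; last by apply: cvgM; [exact: continuous_poly_x1|exact: continuous_poly_x2].
  by apply: cvgD; apply: cvgM; [exact: cdg|exact: continuous_poly_t|exact: cg|exact: continuous_poly_t].
move=> x y xI yI /=.
have cl : continuous (fun s : R => ((x, y), s)).
  by move=> z; apply: (cvg_pair (cvg_cst (x, y)) (@cvg_id _ (nbhs z))); exact: filter_filter.
apply: (@integral_by_parts_poly (fun s => g (x, y, s)) (fun s => 'D_(dt R) g (x, y, s))) => //.
  move=> s sI; apply: (@is_derive_line R _ g (fun s => ((x, y), s))).
    by move=> h; exact: shift_t.
  by apply: dg; exact: inB.
apply: continuous_in_subspaceT => s /set_mem sI.
apply: (@continuous_comp _ _ _ (fun s : R => ((x, y), s)) ('D_(dt R) g)); first exact: cl.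
by apply: cdg; exact: inB.
Qed.

Lemma green_x1 : {in U, forall X, derivable g X (dx1 R)} -> {in U, continuous ('D_(dx1 R) g)} ->
  al.[a.1.1] = 0 -> al.[b.1.1] = 0 ->
  box_null a b (fun X =>
    ('D_(dx1 R) g X * al.[X.1.1] + g X * al^`().[X.1.1]) * (be.[X.1.2] * ga.[X.2])).
Proof.
move=> dg cdg ga0 gb0; apply: (box_null_x1 oU BU).
  move=> X XU; apply: cvgM; last by apply: cvgM; [exact: continuous_poly_x2|exact: continuous_poly_t].
  by apply: cvgD; apply: cvgM; [exact: cdg|exact: continuous_poly_x1|exact: cg|exact: continuous_poly_x1].
move=> y t yI tI /=.
have cl : continuous (fun s : R => ((s, y), t)).
  by move=> z; apply: (cvg_pair (cvg_pair (@cvg_id _ (nbhs z)) (cvg_cst y)) (cvg_cst t)); exact: filter_filter.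
apply: (@integral_by_parts_poly (fun s => g (s, y, t)) (fun s => 'D_(dx1 R) g (s, y, t))) => //.
  move=> s sI; apply: (@is_derive_line R _ g (fun s => ((s, y), t))).
    by move=> h; exact: shift_x1.
  by apply: dg; exact: inB.
apply: continuous_in_subspaceT => s /set_mem sI.
apply: (@continuous_comp _ _ _ (fun s : R => ((s, y), t)) ('D_(dx1 R) g)); first exact: cl.
by apply: cdg; exact: inB.
Qed.

Lemma green_x2 : {in U, forall X, derivable g X (dx2 R)} -> {in U, continuous ('D_(dx2 R) g)} ->
  be.[a.1.2] = 0 -> be.[b.1.2] = 0 ->
  box_null a b (fun X =>
    ('D_(dx2 R) g X * be.[X.1.2] + g X * be^`().[X.1.2]) * (al.[X.1.1] * ga.[X.2])).
Proof.
move=> dg cdg ga0 gb0; apply: (box_null_x2 oU BU).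
  move=> X XU; apply: cvgM; last by apply: cvgM; [exact: continuous_poly_x1|exact: continuous_poly_t].
  by apply: cvgD; apply: cvgM; [exact: cdg|exact: continuous_poly_x2|exact: cg|exact: continuous_poly_x2].
move=> x t xI tI /=.
have cl : continuous (fun s : R => ((x, s), t)).
  by move=> z; apply: (cvg_pair (cvg_pair (cvg_cst x) (@cvg_id _ (nbhs z))) (cvg_cst t)); exact: filter_filter.
apply: (@integral_by_parts_poly (fun s => g (x, s, t)) (fun s => 'D_(dx2 R) g (x, s, t))) => //.
  move=> s sI; apply: (@is_derive_line R _ g (fun s => ((x, s), t))).
    by move=> h; exact: shift_x2.
  by apply: dg; exact: inB.
apply: continuous_in_subspaceT => s /set_mem sI.
apply: (@continuous_comp _ _ _ (fun s : R => ((x, s), t)) ('D_(dx2 R) g)); first exact: cl.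
by apply: cdg; exact: inB.
Qed.

End Green_axes.

Definition test_fun (al be ga : {poly R}) (X : R * R * R) : R :=
  al.[X.1.1] * be.[X.1.2] * ga.[X.2].

(** The formal adjoint of w |-> - w_t - Delta w, applied to test_fun al be ga. *)
Definition adj_test (al be ga : {poly R}) (X : R * R * R) : R :=
  al.[X.1.1] * be.[X.1.2] * ga^`().[X.2]
  - (al^`()^`().[X.1.1] * be.[X.1.2] + al.[X.1.1] * be^`()^`().[X.1.2]) * ga.[X.2].

(** The end conditions that cancel all boundary terms when integrating by parts
    twice. *)
Definition flat_at (p : {poly R}) (x y : R) : Prop :=
  [/\ p.[x] = 0, p.[y] = 0, p^`().[x] = 0 & p^`().[y] = 0].

Lemma continuous_test_fun al be ga : continuous (test_fun al be ga).
Proof.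
by move=> X; apply: cvgM; [apply: cvgM; [exact: continuous_poly_x1|exact: continuous_poly_x2]|exact: continuous_poly_t].
Qed.

Lemma continuous_adj_test al be ga : continuous (adj_test al be ga).
Proof.
move=> X; apply: cvgB.
  by apply: cvgM; [apply: cvgM; [exact: continuous_poly_x1|exact: continuous_poly_x2]|exact: continuous_poly_t].
apply: cvgM; last exact: continuous_poly_t.
by apply: cvgD; apply: cvgM; [exact: continuous_poly_x1|exact: continuous_poly_x2|exact: continuous_poly_x1|exact: continuous_poly_x2].
Qed.

Lemma green_algebra (w G d1 d2 d3 d11 d22 al be ga al1 be1 ga1 al2 be2 : R) :
  (d1 * al1 + w * al2) * (be * ga) + (d2 * be1 + w * be2) * (al * ga)
  - ((d3 * ga + w * ga1) * (al * be) + ((d11 * al + d1 * al1) * (be * ga)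
     + (d22 * be + d2 * be1) * (al * ga)))
  = (- d3 - (d11 + d22) + G * w) * (al * be * ga)
    - w * (al * be * ga1 - (al2 * be + al * be2) * ga + G * (al * be * ga)).
Proof. by ring. Qed.

(** The time derivative is moved to the test function by one integration by parts,
    each second space derivative by two; flatness removes the boundary terms. *)
Lemma green_box a b U w G (al be ga : {poly R}) :
  open U -> box a b `<=` U -> a.1.1 < b.1.1 -> a.1.2 < b.1.2 -> a.2 < b.2 ->
  C2_in U w -> flat_at al a.1.1 b.1.1 -> flat_at be a.1.2 b.1.2 ->
  flat_at ga a.2 b.2 ->
  box_null a b (fun X => Lstar0 G w X * test_fun al be ga X
    - w X * (adj_test al be ga X + G X * test_fun al be ga X)).
Proof.
move=> oU BU a1 a2 a3 cw [ax bx ax' bx'] [ay by_ ay' by'] [at_ bt _ _].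
have [c0 c1 c2 c3 c4] := cw.
have H3 := green_t oU BU a3 c0 al be (c1 _ dt_basis) (c2 _ dt_basis) at_ bt.
have H1 := green_x1 oU BU a1 (c2 _ dx1_basis) be ga
  (c3 _ _ dx1_basis dx1_basis) (c4 _ _ dx1_basis dx1_basis) ax bx.
have H1' := green_x1 oU BU a1 c0 be ga (c1 _ dx1_basis) (c2 _ dx1_basis) ax' bx'.
have H2 := green_x2 oU BU a2 (c2 _ dx2_basis) al ga
  (c3 _ _ dx2_basis dx2_basis) (c4 _ _ dx2_basis dx2_basis) ay by_.
have H2' := green_x2 oU BU a2 c0 al ga (c1 _ dx2_basis) (c2 _ dx2_basis) ay' by'.
have := box_nullB (box_nullD H1' H2') (box_nullD H3 (box_nullD H1 H2)).
congr (box_null _ _ _); apply/funext => X.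
exact: green_algebra.
Qed.

End Green.

(** * Functions with zero integral over every open box *)

Section Bump.
Variable R : realType.

(** A parabola vanishing at x and y with values in [0, 1] between them. *)
Definition bump0 (x y : R) : {poly R} :=
  (y - x)^-2 *: (('X - x%:P) * (y%:P - 'X)).

(** On [x, y] these polynomials increase with k to the indicator of ]x, y[.
    Squaring bump0 makes the derivative vanish at the end points as well. *)
Definition bump (x y : R) k : {poly R} := 1 - (1 - bump0 x y ^+ 2) ^+ k.

Lemma bump0E x y t : (bump0 x y).[t] = (t - x) * (y - t) / (y - x) ^+ 2.
Proof. by rewrite /bump0 hornerZ hornerM !hornerD !hornerN !hornerX !hornerC mulrC. Qed.

Lemma bumpE x y k t : (bump x y k).[t] = 1 - (1 - (bump0 x y).[t] ^+ 2) ^+ k.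
Proof. by rewrite /bump !hornerE. Qed.

Lemma flat_bump x y k : flat_at (bump x y k) x y.
Proof.
have z1 : (bump0 x y).[x] = 0 by rewrite bump0E subrr !mul0r.
have z2 : (bump0 x y).[y] = 0 by rewrite bump0E subrr mulr0 mul0r.
have zd t : (bump0 x y).[t] = 0 -> (bump x y k)^`().[t] = 0.
  move=> t0; rewrite /bump derivB derivC deriv_exp derivB derivC expr2 derivM.
  rewrite !hornerE hornerMn hornerM hornerN hornerD !hornerM t0.
  by rewrite mulr0 mul0r addr0 oppr0 mul0r mul0rn oppr0.
split; rewrite ?zd// bumpE ?z1 ?z2 expr0n/= subr0 expr1n subrr//.
Qed.

Lemma bump0_itv x y t : x < y -> t \in `[x, y] -> 0 <= (bump0 x y).[t] <= 1.
Proof.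
move=> xy; rewrite in_itv/= bump0E => /andP[xt ty].
have d0 : 0 < (y - x) ^+ 2 by rewrite exprn_gt0// subr_gt0.
apply/andP; split.
  by apply: divr_ge0; [apply: mulr_ge0; rewrite subr_ge0|exact: ltW].
by rewrite ler_pdivrMr// mul1r; nra.
Qed.

Lemma bump0_itvoo x y t : x < y -> t \in `]x, y[ -> 0 < (bump0 x y).[t].
Proof.
move=> xy; rewrite in_itv/= bump0E => /andP[xt ty].
by apply: divr_gt0; [apply: mulr_gt0|apply: exprn_gt0]; rewrite subr_gt0.
Qed.

Lemma bump_itv x y k t : x < y -> t \in `[x, y] -> 0 <= (bump x y k).[t] <= 1.
Proof.
move=> xy /(bump0_itv xy)/andP[b0 b1]; rewrite bumpE.
have s0 : 0 <= 1 - (bump0 x y).[t] ^+ 2 by rewrite subr_ge0 expr_le1.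
have s1 : 1 - (bump0 x y).[t] ^+ 2 <= 1 by rewrite gerBl sqr_ge0.
by rewrite subr_ge0 exprn_ile1//= gerBl exprn_ge0.
Qed.

Lemma bump_cvg x y t : x < y -> t \in `]x, y[ ->
  (bump x y k).[t] @[k --> \oo] --> (1 : R).
Proof.
move=> xy txy; have b0 := bump0_itvoo xy txy.
have /andP[_ b1] := bump0_itv xy (subset_itv_oo_cc txy).
have -> : (fun k => (bump x y k).[t]) = (fun k => 1 - (1 - (bump0 x y).[t] ^+ 2) ^+ k).
  by apply/funext => k; rewrite bumpE.
rewrite -[X in _ --> X](subr0 1); apply: cvgB; first exact: cvg_cst.
apply: cvg_expr; rewrite ger0_norm; last by rewrite subr_ge0 expr_le1// ltW.
by rewrite ltrBlDr ltrDl exprn_gt0.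
Qed.

End Bump.

Section Dynkin.
Context d d' (T : measurableType d) (T' : measurableType d') (R : realType).
Variables (mu : {measure set T -> \bar R}) (h : T -> R).
Hypothesis hint : mu.-integrable setT (EFin \o h).

Let itg E := (\int[mu]_(x in E) (h x)%:E)%E.

(** The measurable sets A for which the integral of h over E and f^-1 A vanishes
    form a Dynkin class, by additivity of the integral; so it suffices to test the
    sets of a generating class stable under intersection. *)
Lemma integral_eq0_dynkin (f : T -> T') (E : set T) (G : set (set T')) :
  measurable_fun setT f -> measurable E ->
  @measurable _ T' = <<s G >> -> setI_closed G ->
  itg E = 0%E -> (forall A, G A -> itg (E `&` f @^-1` A) = 0%E) ->
  forall A, measurable A -> itg (E `&` f @^-1` A) = 0%E.
Proof.
move=> mf mE mG GI E0 G0.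
have mfA A : measurable A -> measurable (E `&` f @^-1` A).
  by move=> mA; apply: measurableI => //; rewrite -[_ @^-1` _]setTI; exact: mf.
have hS B : measurable B -> mu.-integrable B (EFin \o h).
  by move=> mB; apply: integrableS hint.
pose H : set (set T') := [set A | measurable A /\ itg (E `&` f @^-1` A) = 0%E].
have dH : dynkin H.
  split.
  - by split => //; rewrite preimage_setT setIT.
  - move=> A [mA A0]; split; first exact: measurableC.
    have EU : (E `&` f @^-1` A) `|` (E `&` f @^-1` (~` A)) = E.
      by rewrite -setIUr -preimage_setU setUv preimage_setT setIT.
    have := E0; rewrite /itg -{1}EU integral_setU; last first.
    - apply/disj_setPS => x [[_ ?] [_ ?]] //.
    - by rewrite EU; apply: measurable_funTS; case/integrableP: hint.
    - by apply: mfA; exact: measurableC.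
    - exact: mfA.
    by rewrite -!/(itg _) A0 add0e.
  - move=> F tF HF; split.
      by apply: bigcup_measurable => k _; case: (HF k).
    rewrite preimage_bigcup setI_bigcupr /itg integral_bigcup//.
    + by apply: eseries0 => k _ _; case: (HF k).
    + apply: trivIset_setIl => i j _ _ [x [Fi Fj]].
      by apply: (tF i j) => //; exists (f x).
    + by move=> k; apply: mfA; case: (HF k).
    + by apply: hS; apply: bigcup_measurable => k _; apply: mfA; case: (HF k).
move=> A mA; have : <<s G >> A by rewrite -mG.
rewrite -setI_closed_g_dynkin_g_sigma_algebra// => dA.
have [] // : H A.
apply: dA; split => // B GB; split; last exact: G0.
by rewrite mG; exact: sub_sigma_algebra.
Qed.

End Dynkin.

Section Zero_on_boxes.
Context (R : realType).
Local Notation R3m := (measurableTypeR R * measurableTypeR R * measurableTypeR R)%type.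

Lemma itvoo_setI_closed :
  setI_closed [set A : set R | exists x y, A = `]x, y[%classic].
Proof.
move=> _ _ [x [y ->]] [x' [y' ->]]; exists (Num.max x x'), (Num.min y y').
apply/seteqP; split => z /=; rewrite !in_itv/= lt_min gt_max.
  by move=> [/andP[-> ->] /andP[-> ->]].
by move=> /andP[/andP[-> ->] /andP[-> ->]].
Qed.

Lemma setX_measurable_setI_closed d1 d2 (T1 : measurableType d1) (T2 : measurableType d2) :
  setI_closed [set A `*` B | A in (@measurable _ T1) & B in (@measurable _ T2)].
Proof.
move=> _ _ [A mA [B mB <-]] [A' mA' [B' mB' <-]].
exists (A `&` A'); first exact: measurableI.
by exists (B `&` B'); [exact: measurableI|rewrite setXI].
Qed.

(** From boxes to measurable sets, the open interval on one axis is replaced by a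
    Borel set at a time, and finally Borel rectangles by measurable sets.  Each
    Dynkin argument requires the integral to vanish also when the new side is the
    whole line: since h lives in obox a0 b0, that side may be cut down to the
    corresponding edge of obox a0 b0. *)
Lemma integral_eq0_measurable (h : R * R * R -> R) a0 b0 :
  leb3.-integrable (setT : set R3m) (EFin \o h) ->
  (forall X, ~ obox a0 b0 X -> h X = 0) ->
  (forall a b, \int[leb3]_(X in (obox a b : set R3m)) (h X)%:E = 0)%E ->
  forall E : set R3m, measurable E -> (\int[leb3]_(X in E) (h X)%:E = 0)%E.
Proof.
move=> hint h0 hbox.
pose Z (E : set R3m) := (\int[leb3]_(X in E) (h X)%:E = 0)%E.
have supp E F : (forall X, obox a0 b0 X -> (E X <-> F X)) -> Z E -> Z F.
  move=> EF; rewrite /Z => <-; rewrite integral_mkcond [RHS]integral_mkcond.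
  apply: eq_integral => X _; rewrite !patchE.
  have [X0|nX0] := pselect (obox a0 b0 X); last by rewrite h0//; do 2 case: ifP.
  by congr (if _ then _ else _); apply/idP/idP => /set_mem/(EF X X0)/mem_set.
pose p1 (X : R3m) : measurableTypeR R := X.1.1.
pose p2 (X : R3m) : measurableTypeR R := X.1.2.
pose p3 (X : R3m) : measurableTypeR R := X.2.
have mp1 : measurable_fun setT p1 by apply: measurableT_comp => //; exact: measurable_fst.
have mp2 : measurable_fun setT p2 by apply: measurableT_comp => //; exact: measurable_fst.
have mp3 : measurable_fun setT p3 by exact: measurable_snd.
have mpre (p : R3m -> measurableTypeR R) A : measurable_fun setT p -> measurable A ->
    measurable (p @^-1` A).
  by move=> mp mA; rewrite -[_ @^-1` _]setTI; exact: mp.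
have RG := @RGenOpens.measurableE R.
have S1 (J K A : set (measurableTypeR R)) : (exists x y, J = `]x, y[%classic) ->
    (exists x y, K = `]x, y[%classic) -> measurable A ->
    Z ((p2 @^-1` J `&` p3 @^-1` K) `&` p1 @^-1` A).
  move=> [x2 [y2 ->]] [x3 [y3 ->]].
  have bx x1 y1 : Z ((p2 @^-1` `]x2, y2[ `&` p3 @^-1` `]x3, y3[) `&` p1 @^-1` `]x1, y1[).
    have := hbox (x1, x2, x3) (y1, y2, y3); apply: supp => X _.
    by rewrite /obox /p1 /p2 /p3/=; split=> [[[]]|[[]]].
  apply: (integral_eq0_dynkin hint mp1 _ RG itvoo_setI_closed) => //.
  - by apply: measurableI; apply: mpre.
  - apply: supp (bx a0.1.1 b0.1.1) => X [[X1 _] _].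
    by split => [[]//|]; split.
  - by move=> _ [x1 [y1 ->]]; exact: bx.
have S2 (A K B : set (measurableTypeR R)) : measurable A ->
    (exists x y, K = `]x, y[%classic) -> measurable B ->
    Z ((p1 @^-1` A `&` p3 @^-1` K) `&` p2 @^-1` B).
  move=> mA [x3 [y3 ->]].
  have bx x2 y2 : Z ((p1 @^-1` A `&` p3 @^-1` `]x3, y3[) `&` p2 @^-1` `]x2, y2[).
    have := S1 `]x2, y2[%classic `]x3, y3[%classic A.
    rewrite (_ : _ `&` _ = p1 @^-1` A `&` p3 @^-1` `]x3, y3[ `&` p2 @^-1` `]x2, y2[).
      by apply => //; [exists x2, y2|exists x3, y3].
    by rewrite setIC setIA setIAC.
  apply: (integral_eq0_dynkin hint mp2 _ RG itvoo_setI_closed) => //.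
  - by apply: measurableI; apply: mpre.
  - apply: supp (bx a0.1.2 b0.1.2) => X [[_ X1] _].
    by split => [[]//|]; split.
  - by move=> _ [x1 [y1 ->]]; exact: bx.
have S3 (A B C : set (measurableTypeR R)) : measurable A -> measurable B -> measurable C ->
    Z ((p1 @^-1` A `&` p2 @^-1` B) `&` p3 @^-1` C).
  move=> mA mB.
  have bx x3 y3 : Z ((p1 @^-1` A `&` p2 @^-1` B) `&` p3 @^-1` `]x3, y3[).
    have := S2 A `]x3, y3[%classic B mA.
    by rewrite setIAC; apply => //; exists x3, y3.
  apply: (integral_eq0_dynkin hint mp3 _ RG itvoo_setI_closed) => //.
  - by apply: measurableI; apply: mpre.
  - apply: supp (bx a0.2 b0.2) => X [_ X1].
    by split => [[]//|]; split.
  - by move=> _ [x1 [y1 ->]]; exact: bx.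
have S4 (C : set (measurableTypeR R)) (E : set (measurableTypeR R * measurableTypeR R)) :
    measurable C -> measurable E -> Z (p3 @^-1` C `&` fst @^-1` E).
  move=> mC; apply: (integral_eq0_dynkin hint _ _ (measurable_prod_measurableType _ _)
    (@setX_measurable_setI_closed _ _ _ _)).
  - exact: measurable_fst.
  - exact: mpre.
  - have := S3 setT setT C; rewrite !preimage_setT !setTI; exact.
  - move=> _ [A mA [B mB <-]]; have := S3 A B C mA mB mC.
    by rewrite setIC; congr Z; apply/seteqP; split => X.
move=> E mE; rewrite -[E]setTI.
apply: (integral_eq0_dynkin hint (@measurable_id _ _ setT) measurableT
  (measurable_prod_measurableType _ _) (@setX_measurable_setI_closed _ _ _ _)) => //.
- by have := S4 setT setT measurableT measurableT; rewrite !preimage_setT setTI.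
- move=> _ [A mA [B mB <-]]; have := S4 B A mB mA.
  congr Z; apply/seteqP; split => X.
    by move=> [XB XA]; split.
  by move=> [_ [XA XB]]; split.
Qed.

End Zero_on_boxes.

(** * Closability of L^* *)

Section L2_bounded.
Context d (X : measurableType d) (R : realType).
Variables (mu : {measure set X -> \bar R}) (D : set X).
Hypothesis mD : measurable D.

Lemma sqint_ae_bounded (f : X -> R) (M : R) : (mu D < +oo)%E -> measurable_fun D f ->
  {ae mu, forall x, D x -> `|f x| <= M} -> sqint mu D f.
Proof.
move=> muD mf fM; split => //.
apply: (@le_lt_trans _ _ (\int[mu]_(x in D) (cst (M ^+ 2)%:E x))%E).
  apply: ae_ge0_le_integral => //.
  - by move=> x _; rewrite lee_fin sqr_ge0.
  - by apply/measurable_EFinP; exact: measurable_funX.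
  - by move=> x _; rewrite lee_fin sqr_ge0.
  - move: fM; apply: filterS => x fM Dx; have {}fM := fM Dx; rewrite lee_fin.
    rewrite -(real_normK (num_real (f x))) lerXn2r ?nnegrE//.
    exact: le_trans fM.
by rewrite integral_cst//= lte_mul_pinfty// lee_fin sqr_ge0.
Qed.

End L2_bounded.

Section Closability.
Context (R : realType).
Local Notation mu := (@lebesgue_measure R).
Local Notation R3m := (measurableTypeR R * measurableTypeR R * measurableTypeR R)%type.
Implicit Types (a b : R * R * R) (U : set (R * R * R)) (w G h : R * R * R -> R).
Local Notation ipB a b := (ip leb3 (box a b : set R3m)).
Local Notation sqB a b := (sqint leb3 (box a b : set R3m)).

Definition ae_bounded_on U G : Prop := measurable_fun (U : set R3m) G /\
  exists M : R, {ae leb3, forall X : R3m, U X -> `|G X| <= M}.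

Lemma continuous_ae_bounded a b U f : open U -> box a b `<=` U -> {in U, continuous f} ->
  ae_bounded_on (box a b) f.
Proof.
move=> oU BU cf; split.
  apply: measurable_funS (continuous_measurable3 oU cf) => //.
  exact: open_measurable3.
have [M [_ Mb]] := continuous_compact_bounded (@box_compact R a b) BU cf.
exists (`|M| + 1); apply: aeW => X BX; apply: (Mb (`|M| + 1)) => //.
by rewrite ltr_pwDr// ler_norm.
Qed.

Lemma ae_boundedD U f g : ae_bounded_on U f -> ae_bounded_on U g -> ae_bounded_on U (f \+ g).
Proof.
move=> [mf [M Mf]] [mg [N Ng]]; split; first exact: measurable_funD.
exists (M + N); move: Mf Ng; apply: filterS2 => X fM gN UX.
by apply: le_trans (ler_normD _ _) _; apply: lerD; [exact: fM|exact: gN].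
Qed.

Lemma ae_boundedM U f g : ae_bounded_on U f -> ae_bounded_on U g -> ae_bounded_on U (f \* g).
Proof.
move=> [mf [M Mf]] [mg [N Ng]]; split; first exact: measurable_funM.
exists (M * N); move: Mf Ng; apply: filterS2 => X fM gN UX.
by rewrite /= normrM; apply: ler_pM => //; [exact: fM|exact: gN].
Qed.

Lemma ae_boundedS (U V : set R3m) f : measurable U -> V `<=` U ->
  ae_bounded_on U f -> ae_bounded_on V f.
Proof.
move=> mU VU [mf [M Mf]]; split; first exact: measurable_funS mf.
by exists M; move: Mf; apply: filterS => X h VX; apply: h; exact: VU.
Qed.

Lemma ae_bounded_sqint a b f : ae_bounded_on (box a b) f -> sqB a b f.
Proof.
move=> [mf [M Mf]]; apply: (@sqint_ae_bounded _ _ _ _ _ (measurable_box a b) _ M) => //.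
exact: box_finite.
Qed.

Lemma Lstar0_ae_bounded a b U G w : open U -> box a b `<=` U -> C2_in U w ->
  ae_bounded_on U G -> ae_bounded_on (box a b) (Lstar0 G w).
Proof.
move=> oU BU [c0 c1 c2 c3 c4] bG.
have bc f : {in U, continuous f} -> ae_bounded_on (box a b) f.
  exact: continuous_ae_bounded.
rewrite (_ : Lstar0 G w = (fun X => - 'D_(dt R) w X - laplacian w X) \+ (G \* w)); last first.
  by apply/funext.
apply: ae_boundedD; last first.
  apply: ae_boundedM; last exact: bc.
  by apply: ae_boundedS bG => //; exact: open_measurable3.
apply: bc => X XU; apply: cvgB; first by apply: cvgN; apply: c2 => //; exact: dt_basis.
by apply: cvgD; apply: c4 => //; rewrite ?dx1_basis ?dx2_basis.
Qed.

(** Green's identity moves L^* from w n to the test function; as w n tends to 0 in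
    L^2 and the adjoint of the test function is bounded, the limit is 0. *)
Lemma limit_tested_eq0 a b U G h (w : nat -> R * R * R -> R) (al be ga : {poly R}) :
  open U -> box a b `<=` U -> a.1.1 < b.1.1 -> a.1.2 < b.1.2 -> a.2 < b.2 ->
  ae_bounded_on U G -> (forall n, C2_in U (w n)) -> sqB a b h ->
  flat_at al a.1.1 b.1.1 -> flat_at be a.1.2 b.1.2 -> flat_at ga a.2 b.2 ->
  ipB a b (w n) (w n) @[n --> \oo] --> 0 ->
  ipB a b (Lstar0 G (w n) \- h) (Lstar0 G (w n) \- h) @[n --> \oo] --> 0 ->
  ipB a b h (test_fun al be ga) = 0.
Proof.
move=> oU BU a1 a2 a3 bG cw sh fal fbe fga w0 Lw0.
have mB := measurable_box a b.
have ct := @continuous_test_fun R al be ga.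
have cad := @continuous_adj_test R al be ga.
have bt : ae_bounded_on (box a b) (test_fun al be ga).
  by apply: continuous_ae_bounded oU BU _ => X _; exact: ct.
have bad : ae_bounded_on (box a b) (fun X => adj_test al be ga X + G X * test_fun al be ga X).
  apply: ae_boundedD.
    by apply: continuous_ae_bounded oU BU _ => X _; exact: cad.
  apply: ae_boundedM bt.
  by apply: ae_boundedS bG => //; exact: open_measurable3.
have sw n : sqB a b (w n).
  by apply/ae_bounded_sqint; apply: continuous_ae_bounded oU BU _; case: (cw n).
have sL n : sqB a b (Lstar0 G (w n)).
  by apply/ae_bounded_sqint; exact: Lstar0_ae_bounded oU BU (cw n) bG.
have st := ae_bounded_sqint bt; have sa := ae_bounded_sqint bad.
have E n : ipB a b (Lstar0 G (w n)) (test_fun al be ga) =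
    ipB a b (w n) (fun X => adj_test al be ga X + G X * test_fun al be ga X).
  apply/eqP; rewrite -subr_eq0; apply/eqP.
  rewrite /ip -RintegralB//; [|exact: integrable_mul..].
  have [_ g0] := green_box G oU BU a1 a2 a3 (cw n) fal fbe fga.
  by rewrite /Rintegral g0.
have l1 := ip_cvgl mB sL sh st Lw0.
have l2 : ipB a b (w n) (fun X => adj_test al be ga X + G X * test_fun al be ga X)
   @[n --> \oo] --> ipB a b (cst 0) (fun X => adj_test al be ga X + G X * test_fun al be ga X).
  apply: ip_cvgl => //.
    apply/ae_bounded_sqint; apply: continuous_ae_bounded oU BU _ => X _.
    exact: cvg_cst.
  have -> // : (fun n => ipB a b (w n \- cst 0) (w n \- cst 0)) = (fun n => ipB a b (w n) (w n)).
  by apply/funext => n; rewrite (_ : w n \- cst 0 = w n)//; apply/funext => X /=; rewrite subr0.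
have E0 : ipB a b (cst 0) (fun X => adj_test al be ga X + G X * test_fun al be ga X) = 0.
  by rewrite /ip; under eq_Rintegral do rewrite mul0r; rewrite Rintegral_cst// mul0r.
move: l1; rewrite (funext E) => l1.
by rewrite -E0; apply: (cvg_unique _ l1 l2).
Qed.

(** Dominated convergence in limit_tested_eq0 along products of bumps, which
    increase to the indicator of the open box. *)
Lemma limit_integral_obox_eq0 a b U G h (w : nat -> R * R * R -> R) :
  open U -> box a b `<=` U -> a.1.1 < b.1.1 -> a.1.2 < b.1.2 -> a.2 < b.2 ->
  ae_bounded_on U G -> (forall n, C2_in U (w n)) -> sqB a b h ->
  ipB a b (w n) (w n) @[n --> \oo] --> 0 ->
  ipB a b (Lstar0 G (w n) \- h) (Lstar0 G (w n) \- h) @[n --> \oo] --> 0 ->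
  (\int[leb3]_(X in (obox a b : set R3m)) (h X)%:E = 0)%E.
Proof.
move=> oU BU a1 a2 a3 bG cw sh w0 Lw0.
have mB := measurable_box a b; have mO := measurable_obox a b.
have OB : obox a b `<=` box a b.
  by move=> X [[/= h1 h2] h3]; split; [split|]; exact: subset_itv_oo_cc.
pose phi k := test_fun (bump a.1.1 b.1.1 k) (bump a.1.2 b.1.2 k) (bump a.2 b.2 k).
have h0 k : ipB a b h (phi k) = 0.
  by apply: limit_tested_eq0 oU BU a1 a2 a3 bG cw sh _ _ _ w0 Lw0; exact: flat_bump.
have mphi k : measurable_fun (box a b : set R3m) (phi k).
  apply: measurable_funS (continuous_measurable3 openT _) => //.
  by move=> X _; exact: continuous_test_fun.
have sphi k : sqB a b (phi k).
  apply/ae_bounded_sqint; apply: continuous_ae_bounded oU BU _ => X _.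
  exact: continuous_test_fun.
have phi01 k X : box a b X -> 0 <= phi k X <= 1.
  move=> [[/= h1 h2] h3].
  have /andP[p1 q1] := bump_itv k a1 h1.
  have /andP[p2 q2] := bump_itv k a2 h2.
  have /andP[p3 q3] := bump_itv k a3 h3.
  by rewrite /phi /test_fun !mulr_ge0//= mulr_ile1// ?mulr_ge0// mulr_ile1.
have s1 : sqB a b (cst 1).
  apply/ae_bounded_sqint; apply: continuous_ae_bounded oU BU _ => X _.
  exact: cvg_cst.
have ih : leb3.-integrable (box a b : set R3m) (EFin \o h).
  have := integrable_mul mB sh s1.
  by rewrite (_ : (fun X => h X * cst 1 X) = h)//; apply/funext => X /=; rewrite mulr1.
have mh : measurable_fun (box a b : set R3m) h by case: sh.
(* every phi k vanishes on the boundary of the box, as does the indicator *)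
have cvphi X : box a b X -> (h X * phi k X)%:E @[k --> \oo] --> (h X * \1_(obox a b) X)%:E.
  move=> BX; apply: cvg_EFin; first exact: nearW.
  apply: cvgM; first exact: cvg_cst.
  rewrite indicE; case: (boolP (X \in obox a b)) => [/set_mem[[/= h1 h2] h3]|].
    rewrite -[X in _ --> X](_ : 1 * 1 * 1 = 1); last by rewrite !mulr1.
    by apply: cvgM; [apply: cvgM|]; apply: bump_cvg.
  move=> XO; have -> : (fun k => phi k X) = cst 0; last exact: cvg_cst.
  apply/funext => k; rewrite /phi /test_fun /=.
  have [e1 e2 _ _] := flat_bump a.1.1 b.1.1 k.
  have [f1 f2 _ _] := flat_bump a.1.2 b.1.2 k.
  have [g1 g2 _ _] := flat_bump a.2 b.2 k.
  move: BX XO => [[/=]]; rewrite !in_itv/= !le_eqVlt.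
  move=> /andP[/predU1P[<-|x1]]; first by rewrite e1 !mul0r.
  move=> /predU1P[->|x2]; first by rewrite e2 !mul0r.
  move=> /andP[/predU1P[<-|y1]]; first by rewrite f1 mulr0 mul0r.
  move=> /predU1P[->|y2]; first by rewrite f2 mulr0 mul0r.
  move=> /andP[/predU1P[<-|t1]]; first by rewrite g1 mulr0.
  move=> /predU1P[->|t2]; first by rewrite g2 mulr0.
  by rewrite notin_setE => -[]; split; [split|]; rewrite /= in_itv/= ?x1 ?x2 ?y1 ?y2 ?t1 ?t2.
have mind : measurable_fun (box a b : set R3m) (\1_(obox a b) : R3m -> R).
  by apply: measurable_funTS; exact: measurable_indic.
have cvae : {ae leb3, forall X : R3m, box a b X ->
    (h X * phi k X)%:E @[k --> \oo] --> (h X * \1_(obox a b) X)%:E}.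
  exact: aeW.
have dom : {ae leb3, forall (X : R3m) k, box a b X ->
    (`|(h X * phi k X)%:E| <= (`|h X|)%:E)%E}.
  apply: aeW => X k BX; rewrite lee_fin normrM ler_piMr//.
  by have /andP[p0 p1] := phi01 k X BX; rewrite ger0_norm.
have mhphi k : measurable_fun (box a b : set R3m) (fun X => (h X * phi k X)%:E).
  exact/measurable_EFinP/measurable_funM.
have mhind : measurable_fun (box a b : set R3m) (fun X => (h X * \1_(obox a b) X)%:E).
  exact/measurable_EFinP/measurable_funM.
have [_ _] := dominated_convergence mB mhphi mhind cvae (integrable_norm ih) dom.
rewrite (_ : [sequence _]_n = cst 0%E); last first.
  apply/funext => k /=; transitivity (ipB a b h (phi k))%:E; last by rewrite h0.
  exact: ip_fin.
move=> /(cvg_unique (@ereal_hausdorff R) (cvg_cst 0%E)) E0.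
rewrite -(setIidr OB) integral_mkcondr [RHS]E0; apply: eq_integral => X _.
by rewrite patchE indicE; case: ifP => _; rewrite ?mulr1 ?mulr0.
Qed.

Lemma obox_setI a b a' b' : obox a b `&` obox a' b' =
  obox (Num.max a.1.1 a'.1.1, Num.max a.1.2 a'.1.2, Num.max a.2 a'.2)
       (Num.min b.1.1 b'.1.1, Num.min b.1.2 b'.1.2, Num.min b.2 b'.2).
Proof.
have I (x y x' y' z : R) : (z \in `]x, y[) && (z \in `]x', y'[) =
    (z \in `](Num.max x x'), (Num.min y y')[).
  by rewrite !in_itv/= lt_min gt_max andbACA.
apply/seteqP; split => X.
  by move=> [[[/= h1 h2] h3] [[/= h1' h2'] h3']]; split; [split|];
    rewrite /= -I; apply/andP.
move=> [[]]; rewrite /= -!I => /andP[h1 h1'] /andP[h2 h2'] /andP[h3 h3'].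
by split; (split; [split|]).
Qed.

Lemma obox_empty a b : ~ [/\ a.1.1 < b.1.1, a.1.2 < b.1.2 & a.2 < b.2] -> obox a b = set0.
Proof.
move=> nab; apply/seteqP; split => // X [[/=]].
rewrite !in_itv/= => /andP[h1 h1'] /andP[h2 h2'] /andP[h3 h3']; apply: nab.
by split; [exact: lt_trans h1 h1'|exact: lt_trans h2 h2'|exact: lt_trans h3 h3'].
Qed.

(** h has integral zero over every open box of U, hence over every measurable
    subset of such a box, so it vanishes almost everywhere in each of the countably
    many rational boxes that exhaust U. *)
Lemma Lstar0_closable U G h (w : nat -> R * R * R -> R) :
  open U -> ae_bounded_on U G -> (forall n, C2_in U (w n)) ->
  (forall a b, box a b `<=` U ->
    [/\ sqB a b h, ipB a b (w n) (w n) @[n --> \oo] --> 0 &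
      ipB a b (Lstar0 G (w n) \- h) (Lstar0 G (w n) \- h) @[n --> \oo] --> 0]) ->
  ae_eq leb3 (U : set R3m) h (cst 0).
Proof.
move=> oU bG cw H.
have zero_obox a b : box a b `<=` U ->
    (\int[leb3]_(X in (obox a b : set R3m)) (h X)%:E = 0)%E.
  move=> BU; have [[a1 a2 a3]|/obox_empty ->] :=
      pselect [/\ a.1.1 < b.1.1, a.1.2 < b.1.2 & a.2 < b.2]; last exact: integral_set0.
  have [sh w0 Lw0] := H _ _ BU.
  exact: (limit_integral_obox_eq0 oU BU a1 a2 a3 bG cw sh w0 Lw0).
have zero_box a b : box a b `<=` U -> ae_eq leb3 (obox a b : set R3m) h (cst 0).
  move=> BU; have mB := measurable_box a b; have mO := measurable_obox a b.
  have OB : obox a b `<=` box a b.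
    by move=> X [[/= h1 h2] h3]; split; [split|]; exact: subset_itv_oo_cc.
  have [sh _ _] := H _ _ BU.
  have s1 : sqB a b (cst 1).
    apply/ae_bounded_sqint; apply: continuous_ae_bounded oU BU _ => X _.
    exact: cvg_cst.
  have ih : leb3.-integrable (box a b : set R3m) (EFin \o h).
    have := integrable_mul mB sh s1.
    by rewrite (_ : (fun X => h X * cst 1 X) = h)//; apply/funext => X /=; rewrite mulr1.
  have ih' : leb3.-integrable (obox a b : set R3m) (EFin \o h) by exact: integrableS ih.
  pose h' : R3m -> R := h \_ (obox a b).
  have ih2 : leb3.-integrable (setT : set R3m) (EFin \o h').
    by have := (integrable_mkcond _ mO).1 ih'; rewrite restrict_EFin.
  have intE E : (\int[leb3]_(X in (E : set R3m)) (h' X)%:E =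
      \int[leb3]_(X in (E `&` obox a b : set R3m)) (h X)%:E)%E.
    by rewrite integral_mkcondr; apply: eq_integral => X _; rewrite /h' !patchE; case: ifP.
  have zE : forall E : set R3m, measurable E -> (\int[leb3]_(X in E) (h' X)%:E = 0)%E.
    apply: (integral_eq0_measurable (a0 := a) (b0 := b) ih2).
      by move=> X nX; rewrite /h' patchE; case: ifP => // /set_mem.
    move=> a' b'; rewrite intE obox_setI; apply: zero_obox => X [[/= h1 h2] h3].
    apply: BU; split; [split|];
      [move: h1|move: h2|move: h3]; rewrite /= !in_itv/= le_min ge_max;
      by move=> /andP[/andP[_ ->] /andP[_ ->]].
  have : ae_eq leb3 (setT : set R3m) (EFin \o h') (cst 0%E).
    apply: integral_ae_eq => // E _ mE; rewrite zE//.
    by apply/esym; exact: integral0.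
  apply: filterS => X /(_ I) /= hX OX; move: hX.
  by rewrite /h' patchE mem_set// => -[].
(* rational boxes are enumerated by nat to take a countable intersection *)
pose P n (X : R3m) := if unpickle n is Some q then
  rat_box q `<=` U -> rat_obox q X -> h X = 0 else True.
have aeP : {ae leb3, forall X : R3m, forall n, P n X}.
  apply: ae_foralln => n; rewrite /P; case: (unpickle n) => [q|]; last exact: aeW.
  have [qU|nqU] := pselect (rat_box q `<=` U); last exact: aeW.
  by move: (zero_box _ _ qU); apply: filterS => X hX _; exact: hX.
move: aeP; apply: filterS => X PX UX.
have [q qU qX] := open_rat_box_cover oU UX.
by have := PX (pickle q); rewrite /P pickleK; exact.
Qed.

End Closability.

(** * The domain and the weights *)

Section Domain.
Context (R : realType).
Local Notation R2m := (measurableTypeR R * measurableTypeR R)%type.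
Local Notation R3m := (measurableTypeR R * measurableTypeR R * measurableTypeR R)%type.
Variables (Omega : set (R * R)) (T : R).
Hypotheses (hOmega : bounded_domain Omega) (hT : 0 < T).
Local Notation QT := (cylinder Omega T).

Lemma Omega_open : open Omega. Proof. by case: hOmega. Qed.

Lemma Omega_sub_rect : exists N : R, Omega `<=` `[-N, N] `*` `[-N, N].
Proof.
case: hOmega => _ _ _ [M [_ Mb]]; exists (`|M| + 1) => -[x y] Oxy.
have /= := Mb (`|M| + 1) _ _ Oxy; rewrite ltr_pwDr ?ler_norm// => /(_ isT).
rewrite /Num.norm/= ge_max => /andP[xM yM].
by split; rewrite /= in_itv/= -ler_norml.
Qed.

Lemma closure_Omega_compact : compact (closure Omega).
Proof.
have [N ON] := Omega_sub_rect.
have cK : compact (`[-N, N] `*` `[-N, N] : set (R * R)).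
  by apply: compact_setX; exact: segment_compact.
apply: (subclosed_compact _ cK); first exact: closed_closure.
have clK : closed (`[-N, N] `*` `[-N, N] : set (R * R)).
  by apply: (compact_closed _ cK); exact: norm_hausdorff.
by rewrite ((closure_id _).1 clK); exact: closureS.
Qed.

Lemma QT_sub_box : exists a b, QT `<=` box a b.
Proof.
have [N ON] := Omega_sub_rect; exists (-N, -N, 0), (N, N, T) => X [/= /ON h1 h2].
by split => //; exact: subset_itv_oo_cc.
Qed.

Lemma closure_QT_compact : compact (closure QT).
Proof.
have [a [b Qab]] := QT_sub_box.
have cK := @box_compact R a b.
apply: (subclosed_compact _ cK); first exact: closed_closure.
have clK : closed (box a b) by apply: (compact_closed _ cK); exact: norm_hausdorff.
by rewrite ((closure_id _).1 clK); exact: closureS.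
Qed.

Lemma QT_open : open QT.
Proof.
rewrite (_ : QT = (fst @^-1` Omega) `&` (snd @^-1` `]0, T[%classic)); last by [].
apply: openI; apply: open_comp => [X _|]; [exact: cvg_fst|exact: Omega_open|exact: cvg_snd|].
exact: interval_open.
Qed.

Lemma measurable_QT : measurable (QT : set R3m).
Proof. exact: open_measurable3 QT_open. Qed.

Lemma measurable_Omega : measurable (Omega : set R2m).
Proof. exact: open_measurable2 Omega_open. Qed.

Lemma QT_finite : (leb3 (QT : set R3m) < +oo)%E.
Proof.
have [a [b Qab]] := QT_sub_box.
apply: le_lt_trans (box_finite a b); apply: le_measure; rewrite ?inE//.
- exact: measurable_QT.
- exact: measurable_box.
Qed.

Lemma Omega_finite : (leb2 (Omega : set R2m) < +oo)%E.
Proof.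
have [N ON] := Omega_sub_rect.
apply: le_lt_trans (rect_finite (-N) N (-N) N); apply: le_measure; rewrite ?inE//.
- exact: measurable_Omega.
- exact: measurableX.
Qed.

Lemma extension_bounded f : (exists g, continuous_extension QT f g) ->
  ae_bounded_on QT f.
Proof.
move=> [g fg]; have cf := continuous_extension_interior QT_open fg.
have [cg fgE] := fg; split; first exact: continuous_measurable3 QT_open cf.
have /compact_bounded[M [_ Mb]] : compact (g @` closure QT).
  by apply: continuous_compact => //; exact: closure_QT_compact.
exists (`|M| + 1); apply: aeW => X QX; rewrite fgE ?inE//.
apply: (Mb (`|M| + 1)); first by rewrite ltr_pwDr// ler_norm.
by exists X => //; exact: subset_closure.
Qed.

Lemma QT_sqint (f : R * R * R -> R) : ae_bounded_on QT f -> sqint leb3 (QT : set R3m) f.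
Proof.
move=> [mf [M Mf]]; apply: (@sqint_ae_bounded _ _ _ _ _ measurable_QT _ M) => //.
exact: QT_finite.
Qed.

End Domain.

Section Weights.
Context (R : realType).
Local Notation R2m := (measurableTypeR R * measurableTypeR R)%type.
Local Notation R3m := (measurableTypeR R * measurableTypeR R * measurableTypeR R)%type.
Variables (Omega omega : set (R * R)) (T : R) (chi0 : R * R -> R) (K1 K2 : R).
Hypotheses (hOmega : bounded_domain Omega) (hT : 0 < T).
Hypotheses (hchi0 : admissible_chi0 Omega omega chi0) (hK1 : 0 < K1).
Hypothesis hK2_large : forall x, closure Omega x -> chi0 x < K2.
Local Notation QT := (cylinder Omega T).
Local Notation rho := (rho T chi0 K1 K2).
Local Notation rho_ := (rho_ T chi0 K1 K2).
Local Notation chi := (chi chi0 K1 K2).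

Let cchi0 : {within closure Omega, continuous chi0}.
Proof. by case: hchi0 => -[]. Qed.

(** chi0 attains a maximum below K2 on the compact closure, so chi stays away from
    0. *)
Lemma chi_bounds : exists c0 c1, 0 < c0 /\ forall x, Omega x -> c0 <= chi x <= c1.
Proof.
have [x0 Ox0] : Omega !=set0 by case: hOmega.
have cO0 : closure Omega !=set0 by exists x0; exact: subset_closure.
have [xm xmO xmP] := compact_EVT_max cO0 (closure_Omega_compact hOmega) cchi0.
exists (K1 * (expR K2 - expR (chi0 xm))), (K1 * expR K2); split.
  rewrite mulr_gt0// subr_gt0 ltr_expR; apply: hK2_large; exact: set_mem.
move=> x Ox; rewrite /chi !ler_pM2l//; apply/andP; split.
  by rewrite lerD2l lerN2 ler_expR; apply: xmP; rewrite inE; exact: subset_closure.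
by rewrite gerBl expR_ge0.
Qed.

Lemma rho_gt0 X : 0 < rho X. Proof. exact: expR_gt0. Qed.

Lemma QT_time X : QT X -> 0 < T - X.2 /\ T - X.2 <= T.
Proof. by move=> [_ /=]; rewrite in_itv/= => /andP[h1 h2]; split; lra. Qed.

Lemma rho_i_gt0 i X : QT X -> 0 < rho_ i X.
Proof. by move=> /QT_time[h _]; rewrite /rho_ mulr_gt0 ?rho_gt0// powR_gt0. Qed.

(** Squares turn the half-integer powers of T - t into integer ones. *)
Lemma rho0_sqr X : QT X -> rho_ 0 X ^+ 2 = (T - X.2) ^+ 3 * rho X ^+ 2.
Proof.
move=> /QT_time[h _]; rewrite /Defs.rho_ exprMn; congr (_ * _).
rewrite -[LHS](powR_mulrn 2 (powR_ge0 _ _)) -powRrM subr0.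
have -> : 3 / 2 * 2%:R = 3%:R :> R by field.
by rewrite powR_mulrn// ltW.
Qed.

Lemma rho2_sqr X : QT X -> rho_ 2 X ^+ 2 = (T - X.2)^-1 * rho X ^+ 2.
Proof.
move=> /QT_time[h _]; rewrite /Defs.rho_ exprMn; congr (_ * _).
rewrite -[LHS](powR_mulrn 2 (powR_ge0 _ _)) -powRrM.
have -> : (3 / 2 - 2%:R) * 2%:R = -1 :> R by field.
by rewrite powR_inv1// ltW.
Qed.

Lemma rho_ge1 X : QT X -> 1 <= rho X.
Proof.
move=> QX; have [c0 [c1 [c00 cc]]] := chi_bounds.
have /cc/andP[h _] : Omega X.1 by case: QX.
have [T0 _] := QT_time QX.
rewrite /Defs.rho -expR0 ler_expR divr_ge0// ?ltW//; exact: lt_le_trans h.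
Qed.

Lemma rhoV_le1 X : QT X -> `|(rho X)^-1| <= 1.
Proof.
move=> QX; have r0 := rho_gt0 X.
rewrite ger0_norm; last by rewrite invr_ge0 ltW.
by rewrite invf_le1//; exact: rho_ge1.
Qed.

(** rho_0^-1 contains (T - t) ^ (-3/2), which blows up at t = T, but rho is at least
    the cubic term of the exponential of c0 / (T - t) and compensates. *)
Lemma rho0V_bounded : exists M, forall X, QT X -> `|(rho_ 0 X)^-1| <= M.
Proof.
have [c0 [c1 [c00 cc]]] := chi_bounds.
exists (6 / c0 ^+ 3 + 1) => X QX.
have /cc/andP[h _] : Omega X.1 by case: QX.
have [T0 _] := QT_time QX; have r0 := rho_i_gt0 0 QX.
rewrite ger0_norm; last by rewrite invr_ge0 ltW.
suff : (rho_ 0 X)^-1 ^+ 2 <= 6 / c0 ^+ 3.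
  (* r <= r ^ 2 + 1, whence the bound M without a square root *)
  by have := sqr_ge0 ((rho_ 0 X)^-1 - 1); nra.
have rX1 := rho_ge1 QX.
have c03 : 0 < c0 ^+ 3 by rewrite exprn_gt0.
have T3 : 0 < (T - X.2) ^+ 3 by rewrite exprn_gt0.
have rX : (c0 ^+ 3 / 6) / (T - X.2) ^+ 3 <= rho X.
  have d0 : 0 <= c0 / (T - X.2) by rewrite divr_ge0 ?ltW.
  apply: (@le_trans _ _ (expR (c0 / (T - X.2)))).
    apply: le_trans (expR_ge1Dxn 2 d0).
    by rewrite expr_div_n mulrAC lerDr.
  by rewrite /Defs.rho ler_expR ler_pM2r ?invr_gt0.
rewrite exprVn rho0_sqr// -[leRHS]invrK invf_div lef_pV2 ?posrE; last first.
- by rewrite divr_gt0.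
- by rewrite mulr_gt0// exprn_gt0// rho_gt0.
move: rX; rewrite ler_pdivrMr// => rX; apply: (le_trans rX).
by rewrite mulrC ler_pM2l// ler_eXnr.
Qed.

(** The weights only blow up or vanish at t = T; on the first half of the time
    interval the weighted norms control unweighted ones. *)
Lemma weights_early_lb : exists2 c, 0 < c & forall X, QT X -> X.2 <= T / 2 ->
  c <= rho_ 0 X ^- 2 /\ c <= rho_ 2 X ^- 2.
Proof.
have [c0 [c1 [c00 cc]]] := chi_bounds.
have T2 : 0 < T / 2 by rewrite divr_gt0.
have c10 : 0 < c1.
  have [x Ox] : Omega !=set0 by case: hOmega.
  by have /andP[h1 h2] := cc x Ox; apply: lt_le_trans (le_trans h1 h2).
pose M := expR (c1 / (T / 2)).
have M0 : 0 < M by exact: expR_gt0.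
pose k := Num.min (T ^+ 3)^-1 (T / 2).
have k0 : 0 < k by rewrite lt_min T2 invr_gt0 exprn_gt0.
exists (k / M ^+ 2); first by rewrite divr_gt0// exprn_gt0.
move=> X QX Xt; have [s0 sT] := QT_time QX.
have sT2 : T / 2 <= T - X.2 by lra.
have r0 := rho_gt0 X.
have rM : rho X <= M.
  have /cc/andP[_ h] : Omega X.1 by case: QX.
  rewrite /Defs.rho ler_expR; apply: ler_pM => //.
  - have /cc/andP[h' _] : Omega X.1 by case: QX.
    by apply: le_trans h'; exact: ltW.
  - by rewrite invr_ge0 ltW.
  - by rewrite lef_pV2 ?posrE.
have rV : M ^- 2 <= rho X ^- 2.
  by rewrite lef_pV2 ?posrE ?exprn_gt0// lerXn2r ?nnegrE// ltW.
have MV : 0 <= M ^- 2 by rewrite invr_ge0 exprn_ge0// ltW.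
have mm (x y : R) : 0 <= x -> 0 <= y -> k <= x -> M ^- 2 <= y -> k / M ^+ 2 <= x * y.
  by move=> *; apply: ler_pM => //; exact: ltW.
have rV0 : 0 <= rho X ^- 2 by rewrite invr_ge0 exprn_ge0// ltW.
rewrite rho0_sqr// rho2_sqr// (invfM (_ ^+ 3)) (invfM _^-1) invrK.
split; apply: mm => //.
- by rewrite invr_ge0 exprn_ge0// ltW.
- rewrite ge_min; apply/orP; left.
  by rewrite lef_pV2 ?posrE ?exprn_gt0// lerXn2r// nnegrE ltW.
- exact: ltW.
- by rewrite ge_min sT2 orbT.
Qed.

End Weights.

Section Weights_continuous.
Context (R : realType).
Local Notation R2m := (measurableTypeR R * measurableTypeR R)%type.
Local Notation R3m := (measurableTypeR R * measurableTypeR R * measurableTypeR R)%type.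
Variables (Omega omega : set (R * R)) (T : R) (chi0 : R * R -> R) (K1 K2 : R).
Hypotheses (hOmega : bounded_domain Omega) (hT : 0 < T).
Hypotheses (hchi0 : admissible_chi0 Omega omega chi0) (hK1 : 0 < K1).
Hypothesis hK2_large : forall x, closure Omega x -> chi0 x < K2.
Local Notation QT := (cylinder Omega T).
Local Notation rho := (rho T chi0 K1 K2).
Local Notation rho_ := (rho_ T chi0 K1 K2).
Local Notation chi := (chi chi0 K1 K2).

Let cchi0 : {within closure Omega, continuous chi0}.
Proof. by case: hchi0 => -[]. Qed.

Lemma continuous_time : continuous (fun X : R * R * R => T - X.2).
Proof. by move=> X; apply: cvgB; [exact: cvg_cst|exact: cvg_snd]. Qed.

Lemma rho_continuous : {in QT, continuous rho}.
Proof.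
move=> X /set_mem QX; have [T0 _] := QT_time QX.
apply: (@continuous_comp _ _ _ (fun X => chi X.1 / (T - X.2)) expR); last exact: continuous_expR.
apply: cvgM; last by apply: cvgV; [rewrite gt_eqF|exact: continuous_time].
apply: cvgM; first exact: cvg_cst.
apply: cvgB; first exact: cvg_cst.
apply: (@continuous_comp _ _ _ (fun X : R * R * R => chi0 X.1) expR); last exact: continuous_expR.
apply: (@continuous_comp _ _ _ fst chi0); first exact: cvg_fst.
apply: (within_closure_continuous (Omega_open hOmega) cchi0).
by rewrite inE; case: QX.
Qed.

Lemma rho_i_continuous i : {in QT, continuous (rho_ i)}.
Proof.
apply: (@eq_on_open_continuous _ _ QT _ (fun X => expR ((3 / 2 - i%:R) * ln (T - X.2)) * rho X)).
- exact: QT_open.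
- move=> X /set_mem QX; have [T0 _] := QT_time QX.
  by rewrite /Defs.rho_ /powR gt_eqF.
move=> X XQ; have [T0 _] := QT_time (set_mem XQ).
apply: cvgM; last exact: rho_continuous.
apply: (@continuous_comp _ _ _ (fun X : R * R * R => (3 / 2 - i%:R) * ln (T - X.2)) expR);
  last exact: continuous_expR.
apply: cvgM; first exact: cvg_cst.
exact: (cvg_comp _ _ (@continuous_time X) (continuous_ln T0)).
Qed.

Lemma rhoV_continuous : {in QT, continuous (fun X => (rho X)^-1)}.
Proof.
by move=> X XQ; apply: cvgV; [rewrite gt_eqF// rho_gt0|exact: rho_continuous].
Qed.

Lemma rho0V_continuous : {in QT, continuous (fun X => (rho_ 0 X)^-1)}.
Proof.
move=> X XQ; apply: cvgV; last exact: rho_i_continuous.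
by rewrite gt_eqF//; apply: rho_i_gt0; exact: (set_mem XQ).
Qed.

Lemma rhoV_ae_bounded : ae_bounded_on QT (fun X => (rho X)^-1).
Proof.
split; first exact: continuous_measurable3 (QT_open hOmega) rhoV_continuous.
exists 1; apply: aeW => X QX.
exact: (rhoV_le1 hOmega hchi0 hK1 hK2_large QX).
Qed.

Lemma rho0V_ae_bounded : ae_bounded_on QT (fun X => (rho_ 0 X)^-1).
Proof.
split; first exact: continuous_measurable3 (QT_open hOmega) rho0V_continuous.
have [M MP] := @rho0V_bounded R Omega omega T chi0 K1 K2 hOmega hchi0 hK1 hK2_large.
by exists M; apply: aeW.
Qed.

End Weights_continuous.

(** * The space P0 *)

Section P0.
Context (R : realType).
Local Notation R2m := (measurableTypeR R * measurableTypeR R)%type.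
Local Notation R3m := (measurableTypeR R * measurableTypeR R * measurableTypeR R)%type.
Variables (Omega : set (R * R)) (T : R) (G : R * R * R -> R).
Hypotheses (hOmega : bounded_domain Omega) (hT : 0 < T).
Hypothesis hG : Linfty leb3 (cylinder Omega T) G.
Local Notation QT := (cylinder Omega T).
Local Notation P0 := (P0 Omega T).
Implicit Types u : R * R * R -> R.

Lemma P0_C2_in u : P0 u -> C2_in QT u.
Proof. by move=> [c2 _]; apply: C2_closure_in c2; exact: QT_open. Qed.

Lemma G_ae_bounded : ae_bounded_on QT G. Proof. exact: hG. Qed.

Lemma P0_ae_bounded u : P0 u -> ae_bounded_on QT u.
Proof.
by move=> [[cu _ _] _]; apply: (extension_bounded hOmega); exists u; split.
Qed.

Lemma P0_derive_ae_bounded u v : P0 u -> v \in basis3 R -> ae_bounded_on QT ('D_v u).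
Proof.
move=> [[_ du _] _] vB; apply: (extension_bounded hOmega).
by have [_] := du _ vB.
Qed.

Lemma P0_Lstar0_ae_bounded u : P0 u -> ae_bounded_on QT (Lstar0 G u).
Proof.
move=> Pu; have [[_ du ddu] _] := Pu.
have bdd v v' : v \in basis3 R -> v' \in basis3 R -> ae_bounded_on QT ('D_v' ('D_v u)).
  by move=> vB v'B; apply: (extension_bounded hOmega); have [_] := ddu _ _ vB v'B.
have bN f : ae_bounded_on QT f -> ae_bounded_on QT (\- f).
  move=> [mf [M Mf]]; split; first exact: measurableT_comp.
  by exists M; move: Mf; apply: filterS => X h QX; rewrite normrN; exact: h.
rewrite (_ : Lstar0 G u = ((\- 'D_(dt R) u) \+ (\- ('D_(dx1 R) ('D_(dx1 R) u) \+
  'D_(dx2 R) ('D_(dx2 R) u)))) \+ (G \* u)); last by apply/funext.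
have tb := dt_basis R; have b1 := dx1_basis R; have b2 := dx2_basis R.
apply: ae_boundedD; last by apply: ae_boundedM; [exact: G_ae_bounded|exact: P0_ae_bounded].
apply: ae_boundedD; apply: bN; first by have [_] := du _ tb; exact: (extension_bounded hOmega).
by apply: ae_boundedD; exact: bdd.
Qed.

Lemma P0_0 : P0 (cst 0).
Proof.
have D0 v : 'D_v (cst 0 : R * R * R -> R) = cst 0.
  by apply/funext => X; rewrite derive_cst.
have cc (U : set (R * R * R)) : {within U, continuous (cst 0 : R * R * R -> R)}.
  by apply: continuous_subspaceT; exact: cst_continuous.
split => //; split => //.
- move=> v _; split; first by move=> X _; exact: derivable_cst.
  by exists (cst 0); split => // X _; rewrite /= derive_cst.
- move=> v w _ _; rewrite D0; split; first by move=> X _; exact: derivable_cst.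
  by exists (cst 0); split => // X _; rewrite /= derive_cst.
Qed.

Let dDZ (t : R) u (v : R * R * R -> R) X w : derivable u X w -> derivable v X w ->
  derivable (u \+ (t \*: v)) X w /\ 'D_w (u \+ (t \*: v)) X = 'D_w u X + t * 'D_w v X.
Proof.
move=> du dv; have dtv : derivable (t \*: v) X w by exact: derivableZ.
by split; [exact: derivableD|rewrite deriveD// deriveZ].
Qed.

(** Additivity of second derivatives needs additivity of the first ones on the whole
    open set, where they are differentiated again. *)
Lemma P0_combine_der2 (t : R) u v : P0 u -> P0 v -> forall w w',
  w \in basis3 R -> w' \in basis3 R -> forall X, QT X ->
  derivable ('D_w (u \+ (t \*: v))) X w' /\
  'D_w' ('D_w (u \+ (t \*: v))) X = 'D_w' ('D_w u) X + t * 'D_w' ('D_w v) X.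
Proof.
move=> Pu Pv w w' wB w'B X QX.
have [_ du _ ddu _] := P0_C2_in Pu; have [_ dv _ ddv _] := P0_C2_in Pv.
have E : {in QT, 'D_w (u \+ (t \*: v)) =1 'D_w u \+ (t \*: 'D_w v)}.
  by move=> Y YQ; have [_ ->] := dDZ t (du w wB Y YQ) (dv w wB Y YQ).
have [d1 e1] := dDZ t (ddu _ _ wB w'B X (mem_set QX)) (ddv _ _ wB w'B X (mem_set QX)).
by have [d2 ->] := derive_eq_on_open (QT_open hOmega) QX E d1.
Qed.

Lemma P0_DZ (t : R) u v : P0 u -> P0 v -> P0 (u \+ (t \*: v)).
Proof.
move=> Pu Pv; have [[cu du ddu] u0] := Pu; have [[cv dv ddv] v0] := Pv.
have cDZ (f g : R * R * R -> R) : {within closure QT, continuous f} ->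
    {within closure QT, continuous g} -> {within closure QT, continuous (f \+ (t \*: g))}.
  by move=> cf cg X; apply: cvgD; [exact: cf|apply: cvgM; [exact: cvg_cst|exact: cg]].
split; last by move=> X LX /=; rewrite u0// v0// add0r /= [_ *: _]mulr0.
split; first exact: cDZ.
- move=> w wB; have [duw [g [cg gE]]] := du w wB; have [dvw [h [ch hE]]] := dv w wB.
  split; first by move=> X XQ; have [] := dDZ t (duw X XQ) (dvw X XQ).
  exists (g \+ (t \*: h)); split; first exact: cDZ.
  move=> X XQ; have [_ ->] := dDZ t (duw X XQ) (dvw X XQ).
  by rewrite gE// hE.
- move=> w w' wB w'B.
  have [_ [g [cg gE]]] := ddu w w' wB w'B; have [_ [h [ch hE]]] := ddv w w' wB w'B.
  have P2 := P0_combine_der2 t Pu Pv wB w'B.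
  split; first by move=> X /set_mem QX; have [] := P2 X QX.
  exists (g \+ (t \*: h)); split; first exact: cDZ.
  by move=> X XQ; have [_ ->] := P2 X (set_mem XQ); rewrite gE// hE.
Qed.

Let Lstar0_algebra (t g x y a a1 a2 b b1 b2 d d1 d2 : R) :
  d = a + t * b -> d1 = a1 + t * b1 -> d2 = a2 + t * b2 ->
  - d - (d1 + d2) + g * (x + t * y) =
  - a - (a1 + a2) + g * x + t * (- b - (b1 + b2) + g * y).
Proof. by move=> -> -> ->; ring. Qed.

Lemma Lstar0_DZ (t : R) u v : P0 u -> P0 v -> forall X, QT X ->
  Lstar0 G (u \+ (t \*: v)) X = Lstar0 G u X + t * Lstar0 G v X.
Proof.
move=> Pu Pv X QX.
have tb := dt_basis R; have b1 := dx1_basis R; have b2 := dx2_basis R.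
have [_ E1] := P0_combine_der2 t Pu Pv b1 b1 QX.
have [_ E2] := P0_combine_der2 t Pu Pv b2 b2 QX.
have [_ du _ _ _] := P0_C2_in Pu; have [_ dv _ _ _] := P0_C2_in Pv.
have [_ Et] := dDZ t (du _ tb X (mem_set QX)) (dv _ tb X (mem_set QX)).
exact: (Lstar0_algebra (G X) (u X) (v X) Et E1 E2).
Qed.

End P0.

(** * Consequences of the Carleman inequality *)

Section Energy.
Context (R : realType).
Local Notation R2m := (measurableTypeR R * measurableTypeR R)%type.
Local Notation R3m := (measurableTypeR R * measurableTypeR R * measurableTypeR R)%type.
Variables (Omega omega : set (R * R)) (T : R) (chi0 : R * R -> R) (K1 K2 C0 : R).
Variable G : R * R * R -> R.
Hypotheses (hOmega : bounded_domain Omega) (omega_open : open omega) (hT : 0 < T).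
Hypotheses (hchi0 : admissible_chi0 Omega omega chi0) (hK1 : 0 < K1).
Hypothesis hK2_large : forall x, closure Omega x -> chi0 x < K2.
Hypothesis hG : Linfty leb3 (cylinder Omega T) G.
Hypotheses (hC0 : 0 < C0) (hcarleman : carleman Omega omega T chi0 K1 K2 G C0).
Local Notation QT := (cylinder Omega T).
Local Notation P0 := (P0 Omega T).
Local Notation rho := (rho T chi0 K1 K2).
Local Notation rho_ := (rho_ T chi0 K1 K2).
Local Notation ipQ := (ip leb3 (QT : set R3m)).
Local Notation sqQ := (sqint leb3 (QT : set R3m)).
Local Notation kform_of := (kform_of Omega omega T chi0 K1 K2).
Implicit Types u : R * R * R -> R.

Definition inv_rho0 (X : R * R * R) : R := (rho_ 0 X)^-1.
Definition inv_rho (X : R * R * R) : R := (rho X)^-1.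
Definition ind_omega (X : R * R * R) : R := \1_omega X.1.

Let mQT : measurable (QT : set R3m). Proof. exact: measurable_QT. Qed.

Lemma ind01 X : 0 <= ind_omega X <= 1.
Proof. by rewrite /ind_omega indicE; case: (_ \in _) => /=; rewrite lexx ler01. Qed.

Lemma ind_sqr X : ind_omega X * ind_omega X = ind_omega X.
Proof. by rewrite /ind_omega indicE; case: (_ \in _); rewrite /= ?mulr1 ?mulr0. Qed.

Lemma measurable_ind : measurable_fun (QT : set R3m) ind_omega.
Proof.
apply: measurable_funTS.
apply: (@measurableT_comp _ _ _ _ _ _ (\1_omega : R2m -> R) _ (fst : R3m -> R2m)).
  by apply: measurable_indic; exact: open_measurable2.
exact: measurable_fst.
Qed.

Lemma sqint_ind f : sqQ f -> sqQ (ind_omega \* f).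
Proof.
move=> sf; apply: (sqint_le mQT _ _ sf).
  by apply: measurable_funM; [exact: measurable_ind|case: sf].
move=> X _ /=; have /andP[i0 i1] := ind01 X.
by rewrite normrM ger0_norm// ler_piMl.
Qed.

Lemma P0_sqint0 u : P0 u -> sqQ (inv_rho0 \* u).
Proof.
move=> Pu; apply: (QT_sqint hOmega); apply: ae_boundedM.
  exact: (rho0V_ae_bounded T hOmega hchi0 hK1 hK2_large).
exact: P0_ae_bounded.
Qed.

Lemma P0_sqint1 u : P0 u -> sqQ (inv_rho \* Lstar0 G u).
Proof.
move=> Pu; apply: (QT_sqint hOmega); apply: ae_boundedM.
  exact: (rhoV_ae_bounded T hOmega hchi0 hK1 hK2_large).
exact: P0_Lstar0_ae_bounded.
Qed.

(** Splitting the integral that defines k is legitimate only when both terms are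
    integrable, which is what the four hypotheses ensure. *)
Lemma kform_ofE (L : (R * R * R -> R) -> R * R * R -> R) p p' :
  sqQ (inv_rho \* L p) -> sqQ (inv_rho \* L p') -> sqQ (inv_rho0 \* p) -> sqQ (inv_rho0 \* p') ->
  kform_of L p p' =
  ipQ (inv_rho \* L p) (inv_rho \* L p') + ipQ (ind_omega \* (inv_rho0 \* p)) (inv_rho0 \* p').
Proof.
move=> s1 s1' s0 s0'; rewrite /ip -RintegralD//.
- apply: eq_Rintegral => X _ /=; rewrite /inv_rho /inv_rho0 -/(ind_omega X) -!exprVn.
  by move: (rho X)^-1 (rho_ 0 X)^-1 (ind_omega X) (L p X) (L p' X) => *; ring.
- exact: integrable_mul.
- by apply: integrable_mul => //; exact: sqint_ind.
Qed.

(** On P0 the extended-real right-hand side of the Carleman inequality is finite and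
    equals the real-valued k u u, because all weighted functions are bounded. *)
Lemma carleman_rhsE u : P0 u ->
  (\int[leb3]_(X in QT) (rho X ^- 2 * Lstar0 G u X ^+ 2
      + rho_ 0 X ^- 2 * u X ^+ 2 * \1_omega X.1)%:E)%E = (kform_of (Lstar0 G) u u)%:E.
Proof.
move=> Pu; have s1 := P0_sqint1 Pu; have s0 := P0_sqint0 Pu.
rewrite kform_ofE// EFinD -!ip_fin//; last exact: sqint_ind.
rewrite -integralD//.
- apply: eq_integral => X _ /=; rewrite -EFinD; congr EFin.
  rewrite /inv_rho /inv_rho0 -/(ind_omega X) -!exprVn.
  by move: (rho X)^-1 (rho_ 0 X)^-1 (ind_omega X) (Lstar0 G u X) => *; ring.
- exact: (integrable_mul mQT s1 s1).
- exact: (integrable_mul mQT (sqint_ind s0) s0).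
Qed.

Definition carleman_density u (X : R * R * R) : R :=
  rho_ 2 X ^- 2 * ('D_(dt R) u X ^+ 2 + laplacian u X ^+ 2)
   + rho_ 1 X ^- 2 * ('D_(dx1 R) u X ^+ 2 + 'D_(dx2 R) u X ^+ 2)
   + rho_ 0 X ^- 2 * u X ^+ 2.

Lemma carleman_k u : P0 u ->
  (\int[leb3]_(X in QT) (carleman_density u X)%:E <= (C0 * kform_of (Lstar0 G) u u)%:E)%E.
Proof. by move=> Pu; rewrite EFinM -carleman_rhsE//; exact: hcarleman. Qed.

Let density_algebra (a b c d x r2 r1 r0 : R) :
  r2 ^- 2 * d ^+ 2 + r0 ^- 2 * x ^+ 2 <=
  r2 ^- 2 * (d ^+ 2 + a ^+ 2) + r1 ^- 2 * (b ^+ 2 + c ^+ 2) + r0 ^- 2 * x ^+ 2.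
Proof.
rewrite lerD2r mulrDr -addrA lerDl addr_ge0// mulr_ge0 ?invr_ge0 ?sqr_ge0//.
by rewrite addr_ge0 ?sqr_ge0.
Qed.

Lemma carleman_density_ge u X :
  rho_ 2 X ^- 2 * 'D_(dt R) u X ^+ 2 + rho_ 0 X ^- 2 * u X ^+ 2 <= carleman_density u X.
Proof.
exact: density_algebra.
Qed.

Lemma carleman_density_ge0 u X : 0 <= carleman_density u X.
Proof.
apply: le_trans (carleman_density_ge u X).
by apply: addr_ge0; apply: mulr_ge0; rewrite ?invr_ge0 sqr_ge0.
Qed.

Lemma measurable_carleman_density u : P0 u ->
  measurable_fun (QT : set R3m) (carleman_density u).
Proof.
move=> Pu; have [[_ _ ddu] _] := Pu.
have mr i : measurable_fun (QT : set R3m) (fun X => rho_ i X ^- 2).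
  apply: (continuous_measurable3 (QT_open hOmega)) => X XQ.
  have r0 : 0 < rho_ i X by apply: (@rho_i_gt0 R Omega); exact: (set_mem XQ).
  apply: cvgV; first by rewrite gt_eqF// exprn_gt0.
  have cr := @rho_i_continuous R Omega omega T chi0 K1 K2 hOmega hchi0 i X XQ.
  by rewrite expr2; apply: cvgM; exact: cr.
have md (v : R * R * R) : v \in basis3 R -> measurable_fun (QT : set R3m) ('D_v u).
  by move=> vB; have [] := P0_derive_ae_bounded hOmega Pu vB.
have mdd (v : R * R * R) : v \in basis3 R -> measurable_fun (QT : set R3m) ('D_v ('D_v u)).
  move=> vB; apply: (continuous_measurable3 (QT_open hOmega)).
  by have [_ _ _ _] := P0_C2_in hOmega Pu; apply.
have mu' : measurable_fun (QT : set R3m) u by case: (P0_ae_bounded hOmega Pu).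
have tb := dt_basis R; have b1 := dx1_basis R; have b2 := dx2_basis R.
have mM (f g : R3m -> R) : measurable_fun (QT : set R3m) f -> measurable_fun (QT : set R3m) g ->
  measurable_fun (QT : set R3m) (fun X => f X * g X) by move=> *; exact: measurable_funM.
have mD (f g : R3m -> R) : measurable_fun (QT : set R3m) f -> measurable_fun (QT : set R3m) g ->
  measurable_fun (QT : set R3m) (fun X => f X + g X) by move=> *; exact: measurable_funD.
have mX (f : R3m -> R) : measurable_fun (QT : set R3m) f ->
  measurable_fun (QT : set R3m) (fun X => f X ^+ 2) by move=> *; exact: measurable_funX.
apply: (mD _ _ (mD _ _ (mM _ _ (mr 2%N) (mD _ _ (mX _ (md _ tb)) (mX _ _)))
  (mM _ _ (mr 1%N) (mD _ _ (mX _ (md _ b1)) (mX _ (md _ b2))))) (mM _ _ (mr 0%N) (mX _ mu'))).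
exact: mD (mdd _ b1) (mdd _ b2).
Qed.

Lemma carleman_L2 u : P0 u ->
  ipQ (inv_rho0 \* u) (inv_rho0 \* u) <= C0 * kform_of (Lstar0 G) u u.
Proof.
move=> Pu; have s0 := P0_sqint0 Pu.
rewrite -lee_fin -ip_fin//; apply: le_trans (carleman_k Pu).
apply: ge0_le_integral => //.
- by move=> X _; rewrite lee_fin -expr2 sqr_ge0.
- by apply/measurable_EFinP; apply: measurable_funM; case: s0.
- by apply/measurable_EFinP; exact: measurable_carleman_density.
move=> X _; rewrite lee_fin; apply: le_trans (carleman_density_ge u X).
rewrite /= /inv_rho0 -expr2 exprMn exprVn lerDr.
by apply: mulr_ge0; rewrite ?invr_ge0 sqr_ge0.
Qed.

End Energy.

(** * The initial trace *)

Section Tonelli.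
Context d1 d2 (T1 : measurableType d1) (T2 : measurableType d2) (R : realType).
Variables (m1 : {measure set T1 -> \bar R})
  (m2 : {sigma_finite_measure set T2 -> \bar R}).
Hypothesis sm1 : sigma_finite setT m1.
Variables (A : set T1) (B : set T2) (f : T1 * T2 -> \bar R).
Hypotheses (mA : measurable A) (mB : measurable B).
Hypothesis mf : measurable_fun (A `*` B) f.
Hypothesis f0 : forall z, (A `*` B) z -> (0 <= f z)%E.

Lemma integral_setX_tonelli :
  (\int[(m1 \x m2)%E]_(z in A `*` B) f z = \int[m1]_(x in A) \int[m2]_(y in B) f (x, y))%E.
Proof.
rewrite [LHS]integral_mkcond.
rewrite [LHS](@fubini_tonelli1 _ _ _ _ _ (sfin_copy sm1) m2); last 2 first.
- exact: (measurable_restrictT f (measurableX mA mB)).1 mf.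
- by move=> z; rewrite patchE; case: ifP => // /set_mem /f0.
rewrite [RHS]integral_mkcond; apply: eq_integral => x _.
rewrite /fubini_F patchE; case: ifP => [/set_mem Ax|nAx].
  rewrite [RHS]integral_mkcond; apply: eq_integral => y _; rewrite !patchE.
  congr (if _ then _ else _).
  by apply/idP/idP => /set_mem; [case=> _ h|move=> h]; apply/mem_set.
apply: integral0_eq => y _; rewrite patchE; case: ifP => // /set_mem[] /= Ax _.
by move/negP: nAx; case; exact/mem_set.
Qed.

Lemma measurable_inner_integral :
  measurable_fun A (fun x => \int[m2]_(y in B) f (x, y))%E.
Proof.
have mfp : measurable_fun setT (f \_ (A `*` B)).
  exact: (measurable_restrictT f (measurableX mA mB)).1 mf.
have fp0 z : (0 <= (f \_ (A `*` B)) z)%E.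
  by rewrite patchE; case: ifP => // /set_mem /f0.
have := @measurable_fun_fubini_tonelli_F _ _ _ _ _ m2 _ mfp fp0.
move=> /(measurable_funS measurableT (@subsetT _ A)); apply: eq_measurable_fun => x /set_mem Ax.
rewrite /fubini_F [RHS]integral_mkcond; apply: eq_integral => y _; rewrite !patchE.
congr (if _ then _ else _).
by apply/idP/idP => /set_mem; [case=> _ h|move=> h]; apply/mem_set.
Qed.

End Tonelli.

Section Within.
Lemma within_continuous_comp (A B C : topologicalType) (D : set A) (E : set B)
    (j : A -> B) (f : B -> C) : continuous j -> (forall x, D x -> E (j x)) ->
  {within E, continuous f} -> {within D, continuous (f \o j)}.
Proof.
move=> cj DE /subspace_continuousP cf; apply/subspace_continuousP => x Dx.
apply: (cvg_comp _ _ _ (cf _ (DE _ Dx))) => P /=.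
rewrite /within/= => EP.
have := cj x _ EP; rewrite /nbhs/=; apply: filterS => y /= h Dy; apply: h; exact: DE.
Qed.
End Within.

Section Trace.
Context (R : realType).
Local Notation mu := (@lebesgue_measure R).
Local Notation R2m := (measurableTypeR R * measurableTypeR R)%type.
Local Notation R3m := (measurableTypeR R * measurableTypeR R * measurableTypeR R)%type.

Let trace_algebra (k e w g : R) : 0 <= k -> 0 <= e <= 1 ->
  k * w ^+ 2 - 2 * e * w * g <= (k + 1) * (w ^+ 2 + g ^+ 2).
Proof.
move=> k0 /andP[e0 e1].
have h : - (2 * e * w * g) <= w ^+ 2 + g ^+ 2.
  have := sqr_ge0 (e * w + g).
  have : (e * w) ^+ 2 <= w ^+ 2.
    by rewrite exprMn ler_piMl ?sqr_ge0// expr_le1.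
  nra.
have := mulr_ge0 k0 (sqr_ge0 g); nra.
Qed.

(** With the affine cut-off eta, equal to 1 at 0 and to 0 at S, w(0) ^ 2 is minus the
    integral of the derivative of eta w ^ 2, and Young's inequality bounds this
    derivative. *)
Lemma initial_value_bound (w g : R -> R) (S : R) : 0 < S ->
  {within `[0, S], continuous w} -> {within `[0, S], continuous g} ->
  (forall s, s \in `]0, S[ -> is_derive s 1 w (g s)) ->
  (((w 0) ^+ 2)%:E <= \int[mu]_(t in `[(0:R)%R, S]) ((S^-1 + 1) * (w t ^+ 2 + g t ^+ 2))%:E)%E.
Proof.
move=> S0 cw cg dw.
pose eta s : R := 1 - S^-1 * s.
have deta (s : R) : is_derive s 1 eta (- S^-1).
  rewrite /eta; apply: trigger_derive.
  by rewrite /GRing.scale/=; ring.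
have ceta : {within `[0, S], continuous eta}.
  apply: continuous_subspaceT => s.
  by apply: cvgB; [exact: cvg_cst|apply: cvgM; [exact: cvg_cst|exact: cvg_id]].
pose F s := eta s * (w s * w s).
pose f s := - S^-1 * (w s * w s) + eta s * (2 * w s * g s).
have cF : {within `[0, S], continuous F}.
  by move=> s; apply: cvgM; [exact: ceta|apply: cvgM; exact: cw].
have cf : {within `[0, S], continuous f}.
  move=> s; apply: cvgD; apply: cvgM; [exact: cvg_cst|by apply: cvgM; exact: cw|exact: ceta|].
  by apply: cvgM; [apply: cvgM; [exact: cvg_cst|exact: cw]|exact: cg].
have dF s : s \in `]0, S[ -> is_derive s 1 F (f s).
  move=> sI; have D1 := dw s sI.
  have D3 := is_deriveM (deta s) (is_deriveM D1 D1).
  apply: trigger_derive D3 _; rewrite /f /GRing.scale/= (_ : (w * w) s = w s * w s)//; ring.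
have E : (\int[mu]_(t in `[(0:R)%R, S]) (f t)%:E = (F S)%:E - (F 0)%:E)%E.
  apply: (continuous_FTC2 S0 cf).
    have /(continuous_within_itvP _ S0)[_ cF0 cFS] := cF.
    by split => // s /dF h; exact: ex_derive.
  by move=> s /dF h; rewrite derive1E derive_val.
have FS : F S = 0 by rewrite /F /eta mulVf ?gt_eqF// subrr mul0r.
have F0 : F 0 = w 0 ^+ 2 by rewrite /F /eta mulr0 subr0 mul1r expr2.
have cI (h : R -> R) : {within `[0, S], continuous h} -> mu.-integrable `[0, S] (EFin \o h).
  by move=> ch; apply: continuous_compact_integrable => //; exact: segment_compact.
have E' : (\int[mu]_(t in `[(0:R)%R, S]) (- f t)%:E = (w 0 ^+ 2)%:E)%E.
  transitivity ((-1)%:E * \int[mu]_(t in `[(0:R)%R, S]) (f t)%:E)%E.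
    rewrite -integralZl//; last exact: cI.
    by apply: eq_integral => t _; rewrite -EFinM mulN1r.
  by rewrite E FS F0 -EFinB -EFinM; congr EFin; ring.
rewrite -E'; apply: le_integral => //.
- by apply: cI => s; apply: cvgN; exact: cf.
- apply: cI => s; apply: cvgM; first exact: cvg_cst.
  by apply: cvgD; rewrite expr2; apply: cvgM; (exact: cw || exact: cg).
move=> t; rewrite inE/= in_itv/= => /andP[t0 tS]; rewrite lee_fin.
have e01 : 0 <= eta t <= 1.
  rewrite /eta subr_ge0 mulrC ler_pdivrMr// mul1r tS/= gerBl divr_ge0// ltW//.
apply: le_trans (trace_algebra (w t) (g t) _ e01); last by rewrite invr_ge0 ltW.
by rewrite /f le_eqVlt; apply/orP; left; apply/eqP; rewrite expr2; ring.
Qed.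

End Trace.

Section Trace_bound.
Context (R : realType).
Local Notation mu := (@lebesgue_measure R).
Local Notation R2m := (measurableTypeR R * measurableTypeR R)%type.
Local Notation R3m := (measurableTypeR R * measurableTypeR R * measurableTypeR R)%type.
Variables (Omega omega : set (R * R)) (T : R) (chi0 : R * R -> R) (K1 K2 C0 : R).
Variable G : R * R * R -> R.
Hypotheses (hOmega : bounded_domain Omega) (omega_open : open omega) (hT : 0 < T).
Hypotheses (hchi0 : admissible_chi0 Omega omega chi0) (hK1 : 0 < K1).
Hypothesis hK2_large : forall x, closure Omega x -> chi0 x < K2.
Hypothesis hG : Linfty leb3 (cylinder Omega T) G.
Hypotheses (hC0 : 0 < C0) (hcarleman : carleman Omega omega T chi0 K1 K2 G C0).
Local Notation QT := (cylinder Omega T).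
Local Notation P0 := (P0 Omega T).
Local Notation rho := (rho T chi0 K1 K2).
Local Notation rho_ := (rho_ T chi0 K1 K2).
Local Notation kform_of := (kform_of Omega omega T chi0 K1 K2).
Local Notation ipO := (ip leb2 (Omega : set R2m)).
Local Notation sqO := (sqint leb2 (Omega : set R2m)).
Implicit Types u : R * R * R -> R.

Let S := T / 2.
Let S0 : 0 < S. Proof. by rewrite /S divr_gt0. Qed.
Let ST : S < T. Proof. by rewrite /S ltr_pdivrMr// ltr_pMr// ltr1n. Qed.

(** The initial slice lies on the boundary of QT; points (x, d) with small d > 0
    approach (x, 0).  This is what lets u be followed down to t = 0. *)
Lemma early_closure x s : Omega x -> s \in `[0, S] -> closure QT (x, s).
Proof.
move=> Ox; rewrite in_itv/= => /andP[s0 sS].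
have [->|sn0] := eqVneq s 0; last first.
  apply: subset_closure; split => //=; rewrite in_itv/= lt_neqAle eq_sym sn0 s0/=.
  exact: le_lt_trans ST.
move=> B /nbhs_ballP[e /= e0 eB].
pose d := Num.min S (e / 2).
have d0 : 0 < d by rewrite lt_min S0 divr_gt0.
exists (x, d); split.
  split => //=; rewrite in_itv/= d0/=; apply: le_lt_trans ST.
  by rewrite ge_min lexx.
apply: eB; split => /=; first exact: ballxx.
rewrite /ball/= sub0r normrN gtr0_norm//; apply: (@le_lt_trans _ _ (e / 2)).
  by rewrite ge_min lexx orbT.
by rewrite ltr_pdivrMr// ltr_pMr// ltr1n.
Qed.

Lemma trace_continuous u : P0 u -> {within closure Omega, continuous (fun x => u (x, 0))}.
Proof.
move=> [[cu _ _] _].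
apply: (within_continuous_comp (j := fun x : R * R => (x, 0 : R)) _ _ cu).
  by move=> z; apply: (cvg_pair (@cvg_id _ (nbhs z)) (cvg_cst (0 : R))); exact: filter_filter.
move=> x clx B [[B1 B2] [/= B1x B20] BB].
have [y [Oy B1y]] := clx _ B1x.
have /(early_closure Oy) : (0 : R) \in `[0, S] by rewrite in_itv/= lexx ltW.
have n : nbhs (y, 0 : R) (setT `*` B2).
  by exists (setT, B2) => //; split => //; exact: filterT.
move=> /(_ _ n)[[y' t] [[/= Oy' ty'] [_ B2t]]].
exists (y, t); split; first by split.
by apply: BB.
Qed.

Lemma trace_sqint u : P0 u -> sqO (fun x => u (x, 0)).
Proof.
move=> Pu; have cu := trace_continuous Pu.
have oO := Omega_open hOmega.
have mu0 : measurable_fun (Omega : set R2m) (fun x => u (x, 0)).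
  exact: (continuous_measurable2 oO (within_closure_continuous oO cu)).
have /compact_bounded[M [_ Mb]] : compact ((fun x => u (x, 0)) @` closure Omega).
  by apply: continuous_compact => //; exact: closure_Omega_compact.
apply: (@sqint_ae_bounded _ _ _ _ _ (measurable_Omega hOmega) _ (`|M| + 1)) => //.
  exact: Omega_finite.
apply: aeW => x Ox; apply: (Mb (`|M| + 1)); first by rewrite ltr_pwDr// ler_norm.
by exists x => //; exact: subset_closure.
Qed.

(** u is known to be differentiable only for t > 0, but u and the extension g of u_t are
    continuous down to t = 0, which is enough for the one-dimensional bound. *)
Lemma trace_pointwise u x : P0 u -> Omega x ->
  ((u (x, 0)%R ^+ 2)%:E <= \int[mu]_(t in `](0:R)%R, S[)
     ((S^-1 + 1) * (u (x, t) ^+ 2 + 'D_(dt R) u (x, t) ^+ 2))%:E)%E.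
Proof.
move=> Pu Ox; have [[cu du _] _] := Pu.
have [dtu [g [cg gE]]] := du _ (dt_basis R).
have cj : continuous (fun s : R => (x, s)).
  by move=> z; apply: (cvg_pair (cvg_cst x) (@cvg_id _ (nbhs z))); exact: filter_filter.
have inQ s : s \in `]0, S[ -> QT (x, s).
  rewrite in_itv/= => /andP[s0 sS]; split => //=; rewrite in_itv/= s0/=.
  exact: lt_trans ST.
have cw : {within `[0, S], continuous (fun s => u (x, s))}.
  apply: (within_continuous_comp (j := fun s : R => (x, s)) cj _ cu) => s.
  exact: early_closure.
have cg' : {within `[0, S], continuous (fun s => g (x, s))}.
  apply: (within_continuous_comp (j := fun s : R => (x, s)) cj _ cg) => s.
  exact: early_closure.
have dw (s : R) : s \in `]0, S[ -> is_derive s 1 (fun s => u (x, s)) (g (x, s)).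
  move=> sI; rewrite -gE ?inE; last exact: inQ.
  apply: (@is_derive_line R _ u (fun s => (x, s))).
    by move=> h; case: x {Ox cj inQ cw cg'} => x y; exact: shift_t.
  by apply: dtu; rewrite inE; exact: inQ.
apply: le_trans (initial_value_bound S0 cw cg' dw) _.
rewrite integral_itv_bndoo; last first.
  apply/measurable_EFinP; apply: measurable_funM; first exact: measurable_cst.
  have mI (h : R -> R) : {within `[0, S], continuous h} -> measurable_fun `]0, S[ h.
    move=> ch; apply: subspace_continuous_measurable_fun => //.
    by apply: continuous_subspaceW ch => s /=; exact: subset_itv_oo_cc.
  by apply: measurable_funD; apply: measurable_funX; exact: mI.
rewrite le_eqVlt; apply/orP; left; apply/eqP; apply: eq_integral => s sI.
by rewrite gE// inE; apply: inQ; move: sI; rewrite inE.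
Qed.

(** Integrating the pointwise bound over Omega gives u and u_t over Omega x ]0, T/2[,
    where the weights rho_0^-2 and rho_2^-2 are bounded below, so that the Carleman
    inequality applies. *)
Lemma trace_bound : exists2 C, 0 <= C & forall u, P0 u ->
  ipO (fun x => u (x, 0)) (fun x => u (x, 0)) <= C * kform_of (Lstar0 G) u u.
Proof.
have [c c0 cP] := weights_early_lb (T := T) hOmega hT hchi0 hK1 hK2_large.
have k0 : 0 <= S^-1 + 1 by rewrite addr_ge0// invr_ge0 ltW.
pose k := (S^-1 + 1) / c.
have kk0 : 0 <= k by rewrite divr_ge0// ltW.
exists (k * C0); first by rewrite mulr_ge0// ltW.
move=> u Pu; have su := trace_sqint Pu.
have mO := measurable_Omega hOmega; have mQ := @measurable_QT R Omega T hOmega.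
pose E : set R3m := Omega `*` `]0, S[.
have mE : measurable E by exact: measurableX.
have EQ : E `<=` QT.
  move=> X [OX]; rewrite /= in_itv/= => /andP[X0 XS]; split => //=.
  by rewrite in_itv/= X0; exact: lt_trans ST.
pose phi (X : R3m) := ((S^-1 + 1) * (u X ^+ 2 + 'D_(dt R) u X ^+ 2))%:E : \bar R.
have mphi : measurable_fun E phi.
  apply/measurable_EFinP; apply: measurable_funM; first exact: measurable_cst.
  apply: measurable_funD; apply: measurable_funX.
    by apply: measurable_funS EQ _ => //; have [] := P0_ae_bounded hOmega Pu.
  apply: measurable_funS EQ _ => //.
  by have [] := P0_derive_ae_bounded hOmega Pu (dt_basis R).
have phi0 X : (0 <= phi X)%E by rewrite lee_fin mulr_ge0// addr_ge0 ?sqr_ge0.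
have mcd := measurable_carleman_density K1 K2 hOmega hchi0 Pu.
rewrite -lee_fin -ip_fin//.
apply: (@le_trans _ _ (\int[leb2]_(x in (Omega : set R2m)) \int[mu]_(t in `](0:R)%R, S[) phi (x, t))%E).
  apply: ge0_le_integral => //.
  - by move=> x _; rewrite lee_fin -expr2 sqr_ge0.
  - by apply/measurable_EFinP; apply: measurable_funM; case: su.
  - by apply: (measurable_inner_integral mu mO _ mphi) => // z _; exact: phi0.
  - by move=> x Ox; rewrite -expr2; exact: trace_pointwise.
rewrite -(@integral_setX_tonelli _ _ R2m (measurableTypeR R) R leb2 mu (leb2_sigma_finite R) _ _ phi)//.
apply: (@le_trans _ _ (\int[leb3]_(X in E) (k%:E * (carleman_density T chi0 K1 K2 u X)%:E))%E).
  apply: ge0_le_integral => //.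
  - by apply: emeasurable_funM => //; apply/measurable_EFinP; exact: measurable_funS mcd.
  - move=> X [OX]; rewrite /= in_itv/= => /andP[X0 XS].
    have QX : QT X by apply: EQ; split => //=; rewrite in_itv/= X0.
    have [c1 c2] := cP X QX (ltW XS).
    rewrite -EFinM lee_fin /k mulrAC -mulrA ler_wpM2l//.
    rewrite ler_pdivlMr//; apply: le_trans (carleman_density_ge _ _ _ _ u X).
    by rewrite mulrC mulrDr addrC; apply: lerD; apply: ler_wpM2r => //; exact: sqr_ge0.
apply: (@le_trans _ _ (\int[leb3]_(X in (QT : set R3m)) (k%:E * (carleman_density T chi0 K1 K2 u X)%:E))%E).
  apply: ge0_subset_integral => //.
  - by apply: emeasurable_funM => //; apply/measurable_EFinP.
  - by move=> X _; rewrite -EFinM lee_fin mulr_ge0// carleman_density_ge0.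
rewrite ge0_integralZl//.
- rewrite -mulrA (EFinM k); apply: lee_wpmul2l; first by rewrite lee_fin.
  exact: (carleman_k hOmega omega_open hchi0 hK1 hK2_large hG hcarleman).
- exact/measurable_EFinP.
- by move=> X _; rewrite lee_fin carleman_density_ge0.
Qed.

End Trace_bound.

(** * Weighted L^2 spaces *)

Section Weighted.
Context d (X : measurableType d) (R : realType).
Variables (mu : {measure set X -> \bar R}) (D : set X) (a : X -> R).
Hypotheses (mD : measurable D) (ma : measurable_fun D a).
Hypothesis maV : measurable_fun D (fun x => (a x)^-1).
Hypothesis a_neq0 : forall x, D x -> a x != 0.
Local Notation ip := (ip mu D).
Local Notation sqint := (sqint mu D).

(** Multiplication by a nowhere vanishing measurable weight identifies the weighted
    space with the plain one; measurability of the inverse recovers that of f. *)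
Lemma wL2P f : wL2 mu D a f <-> sqint (a \* f).
Proof.
have E : (sq_integral mu D a f = \int[mu]_(x in D) (((a \* f) x) ^+ 2)%:E)%E.
  by rewrite /sq_integral; apply: eq_integral => x _; rewrite /= exprMn.
split=> [[mf foo]|[maf foo]].
  by split; [exact: measurable_funM|rewrite -E].
split; last by rewrite E.
apply: (eq_measurable_fun (fun x => (a x)^-1 * (a x * f x))); last exact: measurable_funM.
by move=> x /set_mem Dx; rewrite mulKf// a_neq0.
Qed.

Lemma wL2_cvgP (u : nat -> X -> R) f : (forall n, sqint (a \* u n)) -> sqint (a \* f) ->
  wL2_cvg mu D a u f <->
  ip (a \* u n \- a \* f) (a \* u n \- a \* f) @[n --> \oo] --> 0.
Proof.
move=> su sf.
have E : (fun n => sq_integral mu D a (fun x => u n x - f x)) =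
    EFin \o (fun n => ip (a \* u n \- a \* f) (a \* u n \- a \* f)).
  apply/funext => n /=; rewrite -ip_fin//; [|exact: sqintB..].
  by apply: eq_integral => x _ /=; rewrite -mulrBr -expr2 exprMn.
rewrite /wL2_cvg E; split => h.
  by move/fine_cvg : h.
by apply: cvg_EFin => //; exact: nearW.
Qed.

Lemma weighted_complete (u : nat -> X -> R) : (forall n, sqint (a \* u n)) ->
  (forall e : R, 0 < e -> exists N : nat, forall m n, (N <= m)%N -> (N <= n)%N ->
     ip (a \* u m \- a \* u n) (a \* u m \- a \* u n) < e) ->
  exists f, sqint (a \* f) /\
    ip (a \* u n \- a \* f) (a \* u n \- a \* f) @[n --> \oo] --> 0.
Proof.
move=> su cu; have [g [sg ug]] := sqint_complete mD su cu.
exists (fun x => (a x)^-1 * g x).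
have E x : D x -> a x * ((a x)^-1 * g x) = g x.
  by move=> Dx; rewrite mulVKf// a_neq0.
split; first by apply: (eq_sqint _ sg) => // x Dx /=; rewrite E.
have -> // : (fun n => ip (a \* u n \- a \* (fun x => (a x)^-1 * g x))
    (a \* u n \- a \* (fun x => (a x)^-1 * g x))) =
  (fun n => ip (a \* u n \- g) (a \* u n \- g)).
apply/funext => n; apply: eq_Rintegral => x /set_mem Dx /=.
by rewrite E.
Qed.

Lemma weighted_eq0 f : sqint (a \* f) -> ip (a \* f) (a \* f) = 0 -> ae_eq mu D f (cst 0).
Proof.
move=> sf f0; move: (ip_eq0 mD sf f0); apply: filterS => x + Dx => /(_ Dx) /= /eqP.
by rewrite mulf_eq0 (negbTE (a_neq0 Dx)) => /eqP.
Qed.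

End Weighted.

(** * The completion P and the two problems *)

(** The following scalar identities are stated for plain real numbers so that the
    normalisation never meets derivatives or weights. *)
Lemma cauchy_algebra (R : realType) (e a b x0 y0 x1 y1 : R) :
  a <= 2 * x1 + 2 * y1 -> b <= 2 * x0 + 2 * y0 ->
  x0 < e / 8 -> y0 < e / 8 -> x1 < e / 8 -> y1 < e / 8 -> a + b < e.
Proof. by move=> *; lra. Qed.

Lemma kform_sym_algebra (R : realType) (a b x y z w c : R) :
  a * x * y + b * c * z * w = a * y * x + b * c * w * z.
Proof. by ring. Qed.

Lemma kform_linear_algebra (R : realType) (i e a t b c : R) :
  i * (e * (a + t * b)) * c = (i * (e * a) + t * (i * (e * b))) * c.
Proof. by ring. Qed.

Lemma alpha_algebra (R : realType) (a b z z' p p' i : R) :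
  a ^+ 2 * z * z' + b ^+ 2 * p * p' * i = a * z * (a * z') + i * (b * p) * (b * p').
Proof. by ring. Qed.

Lemma solves_B_algebra (R : realType) (a b c : R) : a + b + (c - a) = c + b.
Proof. by ring. Qed.

Lemma solves_A_unique_algebra (R : realType) (a b c d : R) : a + b = c + d -> a - c + (b - d) = 0.
Proof. by move=> h; lra. Qed.

Lemma lam_algebra (R : realType) (r z l : R) : 0 < r -> r^-1 * z = r * l -> l = r^-1 ^+ 2 * z.
Proof.
by move=> r0 h; rewrite expr2 -mulrA h mulrA mulVf ?mul1r// gt_eqF.
Qed.

Section Completion.
Context (R : realType).
Local Notation R2m := (measurableTypeR R * measurableTypeR R)%type.
Local Notation R3m := (measurableTypeR R * measurableTypeR R * measurableTypeR R)%type.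
Variables (Omega omega : set (R * R)) (T : R) (chi0 : R * R -> R) (K1 K2 C0 : R).
Variable G : R * R * R -> R.
Hypotheses (hOmega : bounded_domain Omega) (omega_open : open omega) (hT : 0 < T).
Hypotheses (hchi0 : admissible_chi0 Omega omega chi0) (hK1 : 0 < K1).
Hypothesis hK2_large : forall x, closure Omega x -> chi0 x < K2.
Hypothesis hG : Linfty leb3 (cylinder Omega T) G.
Hypotheses (hC0 : 0 < C0) (hcarleman : carleman Omega omega T chi0 K1 K2 G C0).
Local Notation QT := (cylinder Omega T).
Local Notation P0 := (P0 Omega T).
Local Notation rho := (rho T chi0 K1 K2).
Local Notation rho_ := (rho_ T chi0 K1 K2).
Local Notation e0 := (inv_rho0 T chi0 K1 K2).
Local Notation e1 := (inv_rho T chi0 K1 K2).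
Local Notation ind := (ind_omega omega).
Local Notation ipQ := (ip leb3 (QT : set R3m)).
Local Notation sqQ := (sqint leb3 (QT : set R3m)).
Local Notation ipO := (ip leb2 (Omega : set R2m)).
Local Notation sqO := (sqint leb2 (Omega : set R2m)).
Local Notation kform_of := (kform_of Omega omega T chi0 K1 K2).
Local Notation L0 := (Lstar0 G).
Local Notation tr0 := (fun (u : R * R * R -> R) (x : R * R) => u (x, 0)).
Implicit Types p q h w : R * R * R -> R.

Let mQT : measurable (QT : set R3m). Proof. exact: measurable_QT. Qed.
Let mO : measurable (Omega : set R2m). Proof. exact: measurable_Omega. Qed.

Lemma inv_rho0_gt0 X : QT X -> 0 < e0 X.
Proof. by move=> QX; rewrite /inv_rho0 invr_gt0; exact: (@rho_i_gt0 R Omega). Qed.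

Lemma inv_rho_gt0 X : 0 < e1 X.
Proof. by rewrite /inv_rho invr_gt0; exact: rho_gt0. Qed.

Let e0_neq0 X : QT X -> e0 X != 0. Proof. by move=> /inv_rho0_gt0 h; rewrite gt_eqF. Qed.
Let e1_neq0 X : QT X -> e1 X != 0. Proof. by move=> _; rewrite gt_eqF// inv_rho_gt0. Qed.

Let cm (f : R * R * R -> R) : {in QT, continuous f} -> measurable_fun (QT : set R3m) f.
Proof. exact: continuous_measurable3 (QT_open hOmega). Qed.

Let me0 : measurable_fun (QT : set R3m) e0.
Proof. by apply: cm; exact: rho0V_continuous hOmega hchi0. Qed.

Let me1 : measurable_fun (QT : set R3m) e1.
Proof. by apply: cm; exact: rhoV_continuous hOmega hchi0. Qed.

Let me0V : measurable_fun (QT : set R3m) (fun X => (e0 X)^-1).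
Proof.
apply: (eq_measurable_fun (rho_ 0)); first by move=> X _; rewrite /inv_rho0 invrK.
by apply: cm; exact: (@rho_i_continuous R Omega omega T chi0 K1 K2 hOmega hchi0 0).
Qed.

Let me1V : measurable_fun (QT : set R3m) (fun X => (e1 X)^-1).
Proof.
apply: (eq_measurable_fun rho); first by move=> X _; rewrite /inv_rho invrK.
by apply: cm; exact: (@rho_continuous R Omega omega T chi0 K1 K2 hOmega hchi0).
Qed.

(** On a compact box inside QT the inverse r of the weight e is bounded, so the
    weighted norm on QT controls the plain norm on the box. *)
Lemma weighted_box (e r : R * R * R -> R) a b : {in QT, continuous r} ->
  (forall X, QT X -> r X * e X = 1) -> box a b `<=` QT ->
  exists M, 0 <= M /\ forall f, sqQ (e \* f) ->
    sqint leb3 (box a b : set R3m) f /\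
    ip leb3 (box a b : set R3m) f f <= M * ipQ (e \* f) (e \* f).
Proof.
move=> cr re BU.
have [M [_ Mb]] := continuous_compact_bounded (@box_compact R a b) BU cr.
pose N := `|M| + 1.
have N0 : 0 <= N by rewrite addr_ge0.
have rN X : box a b X -> `|r X| <= N.
  by move=> BX; apply: (Mb N) => //; rewrite ltr_pwDr// ler_norm.
exists (N ^+ 2); split; first exact: sqr_ge0.
move=> f sf; have mB := measurable_box a b.
have fle X : box a b X -> `|f X| <= `|N * (e X * f X)|.
  move=> BX; rewrite -[leLHS]mul1r -[X in X * _ <= _](normr1 R) -(re X (BU X BX)).
  by rewrite !normrM mulrA ler_wpM2r// ler_wpM2r// (ger0_norm N0) rN.
have mf : measurable_fun (QT : set R3m) f.
  apply: (eq_measurable_fun (fun X => r X * (e X * f X))).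
    by move=> X /set_mem QX; rewrite mulrA re// mul1r.
  by apply: measurable_funM; [exact: cm|case: sf].
have mfB : measurable_fun (box a b : set R3m) f by exact: measurable_funS mf.
have sfB : sqint leb3 (box a b : set R3m) (e \* f).
  case: sf => mef foo; split; first exact: measurable_funS mef.
  apply: le_lt_trans foo; apply: ge0_subset_integral => //.
  - by apply/measurable_EFinP; exact: measurable_funX.
  - by move=> X _; rewrite lee_fin sqr_ge0.
have sf' : sqint leb3 (box a b : set R3m) f.
  by apply: (sqint_le mB mfB fle); exact: (sqintZ mB N sfB).
split=> //.
rewrite -lee_fin -ip_fin// EFinM -ip_fin//.
apply: (@le_trans _ _ (\int[leb3]_(X in (box a b : set R3m)) ((N ^+ 2)%:E * ((e \* f) X * (e \* f) X)%:E))%E).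
  apply: ge0_le_integral => //.
  - by move=> X _; rewrite lee_fin -expr2 sqr_ge0.
  - by apply/measurable_EFinP; exact: measurable_funM.
  - apply: emeasurable_funM => //; apply/measurable_EFinP.
    by apply: measurable_funM; case: sfB.
  - move=> X BX; rewrite -EFinM lee_fin /= -!expr2 -exprMn -(real_normK (num_real (f X))).
    by rewrite -(real_normK (num_real (N * _))) lerXn2r ?nnegrE// fle.
rewrite -ge0_integralZl//; last 3 first.
- by apply/measurable_EFinP; apply: measurable_funM; case: sf.
- by move=> X _; rewrite lee_fin -expr2 sqr_ge0.
- by rewrite lee_fin sqr_ge0.
apply: ge0_subset_integral => //.
- apply: emeasurable_funM => //; apply/measurable_EFinP.
  by apply: measurable_funM; case: sf.
- by move=> X _; rewrite -EFinM lee_fin mulr_ge0 ?sqr_ge0// -expr2 sqr_ge0.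
Qed.

(** Weighted convergence on QT implies plain convergence on every box inside QT, so
    the local closability of L^* applies. *)
Lemma closable_weighted h (w : nat -> R * R * R -> R) : (forall n, P0 (w n)) ->
  sqQ (e1 \* h) ->
  ipQ (e0 \* w n) (e0 \* w n) @[n --> \oo] --> 0 ->
  ipQ (e1 \* L0 (w n) \- e1 \* h) (e1 \* L0 (w n) \- e1 \* h) @[n --> \oo] --> 0 ->
  ae_eq leb3 (QT : set R3m) h (cst 0).
Proof.
move=> Pw sh w0 Lw0.
apply: (Lstar0_closable (w := w) (QT_open hOmega) (G_ae_bounded hG)).
  by move=> n; exact: P0_C2_in.
move=> a b BU.
have r0 X : QT X -> rho_ 0 X * e0 X = 1.
  by move=> QX; rewrite /inv_rho0 divff// gt_eqF//; exact: (@rho_i_gt0 R Omega).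
have r1 X : QT X -> rho X * e1 X = 1.
  by move=> QX; rewrite /inv_rho divff// gt_eqF// rho_gt0.
have [M0 [M00 M0P]] := weighted_box (@rho_i_continuous R Omega omega T chi0 K1 K2 hOmega hchi0 0) r0 BU.
have [M1 [M10 M1P]] := weighted_box (@rho_continuous R Omega omega T chi0 K1 K2 hOmega hchi0) r1 BU.
have sq0 (M : R) (f g : nat -> R) : (forall n, 0 <= f n <= M * g n) -> g n @[n --> \oo] --> 0 ->
    f n @[n --> \oo] --> 0.
  move=> fg g0; apply: (@squeeze_cvgr _ _ _ _ (cst 0) (fun n => M * g n)).
  - exact: nearW.
  - exact: cvg_cst.
  - rewrite -[X in _ --> X](mulr0 M); apply: cvgM => //; exact: cvg_cst.
have s0 n := P0_sqint0 hOmega hchi0 hK1 hK2_large (Pw n).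
have s1 n := P0_sqint1 hOmega hchi0 hK1 hK2_large hG (Pw n).
split; first by have [] := M1P h sh.
  by apply: (sq0 M0) w0 => n; rewrite ip_ge0/=; have [] := M0P _ (s0 n).
apply: (sq0 M1) Lw0 => n; rewrite ip_ge0/=.
have E : e1 \* L0 (w n) \- e1 \* h = e1 \* (L0 (w n) \- h).
  by apply/funext => X /=; rewrite mulrBr.
have sB : sqQ (e1 \* (L0 (w n) \- h)) by rewrite -E; exact: sqintB.
by rewrite E; have [] := M1P _ sB.
Qed.

(** P seen as a closed graph: p belongs to P with L^* p = q and p(., 0) = r when some
    sequence u of P0 converges in all three components. *)
Record graph_cvg (u : nat -> R * R * R -> R) p q (r : R * R -> R) : Prop := {
  gc_P0 : forall n, P0 (u n) ;
  gc_sq0 : sqQ (e0 \* p) ;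
  gc_sq1 : sqQ (e1 \* q) ;
  gc_sqO : sqO r ;
  gc_cvg0 : ipQ (e0 \* u n \- e0 \* p) (e0 \* u n \- e0 \* p) @[n --> \oo] --> 0 ;
  gc_cvg1 : ipQ (e1 \* L0 (u n) \- e1 \* q) (e1 \* L0 (u n) \- e1 \* q) @[n --> \oo] --> 0 ;
  gc_cvgO : ipO (tr0 (u n) \- r) (tr0 (u n) \- r) @[n --> \oo] --> 0 }.

Definition k_cauchy (u : nat -> R * R * R -> R) : Prop :=
  forall e : R, 0 < e -> exists N : nat, forall m n, (N <= m)%N -> (N <= n)%N ->
    kform_of L0 (u m \- u n) (u m \- u n) < e.

Let s0 u : P0 u -> sqQ (e0 \* u).
Proof. exact: (P0_sqint0 hOmega hchi0 hK1 hK2_large). Qed.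
Let s1 u : P0 u -> sqQ (e1 \* L0 u).
Proof. exact: (P0_sqint1 hOmega hchi0 hK1 hK2_large hG). Qed.
Let sO u : P0 u -> sqO (tr0 u).
Proof. exact: (trace_sqint hOmega hT). Qed.

Lemma P0_B u v : P0 u -> P0 v -> P0 (u \- v).
Proof.
move=> Pu Pv; rewrite (_ : u \- v = u \+ ((-1) \*: v)); first exact: P0_DZ.
by apply/funext => X /=; rewrite scaleN1r.
Qed.

Lemma Lstar0_B u v X : P0 u -> P0 v -> QT X -> L0 (u \- v) X = L0 u X - L0 v X.
Proof.
move=> Pu Pv QX; rewrite (_ : u \- v = u \+ ((-1) \*: v)); last first.
  by apply/funext => Y /=; rewrite scaleN1r.
by rewrite (@Lstar0_DZ R Omega T G hOmega (-1) u v Pu Pv X QX) mulN1r.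
Qed.

Lemma kform_P0E u v : P0 u -> P0 v -> kform_of L0 u v =
  ipQ (e1 \* L0 u) (e1 \* L0 v) + ipQ (ind \* (e0 \* u)) (e0 \* v).
Proof.
move=> Pu Pv.
exact: (kform_ofE hOmega omega_open (s1 Pu) (s1 Pv) (s0 Pu) (s0 Pv)).
Qed.

Lemma kform_ge0 L f : 0 <= kform_of L f f.
Proof.
apply: Rintegral_ge0 => X _; have /andP[i0 _] := ind01 omega X.
apply: addr_ge0; rewrite -mulrA -expr2; apply: mulr_ge0; rewrite ?sqr_ge0 ?invr_ge0 ?sqr_ge0//.
by apply: mulr_ge0 => //; rewrite invr_ge0 sqr_ge0.
Qed.

Lemma ip_ind_ge0 f : 0 <= ipQ (ind \* f) f.
Proof.
apply: Rintegral_ge0 => X _ /=; have /andP[i0 _] := ind01 omega X.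
by rewrite -mulrA mulr_ge0// -expr2 sqr_ge0.
Qed.

Lemma ip_ind_le f : sqQ f -> ipQ (ind \* f) f <= ipQ f f.
Proof.
move=> sf; apply: le_Rintegral => //.
- by apply: integrable_mul => //; exact: sqint_ind.
- exact: integrable_mul.
- move=> X _ /=; have /andP[_ i1] := ind01 omega X.
  by rewrite -mulrA ler_piMl// -expr2 sqr_ge0.
Qed.

Lemma ip_ind f g : ipQ (ind \* f) g = ipQ f (ind \* g).
Proof. by apply: eq_Rintegral => X _ /=; rewrite mulrAC mulrC mulrA mulrC. Qed.

Let ip1B u v : P0 u -> P0 v -> ipQ (e1 \* L0 (u \- v)) (e1 \* L0 (u \- v)) =
  ipQ (e1 \* L0 u \- e1 \* L0 v) (e1 \* L0 u \- e1 \* L0 v).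
Proof.
by move=> Pu Pv; apply: eq_Rintegral => X /set_mem QX /=; rewrite Lstar0_B// mulrBr.
Qed.

Let e0B u v : e0 \* (u \- v) = e0 \* u \- e0 \* v.
Proof. by apply/funext => X /=; rewrite mulrBr. Qed.

(** The three norms are bounded by k on P0: the one of p by the Carleman inequality,
    the one of L^* p by definition of k, and the one of the trace by trace_bound. *)
Lemma k_cauchy_graph_cvg u : (forall n, P0 (u n)) -> k_cauchy u ->
  exists p q r, graph_cvg u p q r.
Proof.
move=> Pu cu.
have PB m n := P0_B (Pu m) (Pu n).
have [Ct Ct0 CtP] := trace_bound hOmega omega_open hT hchi0 hK1 hK2_large hG hC0 hcarleman.
have CC (K : R) (F : nat -> nat -> R) : 0 <= K ->
    (forall m n, F m n <= K * kform_of L0 (u m \- u n) (u m \- u n)) ->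
    forall e : R, 0 < e -> exists N : nat, forall m n, (N <= m)%N -> (N <= n)%N -> F m n < e.
  move=> K0 FK e e0; have K1p : 0 < K + 1 by lra.
  have [N HN] := cu (e / (K + 1)) (divr_gt0 e0 K1p).
  exists N => m n Nm Nn; apply: le_lt_trans (FK m n) _.
  have := HN m n Nm Nn; rewrite ltr_pdivlMr//.
  have := kform_ge0 L0 (u m \- u n); nra.
have B0 m n : ipQ (e0 \* u m \- e0 \* u n) (e0 \* u m \- e0 \* u n) <=
    C0 * kform_of L0 (u m \- u n) (u m \- u n).
  rewrite -e0B.
  exact: (carleman_L2 hOmega omega_open hchi0 hK1 hK2_large hG hcarleman (PB m n)).
have B1 m n : ipQ (e1 \* L0 (u m) \- e1 \* L0 (u n)) (e1 \* L0 (u m) \- e1 \* L0 (u n)) <=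
    1 * kform_of L0 (u m \- u n) (u m \- u n).
  by rewrite mul1r kform_P0E// ip1B// lerDl ip_ind_ge0.
have [p [sp up]] := weighted_complete mQT e0_neq0 (fun n => s0 (Pu n)) (CC C0 _ (ltW hC0) B0).
have [q [sq uq]] := weighted_complete mQT e1_neq0 (fun n => s1 (Pu n)) (CC 1 _ ler01 B1).
have [r [sr ur]] := sqint_complete mO (fun n => sO (Pu n))
  (CC Ct _ Ct0 (fun m n => CtP _ (PB m n))).
by exists p, q, r; split.
Qed.

Let addrACA_sub (a b c e : R) : a - b - (c - e) = a - c - (b - e).
Proof. by ring. Qed.

Let ip_cvg0B d (Y : measurableType d) (m : {measure set Y -> \bar R}) D
    (u v : nat -> Y -> R) (f g : Y -> R) : measurable D ->
  (forall n, sqint m D (u n)) -> (forall n, sqint m D (v n)) -> sqint m D f -> sqint m D g ->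
  ip m D (u n \- f) (u n \- f) @[n --> \oo] --> 0 ->
  ip m D (v n \- g) (v n \- g) @[n --> \oo] --> 0 ->
  ip m D ((u n \- v n) \- (f \- g)) ((u n \- v n) \- (f \- g)) @[n --> \oo] --> 0.
Proof.
move=> mD su sv sf sg uf vg.
apply: (@squeeze_cvgr _ _ _ _ (cst 0)
  (fun n => 2 * ip m D (u n \- f) (u n \- f) + 2 * ip m D (v n \- g) (v n \- g))).
- apply: nearW => n; rewrite ip_ge0/=.
  rewrite (_ : (u n \- v n) \- (f \- g) = (u n \- f) \- (v n \- g)); last first.
    by apply/funext => y /=; exact: addrACA_sub.
  exact: ip_triangleB (sqintB mD (su n) sf) (sqintB mD (sv n) sg).
- exact: cvg_cst.
- rewrite -[X in _ --> X](_ : 2 * 0 + 2 * 0 = 0); last by rewrite mulr0 addr0.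
  by apply: cvgD; apply: cvgM => //; exact: cvg_cst.
Qed.

Lemma graph_cvgB u p q r u' p' q' r' : graph_cvg u p q r -> graph_cvg u' p' q' r' ->
  graph_cvg (fun n => u n \- u' n) (p \- p') (q \- q') (r \- r').
Proof.
move=> [P a0 a1 aO c0 c1 cO] [P' a0' a1' aO' c0' c1' cO'].
have eB (e f g : R * R * R -> R) : e \* (f \- g) = e \* f \- e \* g.
  by apply/funext => X /=; rewrite mulrBr.
split.
- by move=> n; exact: P0_B.
- by rewrite eB; exact: sqintB.
- by rewrite eB; exact: sqintB.
- exact: sqintB.
- have := ip_cvg0B mQT (fun n => s0 (P n)) (fun n => s0 (P' n)) a0 a0' c0 c0'.
  by under [X in _ -> X @ _ --> _]eq_fun do rewrite !eB.
- have := ip_cvg0B mQT (fun n => s1 (P n)) (fun n => s1 (P' n)) a1 a1' c1 c1'.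
  have -> // : (fun n => ipQ (e1 \* L0 (u n \- u' n) \- e1 \* (q \- q'))
     (e1 \* L0 (u n \- u' n) \- e1 \* (q \- q'))) =
   (fun n => ipQ ((e1 \* L0 (u n) \- e1 \* L0 (u' n)) \- (e1 \* q \- e1 \* q'))
     ((e1 \* L0 (u n) \- e1 \* L0 (u' n)) \- (e1 \* q \- e1 \* q'))).
  apply/funext => n; apply: eq_Rintegral => X /set_mem QX /=.
  by rewrite Lstar0_B// !mulrBr.
- exact: (ip_cvg0B mO (fun n => sO (P n)) (fun n => sO (P' n)) aO aO' cO cO').
Qed.

Lemma graph_cvg_energy u p q r : graph_cvg u p q r ->
  kform_of L0 (u n) (u n) @[n --> \oo] -->
    ipQ (e1 \* q) (e1 \* q) + ipQ (ind \* (e0 \* p)) (e0 \* p).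
Proof.
move=> [P a0 a1 aO c0 c1 cO].
under eq_fun do rewrite kform_P0E//.
apply: cvgD.
  exact: (ip_cvg2 mQT (fun n => s1 (P n)) (fun n => s1 (P n)) a1 a1 c1 c1).
apply: (ip_cvg2 mQT _ (fun n => s0 (P n)) _ a0 _ c0).
- by move=> n; apply: sqint_ind => //; exact: s0.
- exact: sqint_ind.
apply: (@squeeze_cvgr _ _ _ _ (cst 0)
  (fun n => ipQ (e0 \* u n \- e0 \* p) (e0 \* u n \- e0 \* p))) => //; last exact: cvg_cst.
apply: nearW => n; rewrite ip_ge0/=.
have sB : sqQ (e0 \* u n \- e0 \* p) by apply: sqintB => //; exact: s0.
apply: le_trans (ip_ind_le sB).
rewrite le_eqVlt; apply/orP; left; apply/eqP; apply: eq_Rintegral => X _ /=.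
by rewrite -!mulrBr mulrACA ind_sqr mulrA.
Qed.

(** Closability makes q vanish; then k (u n) (u n) tends to 0 and the trace bound
    forces r to vanish too. *)
Lemma graph_cvg_eq0 u p q r : graph_cvg u p q r -> ae_eq leb3 (QT : set R3m) p (cst 0) ->
  ae_eq leb3 (QT : set R3m) q (cst 0) /\ ae_eq leb2 (Omega : set R2m) r (cst 0).
Proof.
move=> g p0; have [P a0 a1 aO c0 c1 cO] := g.
have z3 (f : R3m -> R) : measurable_fun (QT : set R3m) f ->
    ae_eq leb3 (QT : set R3m) f (cst 0) -> ipQ f f = 0.
  have mc : measurable_fun (QT : set R3m) (cst 0 : R3m -> R) by exact: measurable_cst.
  move=> mf f0; rewrite (ae_ip mQT mf mc mf f0) /ip.
  by under eq_Rintegral do rewrite mul0r; rewrite Rintegral_cst// mul0r.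
have e0p : ae_eq leb3 (QT : set R3m) (e0 \* p) (cst 0).
  by move: p0; apply: filterS => X h QX; rewrite /= h// mulr0.
have c00 : ipQ (e0 \* u n) (e0 \* u n) @[n --> \oo] --> 0.
  by rewrite -(z3 _ a0.1 e0p); apply: (ip_cvg2 mQT (fun n => s0 (P n)) (fun n => s0 (P n))).
have q0 : ae_eq leb3 (QT : set R3m) q (cst 0) by exact: closable_weighted P a1 c00 c1.
split=> //.
have e1q : ae_eq leb3 (QT : set R3m) (e1 \* q) (cst 0).
  by move: q0; apply: filterS => X h QX; rewrite /= h// mulr0.
have k0 : kform_of L0 (u n) (u n) @[n --> \oo] --> 0.
  have := graph_cvg_energy g; rewrite (z3 _ a1.1 e1q) add0r.
  rewrite (_ : ipQ (ind \* (e0 \* p)) (e0 \* p) = 0)//.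
  apply/eqP; rewrite eq_le ip_ind_ge0 andbT -(z3 _ a0.1 e0p); exact: ip_ind_le.
have [Ct Ct0 CtP] := trace_bound hOmega omega_open hT hchi0 hK1 hK2_large hG hC0 hcarleman.
have t0 : ipO (tr0 (u n)) (tr0 (u n)) @[n --> \oo] --> 0.
  apply: (@squeeze_cvgr _ _ _ _ (cst 0) (fun n => Ct * kform_of L0 (u n) (u n))).
  - by apply: nearW => n; rewrite ip_ge0/=; exact: CtP.
  - exact: cvg_cst.
  - by rewrite -(mulr0 Ct); apply: cvgM => //; exact: cvg_cst.
have tr : ipO (tr0 (u n)) (tr0 (u n)) @[n --> \oo] --> ipO r r.
  exact: (ip_cvg2 mO (fun n => sO (P n)) (fun n => sO (P n)) aO aO cO cO).
by apply: (ip_eq0 mO aO); exact: (cvg_unique _ tr t0).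
Qed.

(** L^* p and p(., 0) do not depend on the approximating sequence. *)
Lemma graph_cvg_unique u p q r u' p' q' r' :
  graph_cvg u p q r -> graph_cvg u' p' q' r' -> ae_eq leb3 (QT : set R3m) p p' ->
  ae_eq leb3 (QT : set R3m) q q' /\ ae_eq leb2 (Omega : set R2m) r r'.
Proof.
move=> g g' pp'; have [] := graph_cvg_eq0 (graph_cvgB g g').
  by move: pp'; apply: filterS => X h QX; rewrite /= h// subrr.
move=> q0 r0; split.
  by move: q0; apply: filterS => X h QX; apply/eqP; rewrite -subr_eq0; apply/eqP; exact: h.
by move: r0; apply: filterS => x h Ox; apply/eqP; rewrite -subr_eq0; apply/eqP; exact: h.
Qed.

Let ae_cvg d (Y : measurableType d) (m : {measure set Y -> \bar R}) D
    (u : nat -> Y -> R) (f f' : Y -> R) : measurable D ->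
  (forall n, sqint m D (u n)) -> sqint m D f -> sqint m D f' -> ae_eq m D f f' ->
  ip m D (u n \- f) (u n \- f) @[n --> \oo] --> 0 ->
  ip m D (u n \- f') (u n \- f') @[n --> \oo] --> 0.
Proof.
move=> mD su sf sf' ff'.
have -> // : (fun n => ip m D (u n \- f) (u n \- f)) = (fun n => ip m D (u n \- f') (u n \- f')).
apply/funext => n; have s1' := sqintB mD (su n) sf; have s2' := sqintB mD (su n) sf'.
have ae : ae_eq m D (u n \- f) (u n \- f') by move: ff'; apply: filterS => y h Dy; rewrite /= h.
rewrite (ae_ip mD s1'.1 s2'.1 s1'.1 ae) ipC.
by rewrite (ae_ip mD s1'.1 s2'.1 s2'.1 ae).
Qed.

Lemma graph_cvg_ae u p q r q' r' : graph_cvg u p q r ->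
  sqQ (e1 \* q') -> ae_eq leb3 (QT : set R3m) q q' ->
  sqO r' -> ae_eq leb2 (Omega : set R2m) r r' -> graph_cvg u p q' r'.
Proof.
move=> [P a0 a1 aO c0 c1 cO] sq' qq' sr' rr'; split => //.
- apply: (ae_cvg mQT (fun n => s1 (P n)) a1 sq') => //.
  by move: qq'; apply: filterS => X h QX; rewrite /= h.
- exact: (ae_cvg mO (fun n => sO (P n)) aO sr').
Qed.

Local Notation PS := (P_space Omega omega T chi0 K1 K2 G).
Local Notation kappr := (k_approx Omega omega T chi0 K1 K2 G).
Local Notation LS := (Lstar Omega omega T chi0 K1 K2 G).
Local Notation T0 := (trace0 Omega omega T chi0 K1 K2 G).

Lemma wL2_inv_rho0P f : wL2 leb3 (QT : set R3m) (fun X => (rho_ 0 X)^-1) f <-> sqQ (e0 \* f).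
Proof. exact: (wL2P _ me0 me0V e0_neq0). Qed.

Lemma Z_spaceP f : Z_space Omega T chi0 K1 K2 f <-> sqQ (e1 \* f).
Proof. exact: (wL2P _ me1 me1V e1_neq0). Qed.

Lemma mul_cst1 (Y : Type) (f : Y -> R) : cst 1 \* f = f.
Proof. by apply/funext => y /=; rewrite mul1r. Qed.

Let mc1 : measurable_fun (Omega : set R2m) (cst 1 : R2m -> R).
Proof. exact: measurable_cst. Qed.

Lemma wL2_1P (f : R * R -> R) : wL2 leb2 (Omega : set R2m) (cst 1) f <-> sqO f.
Proof.
rewrite -[X in _ <-> sqO X]mul_cst1; by apply: (wL2P _ mc1) => [|x _]; [exact: (measurable_cst (1^-1 : R))|exact: oner_neq0].
Qed.

Lemma k_approx_graph u p : sqQ (e0 \* p) -> kappr u p -> exists q r, graph_cvg u p q r.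
Proof.
move=> sp [P cu up]; have [p' [q [r [_ sp' a1 aO c0 c1 cO]]]] := k_cauchy_graph_cvg P cu.
exists q, r; split => //.
by apply/(wL2_cvgP mQT (fun n => s0 (P n)) sp).
Qed.

Lemma graph_k_cauchy u p q r : graph_cvg u p q r -> k_cauchy u.
Proof.
move=> [P a0 a1 aO c0 c1 cO] e ep.
have e8 : 0 < e / 8 by rewrite divr_gt0.
have near_lt (F : nat -> R) : (forall n, 0 <= F n) -> F n @[n --> \oo] --> 0 ->
    \forall n \near \oo, F n < e / 8.
  move=> F0 /cvgrPdist_lt/(_ _ e8); apply: filterS => n.
  by rewrite sub0r normrN ger0_norm.
have [N0 _ H0] := near_lt _ (fun n => ip_ge0 _ _ _) c0.
have [N1 _ H1] := near_lt _ (fun n => ip_ge0 _ _ _) c1.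
exists (maxn N0 N1) => m n; rewrite !geq_max => /andP[m0 m1] /andP[n0 n1].
have dB (Y : Type) (f g h : Y -> R) : f \- g = (f \- h) \- (g \- h).
  by apply/funext => y /=; rewrite opprB addrA subrK.
have PB := P0_B (P m) (P n).
rewrite kform_P0E// ip1B//.
apply: (@le_lt_trans _ _ (ipQ (e1 \* L0 (u m) \- e1 \* L0 (u n)) (e1 \* L0 (u m) \- e1 \* L0 (u n)) +
  ipQ (e0 \* (u m \- u n)) (e0 \* (u m \- u n)))).
  by rewrite lerD2l; apply: ip_ind_le; exact: s0.
rewrite e0B (dB _ (e1 \* L0 (u m)) _ (e1 \* q)) (dB _ (e0 \* u m) _ (e0 \* p)).
have t1 := ip_triangleB mQT (sqintB mQT (s1 (P m)) a1) (sqintB mQT (s1 (P n)) a1).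
have t0 := ip_triangleB mQT (sqintB mQT (s0 (P m)) a0) (sqintB mQT (s0 (P n)) a0).
have hm0 := H0 m m0; have hn0 := H0 n n0; have hm1 := H1 m m1; have hn1 := H1 n n1.
move: t1 t0 hm0 hn0 hm1 hn1 => /=.
exact: cauchy_algebra.
Qed.

Lemma graph_cvg_k_approx u p q r : graph_cvg u p q r -> kappr u p.
Proof.
move=> g; have [P a0 a1 aO c0 c1 cO] := g; split => //.
  exact: graph_k_cauchy g.
by apply/(wL2_cvgP mQT (fun n => s0 (P n)) a0).
Qed.

Lemma graph_cvg_P_space u p q r : graph_cvg u p q r -> PS p.
Proof.
move=> g; split; first by apply/wL2_inv_rho0P; case: g.
by exists u; exact: graph_cvg_k_approx g.
Qed.

(** Lstar p and trace0 p are chosen independently, along possibly different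
    approximating sequences; by uniqueness of the graph limits they are equal almost
    everywhere to q and r, so the given u serves for both. *)
Lemma graph_cvg_operators u p q r : graph_cvg u p q r -> graph_cvg u p (LS p) (T0 p).
Proof.
move=> g; have [P a0 a1 aO c0 c1 cO] := g.
have [/Z_spaceP sL [u1 [ku1 cu1]]] : [set q | Z_space Omega T chi0 K1 K2 q /\ exists u, kappr u p /\
    wL2_cvg leb3 QT (fun X => (rho X)^-1) (fun n => L0 (u n)) q] (LS p).
  apply: xgetPex; exists q; split; first exact/Z_spaceP.
  exists u; split; first exact: graph_cvg_k_approx g.
  by apply/(wL2_cvgP mQT (fun n => s1 (P n)) a1).
have [/wL2_1P sT [u2 [ku2 cu2]]] : [set r | wL2 leb2 Omega (cst 1) r /\ exists u, kappr u p /\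
    wL2_cvg leb2 Omega (cst 1) (fun n x => u n (x, 0)) r] (T0 p).
  apply: xgetPex; exists r; split; first exact/wL2_1P.
  exists u; split; first exact: graph_cvg_k_approx g.
  apply/(wL2_cvgP mO); rewrite ?mul_cst1//; last by under eq_fun do rewrite mul_cst1.
  by move=> n; rewrite mul_cst1; exact: sO.
have aepp : ae_eq leb3 (QT : set R3m) p p by exact: aeW.
have [q1 [r1 [P1 b0 b1 bO d0 d1 dO]]] := k_approx_graph a0 ku1.
have g1 : graph_cvg u1 p (LS p) r1.
  by split => //; apply/(wL2_cvgP mQT (fun n => s1 (P1 n)) sL).
have [q2 [r2 [P2 b0' b1' bO' d0' d1' dO']]] := k_approx_graph a0 ku2.
have g2 : graph_cvg u2 p q2 (T0 p).
  split => //; move: cu2 => /(wL2_cvgP mO).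
  rewrite mul_cst1 => h; under eq_fun do rewrite -[X in X \- _]mul_cst1; apply: h => // n.
  by rewrite mul_cst1; exact: sO.
have [ae1 _] := graph_cvg_unique g g1 aepp.
have [_ ae2] := graph_cvg_unique g g2 aepp.
exact: (graph_cvg_ae g sL ae1 sT ae2).
Qed.

Lemma P_space_graph p : PS p -> exists u, graph_cvg u p (LS p) (T0 p).
Proof.
move=> [/wL2_inv_rho0P sp [u ku]]; have [q [r g]] := k_approx_graph sp ku.
by exists u; exact: graph_cvg_operators g.
Qed.

Lemma Lambda_spaceP f : Lambda_space Omega T chi0 K1 K2 f <-> sqQ (rho \* f).
Proof.
have mr : measurable_fun (QT : set R3m) rho.
  by apply: cm; exact: (@rho_continuous R Omega omega T chi0 K1 K2 hOmega hchi0).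
by apply: (wL2P _ mr me1) => X _; rewrite gt_eqF// rho_gt0.
Qed.

Let sLS p : PS p -> sqQ (e1 \* LS p).
Proof. by move=> /P_space_graph[u []]. Qed.
Let sP p : PS p -> sqQ (e0 \* p).
Proof. by move=> /P_space_graph[u []]. Qed.

(** The form k on pairs (p, q) with q in the role of L^* p; it is also alpha on
    pairs (q, p). *)
Definition graph_form p q p' q' : R :=
  ipQ (e1 \* q) (e1 \* q') + ipQ (ind \* (e0 \* p)) (e0 \* p').

Lemma kform_P_spaceE p p' : PS p -> PS p' ->
  kform Omega omega T chi0 K1 K2 G p p' = graph_form p (LS p) p' (LS p').
Proof.
move=> Pp Pp'.
exact: (kform_ofE hOmega omega_open (sLS Pp) (sLS Pp') (sP Pp) (sP Pp')).
Qed.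

Lemma P_spaceB p p' : PS p -> PS p' ->
  [/\ PS (p \- p'), ae_eq leb3 (QT : set R3m) (LS (p \- p')) (LS p \- LS p') &
    ae_eq leb2 (Omega : set R2m) (T0 (p \- p')) (T0 p \- T0 p')].
Proof.
move=> /P_space_graph[u g] /P_space_graph[u' g'].
have g2 := graph_cvgB g g'; have g3 := graph_cvg_operators g2.
have aepp : ae_eq leb3 (QT : set R3m) (p \- p') (p \- p') by exact: aeW.
by have [? ?] := graph_cvg_unique g3 g2 aepp; split => //; exact: graph_cvg_P_space g2.
Qed.

(** Both sides of carleman_L2 are continuous along graph convergence. *)
Lemma graph_carleman u p q r : graph_cvg u p q r ->
  ipQ (e0 \* p) (e0 \* p) <= C0 * graph_form p q p q.
Proof.
move=> g; have [P a0 a1 aO c0 c1 cO] := g.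
have h0 := ip_cvg2 mQT (fun n => s0 (P n)) (fun n => s0 (P n)) a0 a0 c0 c0.
have hk : C0 * kform_of L0 (u n) (u n) @[n --> \oo] --> C0 * graph_form p q p q.
  by apply: cvgM; [exact: cvg_cst|exact: graph_cvg_energy g].
apply: ler_cvg_to h0 hk _; apply: nearW => n.
exact: (carleman_L2 hOmega omega_open hchi0 hK1 hK2_large hG hcarleman (P n)).
Qed.

(** P0 is dense in P and both sides are continuous in p', so the variational equation
    has to be tested on P0 only. *)
Lemma graph_form_density (y0 : R * R -> R) p q : sqO y0 -> sqQ (e0 \* p) -> sqQ (e1 \* q) ->
  (forall v, P0 v -> graph_form p q v (L0 v) = ipO y0 (tr0 v)) ->
  forall p', PS p' -> graph_form p q p' (LS p') = ipO y0 (T0 p').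
Proof.
move=> sy sp sq H p' /P_space_graph[v [P a0 a1 aO c0 c1 cO]].
have l1 : graph_form p q (v n) (L0 (v n)) @[n --> \oo] --> graph_form p q p' (LS p').
  apply: cvgD; rewrite ipC; under eq_fun do rewrite ipC.
    exact: (ip_cvgl mQT (fun n => s1 (P n)) a1 sq c1).
  by apply: (ip_cvgl mQT (fun n => s0 (P n)) a0 _ c0); exact: sqint_ind.
have l2 : ipO y0 (tr0 (v n)) @[n --> \oo] --> ipO y0 (T0 p').
  rewrite ipC; under eq_fun do rewrite ipC.
  exact: (ip_cvgl mO (fun n => sO (P n)) aO sy cO).
move: l1; rewrite (funext (fun n => H _ (P n))) => l1.
exact: (cvg_unique _ l1 l2).
Qed.

(** y0 induces a linear form on P0 that is bounded for k, by Cauchy-Schwarz in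
    L^2(Omega) and the trace bound; the minimising sequence then converges in P. *)
Lemma exists_solves_A (y0 : R * R -> R) : sqO y0 ->
  exists p, solves_A Omega omega T chi0 K1 K2 G y0 p.
Proof.
move=> sy.
have [Ct Ct0 CtP] := trace_bound hOmega omega_open hT hchi0 hK1 hK2_large hG hC0 hcarleman.
have [] := @riesz_minimizing_sequence (R * R * R) R P0 (kform_of L0) (fun v => ipO y0 (tr0 v))
  (ipO y0 y0 * Ct).
- exact: P0_0.
- by move=> t f g; exact: P0_DZ.
- by move=> f g; apply: eq_Rintegral => X _; rewrite kform_sym_algebra.
- exact: kform_ge0.
- move=> t f g h Pf Pg Ph; have Pfg := P0_DZ hOmega t Pf Pg.
  rewrite !kform_P0E//.
  have -> : ipQ (e1 \* L0 (f \+ t \*: g)) (e1 \* L0 h) =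
      ipQ (e1 \* L0 f \+ (t \*: (e1 \* L0 g))) (e1 \* L0 h).
    apply: eq_Rintegral => X /set_mem QX /=.
    by rewrite (@Lstar0_DZ R Omega T G hOmega t f g Pf Pg X QX) mulrDr (mulrCA (e1 X)).
  have -> : ipQ (ind \* (e0 \* (f \+ t \*: g))) (e0 \* h) =
      ipQ (ind \* (e0 \* f) \+ (t \*: (ind \* (e0 \* g)))) (e0 \* h).
    apply: eq_Rintegral => X _ /=; exact: kform_linear_algebra.
  have i0 (w : R * R * R -> R) : P0 w -> sqQ (ind \* (e0 \* w)).
    by move=> /s0 ?; exact: sqint_ind.
  rewrite !ipDl ?ipZl//; do ?[exact: s1|exact: s0|exact: i0|
    by apply: sqintZ => //; first [exact: s1|exact: i0]].
  by rewrite mulrDr addrACA.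
- move=> t f g Pf Pg; rewrite ipC.
  rewrite [LHS](_ : _ = ipO (tr0 f \+ (t \*: tr0 g)) y0)//.
  rewrite ipDl ?ipZl//; do ?[exact: sO|by apply: sqintZ => //; exact: sO].
  by congr (_ + _ * _); rewrite ipC.
- move=> f Pf; apply: le_trans (cauchy_schwarz mO sy (sO Pf)) _.
  by rewrite -mulrA; apply: ler_wpM2l; [exact: ip_ge0|exact: CtP].
move=> u [Pu cu lu].
have [p [q [r g]]] := k_cauchy_graph_cvg Pu cu.
have [P a0 a1 aO c0 c1 cO] := g.
exists p; have Pp := graph_cvg_P_space g; split => // p' Pp'.
rewrite kform_P_spaceE//.
apply: (graph_form_density sy (sP Pp) (sLS Pp)) => // v Pv.
have [_ _ _ _ _ d1 _] := graph_cvg_operators g.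
have l2 : kform_of L0 (u n) v @[n --> \oo] --> graph_form p (LS p) v (L0 v).
  under eq_fun do rewrite kform_P0E//.
  apply: cvgD; first exact: (ip_cvgl mQT (fun n => s1 (P n)) (sLS Pp) (s1 Pv) d1).
  rewrite ip_ind; under eq_fun do rewrite ip_ind.
  apply: (ip_cvgl mQT (fun n => s0 (P n)) a0 _ c0); apply: sqint_ind => //; exact: s0.
exact: (cvg_unique _ l2 (lu v Pv)).
Qed.

Variable y0 : R * R -> R.
Hypothesis sy : sqO y0.
Local Notation solA := (solves_A Omega omega T chi0 K1 K2 G y0).
Local Notation solB := (solves_B Omega omega T chi0 K1 K2 G y0).
Local Notation alpha := (alpha Omega omega T chi0 K1 K2).
Local Notation beta := (beta Omega omega T chi0 K1 K2 G).

Lemma alphaE z p z' p' : sqQ (e1 \* z) -> sqQ (e1 \* z') -> PS p -> PS p' ->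
  alpha (z, p) (z', p') = graph_form p z p' z'.
Proof.
move=> sz sz' Pp Pp'; rewrite /graph_form /ip -RintegralD//.
- apply: eq_Rintegral => X _ /=; rewrite /inv_rho /inv_rho0 -/(ind X) -!exprVn.
  exact: alpha_algebra.
- exact: integrable_mul.
- by apply: integrable_mul => //; [apply: sqint_ind => //; exact: sP|exact: sP].
Qed.

Let e1B f g : e1 \* (f \- g) = e1 \* f \- e1 \* g.
Proof. by apply/funext => X /=; rewrite mulrBr. Qed.

(** The opposite weights of Z and Lambda cancel in the duality bracket. *)
Lemma betaE z p lam : beta (z, p) lam = ipQ (e1 \* LS p \- e1 \* z) (rho \* lam).
Proof.
apply: eq_Rintegral => X _ /=; rewrite -mulrBr mulrACA /inv_rho mulVf ?mul1r//.
by rewrite gt_eqF// rho_gt0.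
Qed.

Let rho_e1 (f : R * R * R -> R) : rho \* (fun X => e1 X ^+ 2 * f X) = e1 \* f.
Proof.
apply/funext => X /=; rewrite mulrA expr2 mulrA /inv_rho divff ?mul1r//.
by rewrite gt_eqF// rho_gt0.
Qed.

Let e1_rho (f : R * R * R -> R) : e1 \* (fun X => rho X ^+ 2 * f X) = rho \* f.
Proof.
apply/funext => X /=; rewrite mulrA expr2 mulrA /inv_rho mulVf ?mul1r//.
by rewrite gt_eqF// rho_gt0.
Qed.

Let ae_e1 f g : ae_eq leb3 (QT : set R3m) f g -> ae_eq leb3 (QT : set R3m) (e1 \* f) (e1 \* g).
Proof. by apply: filterS => X h QX; rewrite /= h. Qed.

Let ip_e1_ae f f' g : sqQ (e1 \* f) -> sqQ (e1 \* f') -> sqQ (e1 \* g) ->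
  ae_eq leb3 (QT : set R3m) f f' -> ipQ (e1 \* f) (e1 \* g) = ipQ (e1 \* f') (e1 \* g).
Proof. by move=> [mf _] [mf' _] [mg _] /ae_e1; exact: ae_ip. Qed.

(** With lambda = rho^-2 L^* p, the bracket beta adds the L^* p' term of k and removes
    the z' term of alpha, turning alpha into k. *)
Lemma solves_A_B p : solA p -> solB (LS p, p) (fun X => e1 X ^+ 2 * LS p X).
Proof.
move=> [Pp Hp]; have sL := sLS Pp.
have sl : sqQ (rho \* (fun X => e1 X ^+ 2 * LS p X)) by rewrite rho_e1.
split => //; [exact/Z_spaceP|exact/Lambda_spaceP|].
move=> z' p' lam' /Z_spaceP sz' Pp' _; split.
  have sL' := sLS Pp'.
  have b1 : beta (z', p') (fun X => e1 X ^+ 2 * LS p X) =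
      ipQ (e1 \* LS p') (e1 \* LS p) - ipQ (e1 \* z') (e1 \* LS p).
    rewrite betaE rho_e1; exact: ipBl.
  rewrite [X in X + _ = _](alphaE sL sz' Pp Pp') [X in _ + X = _]b1.
  have := Hp _ Pp'; rewrite (kform_P_spaceE Pp Pp') => H.
  rewrite [RHS](_ : _ = graph_form p (LS p) p' (LS p')); last by rewrite H.
  rewrite /graph_form [ipQ (e1 \* LS p') _]ipC [ipQ (e1 \* z') _]ipC.
  exact: solves_B_algebra.
have b0 : beta (LS p, p) lam' = ipQ (e1 \* LS p \- e1 \* LS p) (rho \* lam') by exact: betaE.
rewrite b0 /ip.
under eq_Rintegral do rewrite /= subrr mul0r.
by rewrite Rintegral_cst// mul0r.
Qed.

(** Test the second equation with lambda' = rho^-2 (L^* p - z), which turns it into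
    the squared norm of L^* p - z. *)
Lemma solves_B_z z p lam : solB (z, p) lam -> ae_eq leb3 (QT : set R3m) z (LS p).
Proof.
move=> [/Z_spaceP sz Pp /Lambda_spaceP sl H] /=; have sL := sLS Pp.
have sd : sqQ (e1 \* (LS p \- z)) by rewrite e1B; exact: sqintB.
have Ll : Lambda_space Omega T chi0 K1 K2 (fun X => e1 X ^+ 2 * (LS p \- z) X).
  by apply/Lambda_spaceP; rewrite rho_e1.
have [_] := H z p _ ((Z_spaceP z).2 sz) Pp Ll.
rewrite betaE rho_e1 -e1B => /(weighted_eq0 mQT e1_neq0 sd).
by apply: filterS => X h QX; apply/esym/eqP; rewrite -subr_eq0; apply/eqP; exact: h.
Qed.

(** With z' = L^* p' the bracket with the multiplier disappears. *)
Lemma solves_B_A z p lam : solB (z, p) lam -> solA p.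
Proof.
move=> hB; have ae := solves_B_z hB.
have [/Z_spaceP sz Pp /Lambda_spaceP sl H] := hB; rewrite /= in sz Pp sl.
have sL := sLS Pp; split => // p' Pp'; have sL' := sLS Pp'.
have [E _] := H (LS p') p' lam ((Z_spaceP _).2 sL') Pp' ((Lambda_spaceP _).2 sl).
have b0 : beta (LS p', p') lam = 0.
  rewrite betaE /ip; under eq_Rintegral do rewrite /= subrr mul0r.
  by rewrite Rintegral_cst// mul0r.
move: E; rewrite [X in X + _ = _](alphaE sz sL' Pp Pp') [X in _ + X = _]b0 addr0 => E.
rewrite (kform_P_spaceE Pp Pp') -[RHS]E; congr (_ + _).
by apply: ip_e1_ae => //; apply: filterS ae => X h QX; rewrite h.
Qed.

(** Test the first equation with p' = 0 and z' = z - rho^2 lambda: what remains is the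
    squared norm of z'. *)
Lemma solves_B_lam z p lam : solB (z, p) lam ->
  ae_eq leb3 (QT : set R3m) lam (fun X => e1 X ^+ 2 * z X).
Proof.
move=> hB; have [/Z_spaceP sz Pp /Lambda_spaceP sl H] := hB; rewrite /= in sz Pp sl.
(* the zero function is obtained as p - p, whose L^* and trace vanish a.e. *)
have [Po aeL aeT] := P_spaceB Pp Pp; set o := p \- p in Po aeL aeT.
have sLo := sLS Po.
have o0 X : o X = 0 by rewrite /o/= subrr.
pose z' X := z X - rho X ^+ 2 * lam X.
have z'E : e1 \* z' = e1 \* z \- rho \* lam.
  by rewrite -(e1_rho lam) -e1B.
have sz' : sqQ (e1 \* z') by rewrite z'E; exact: sqintB.
have [E _] := H z' o lam ((Z_spaceP _).2 sz') Po ((Lambda_spaceP _).2 sl).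
have t0 : ell Omega omega T chi0 K1 K2 G y0 (z', o) = 0.
  have [_ [_ _ _ sT _ _ _]] := P_space_graph Po.
  have mc : measurable_fun (Omega : set R2m) (cst 0 : R2m -> R) by exact: measurable_cst.
  rewrite (_ : ell _ _ _ _ _ _ _ _ _ = ipO (T0 o) y0); last by rewrite ipC.
  rewrite (@ae_ip _ _ _ _ _ mO (T0 o) (cst 0) y0)//; [|by case: sT|by case: sy|].
    by rewrite /ip; under eq_Rintegral do rewrite mul0r; rewrite Rintegral_cst// mul0r.
  by move: aeT; apply: filterS => x h Ox; rewrite h//= subrr.
have b1 : beta (z', o) lam = - ipQ (e1 \* z') (rho \* lam).
  rewrite betaE ipBl// -[RHS]sub0r; congr (_ - _).
  have mc : measurable_fun (QT : set R3m) (cst 0 : R3m -> R) by exact: measurable_cst.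
  rewrite (@ae_ip _ _ _ _ _ mQT (e1 \* LS o) (cst 0) (rho \* lam))//; [|by case: sLo|by case: sl|].
    by rewrite /ip; under eq_Rintegral do rewrite mul0r; rewrite Rintegral_cst// mul0r.
  by move: aeL; apply: filterS => X h QX; rewrite /= h//= subrr mulr0.
have a1 : graph_form p z o z' = ipQ (e1 \* z') (e1 \* z).
  rewrite /graph_form [ipQ (e1 \* z) _]ipC -[RHS]addr0; congr (_ + _).
  rewrite /ip; under eq_Rintegral do rewrite /= o0 !mulr0.
  by rewrite Rintegral_cst// mul0r.
move: E; rewrite [X in X + _ = _](alphaE sz sz' Pp Po) [X in _ + X = _]b1 a1 t0.
rewrite ![ipQ (e1 \* z') _]ipC -ipBl// -z'E => /(ip_eq0 mQT sz').
apply: filterS => X h QX; have := h QX; rewrite z'E /= => /eqP.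
rewrite subr_eq0 => /eqP; rewrite /inv_rho; exact: lam_algebra (rho_gt0 _ _ _ _ X).
Qed.

(** The difference d of two solutions is orthogonal to itself for k, and the Carleman
    inequality on P then gives d = 0. *)
Lemma solves_A_unique p p' : solA p -> solA p' -> ae_eq leb3 (QT : set R3m) p p'.
Proof.
move=> [Pp Hp] [Pp' Hp'].
have [Pd aeL _] := P_spaceB Pp Pp'; set d := p \- p' in Pd aeL.
have sd := sP Pd; have sLd := sLS Pd; have sL := sLS Pp; have sL' := sLS Pp'.
have s0p := sP Pp; have s0p' := sP Pp'.
have [u g] := P_space_graph Pd.
have E : graph_form p (LS p) d (LS d) = graph_form p' (LS p') d (LS d).
  by rewrite -!kform_P_spaceE// Hp// Hp'.
have F : graph_form d (LS d) d (LS d) = 0.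
  rewrite /graph_form (@ip_e1_ae (LS d) (LS p \- LS p'))//; last by rewrite e1B; exact: sqintB.
  rewrite e1B ipBl//.
  have -> : ind \* (e0 \* d) = ind \* (e0 \* p) \- ind \* (e0 \* p').
    by apply/funext => X /=; rewrite -!mulrBr.
  rewrite ipBl//; [|by apply: sqint_ind|by apply: sqint_ind].
  move: E; rewrite /graph_form => E; exact: solves_A_unique_algebra E.
have := graph_carleman g; rewrite F mulr0 => le0.
have /(weighted_eq0 mQT e0_neq0 sd) : ipQ (e0 \* d) (e0 \* d) = 0.
  by apply/eqP; rewrite eq_le le0 ip_ge0.
by apply: filterS => X h QX; apply/eqP; rewrite -subr_eq0; apply/eqP; exact: h.
Qed.

(** Lstar is chosen for each function separately, so its compatibility with equality
    almost everywhere comes from uniqueness of graph limits. *)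
Lemma P_space_ae_Lstar p p' : PS p -> PS p' -> ae_eq leb3 (QT : set R3m) p p' ->
  ae_eq leb3 (QT : set R3m) (LS p) (LS p').
Proof.
move=> /P_space_graph[u g] /P_space_graph[u' g'] pp'.
by have [] := graph_cvg_unique g g' pp'.
Qed.

End Completion.

Unset Implicit Arguments.

Theorem proposition2 (R : realType)
    (Omega omega : set (R * R)) (T : R)
    (chi0 : R * R -> R) (K1 K2 C0 : R)
    (G : R * R * R -> R) (y0 : R * R -> R)
    (hOmega : bounded_domain Omega) (hGamma : C2_boundary Omega)
    (omega_open : open omega) (omega_nonempty : omega !=set0)
    (omega_sub : omega `<=` Omega) (hT : 0 < T)
    (hchi0 : admissible_chi0 Omega omega chi0)
    (hK1 : 0 < K1) (hK2 : 0 < K2)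
    (hK2_large : forall x, closure Omega x -> chi0 x < K2)
    (hG : Linfty leb3 (cylinder Omega T) G)
    (hC0 : 0 < C0)
    (hcarleman : carleman Omega omega T chi0 K1 K2 G C0)
    (hy0 : wL2 leb2 Omega (cst 1) y0) :
  let QT := cylinder Omega T in
  let solA := solves_A Omega omega T chi0 K1 K2 G y0 in
  let solB := solves_B Omega omega T chi0 K1 K2 G y0 in
  [/\ exists z p lam, solB (z, p) lam /\
        forall z' p' lam', solB (z', p') lam' ->
          [/\ ae_eq leb3 QT z' z, ae_eq leb3 QT p' p & ae_eq leb3 QT lam' lam],
      forall z p lam, solB (z, p) lam -> solA p &
      forall p, solA p ->
        exists2 lam, Lambda_space Omega T chi0 K1 K2 lam &
          solB (Lstar Omega omega T chi0 K1 K2 G p, p) lam].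
Proof.
move=> QT solA solB.
have sy : sqint leb2 (Omega : set (measurableTypeR R * measurableTypeR R)%type) y0.
  exact: (wL2_1P Omega y0).1 hy0.
have AB p : solA p -> solB (Lstar Omega omega T chi0 K1 K2 G p, p)
    (fun X => inv_rho T chi0 K1 K2 X ^+ 2 * Lstar Omega omega T chi0 K1 K2 G p X).
  exact: (solves_A_B hOmega omega_open hT hchi0 hK1 hK2_large hG hC0 hcarleman).
have BA z p lam : solB (z, p) lam -> solA p.
  exact: (solves_B_A hOmega omega_open hT hchi0 hK1 hK2_large hG hC0 hcarleman).
split.
- have [p Ap] := exists_solves_A hOmega omega_open hT hchi0 hK1 hK2_large hG hC0 hcarleman sy.
  exists (Lstar Omega omega T chi0 K1 K2 G p), p,
    (fun X => inv_rho T chi0 K1 K2 X ^+ 2 * Lstar Omega omega T chi0 K1 K2 G p X).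
  split; first exact: AB.
  move=> z' p' lam' B'; have Ap' := BA _ _ _ B'.
  have pp' := solves_A_unique hOmega omega_open hT hchi0 hK1 hK2_large hG hC0 hcarleman Ap' Ap.
  have zL := solves_B_z hOmega omega_open hT hchi0 hK1 hK2_large hG hC0 hcarleman B'.
  have lz := solves_B_lam hOmega omega_open hT hchi0 hK1 hK2_large hG hC0 hcarleman sy B'.
  have LL := P_space_ae_Lstar hOmega omega_open hT hchi0 hK1 hK2_large hG hC0 hcarleman
    Ap'.1 Ap.1 pp'.
  have zz : ae_eq leb3 QT z' (Lstar Omega omega T chi0 K1 K2 G p) by exact: ae_eq_trans LL.
  split => //.
  by apply: filterS2 lz zz => X h1 h2 QX; rewrite h1// h2.
- exact: BA.
- move=> p Ap; exists (fun X => inv_rho T chi0 K1 K2 X ^+ 2 * Lstar Omega omega T chi0 K1 K2 G p X).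
    by have [_ _] := AB p Ap.
  exact: AB.
Qed.
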